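(* Let $n\ge 1$ and let $\mathfrak{g}$ be either the periplectic Lie superalgebra $\tilde{\mathfrak{p}}(n)$ or the queer Lie superalgebra $\mathfrak{q}(n)$ over $\mathbf{k}$. Then the first super Kac-Weisfeiler conjecture holds for $\mathfrak{g}$: the maximal dimension of irreducible $\mathfrak{g}$-modules is $$p^{\frac{b_0}{2}}2^{\lceil\frac{b_1}{2}\rceil}:=\max_{\theta\in \mathfrak{g}_{\bar 0}^*}p^{\frac{b^\theta_0}{2}}2^{\lceil\frac{b^\theta_1}{2}\rceil}.$$
   Context: $\mathbf{k}$ is an algebraically closed field of characteristic $p>2$. All vector spaces, modules and subalgebras are understood in the super ($\mathbb{Z}_2$-graded) sense, and all Lie superalgebras are finite-dimensional; $\dim V=\dim V_{\bar 0}+\dim V_{\bar 1}$. $\tilde{\mathfrak{p}}(n)$ is the Lie subsuperalgebra of $\mathfrak{gl}(n|n)$ of all matrices $\begin{pmatrix} A & B\\ C & -A^{t}\end{pmatrix}$ with $A,B,C$ of size $n\times n$, $B=B^{t}$, $C=-C^{t}$. $\mathfrak{q}(n)$ is the Lie subsuperalgebra of $\mathfrak{gl}(n|n)$ of all matrices $\begin{pmatrix} A & B\\ B & A\end{pmatrix}$ with $A,B$ arbitrary $n\times n$ matrices. In both cases $\mathfrak{g}_{\bar 0}\cong\mathfrak{gl}(n)$ (block-diagonal matrices) and $\mathfrak{g}$ is a restricted Lie superalgebra, with $p$-mapping on $\mathfrak{g}_{\bar 0}$ given by the $p$-th power of matrices. For a restricted Lie superalgebra $\mathfrak{g}=\mathfrak{g}_{\bar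 0}\oplus\mathfrak{g}_{\bar 1}$ and $\theta\in\mathfrak{g}_{\bar 0}^*$ (extended to $\mathfrak{g}$ by $\theta(\mathfrak{g}_{\bar 1})=0$), let $\mathfrak{g}^\theta=\{X\in\mathfrak{g}\mid\theta([X,\mathfrak{g}])=0\}=\mathfrak{g}^\theta_{\bar 0}\oplus\mathfrak{g}^\theta_{\bar 1}$, and set $b_0^\theta=\dim\mathfrak{g}_{\bar 0}-\dim\mathfrak{g}_{\bar 0}^\theta$ (always even) and $b_1^\theta=\dim\mathfrak{g}_{\bar 1}-\dim\mathfrak{g}_{\bar 1}^\theta$. $\lceil a\rceil$ denotes the least integer $\geq a$. *)

(* Defs.v *)
From HB Require Import structures.
From mathcomp Require Import all_boot all_order all_algebra.
From mathcomp Require Import ring.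

Set Implicit Arguments.
Unset Strict Implicit.
Unset Printing Implicit Defensive.

Import GRing.Theory.
Local Open Scope ring_scope.

(* Parities are booleans ([false] is even), so that the sum of two parities is
   [a (+) b] and the sign (-1)^{|X||Y|} is [(-1) ^+ (a && b)]. *)

Local Ltac mx_zmod :=
  repeat match goal with |- context [?A *m ?B] => move: (A *m B) => ? end;
  apply/matrixP => ? ?; rewrite !mxE; ring.

Section GeneralLinear.
Variables (k : fieldType) (n : nat).
Implicit Types (X Y : 'M[k]_(n + n)) (a b : bool).

Definition hpart b X : 'M[k]_(n + n) :=
  if b then block_mx 0 (ursubmx X) (dlsubmx X) 0
  else block_mx (ulsubmx X) 0 0 (drsubmx X).

Arguments hpart : simpl never.

Fact hpart_is_linear b : linear (hpart b).
Proof.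
move=> c X Y; rewrite /hpart /ulsubmx /ursubmx /dlsubmx /drsubmx.
by case: b; rewrite scale_block_mx add_block_mx !scaler0 !addr0 !linearP.
Qed.
HB.instance Definition _ b :=
  GRing.isLinear.Build k 'M[k]_(n + n) 'M[k]_(n + n) _ (hpart b)
    (hpart_is_linear b).

Lemma hpartD X : X = hpart false X + hpart true X.
Proof. by rewrite /hpart add_block_mx !addr0 !add0r submxK. Qed.

Lemma hpart_hpart a b X : hpart a (hpart b X) = if a == b then hpart b X else 0.
Proof.
by rewrite /hpart; case: a; case: b => /=; rewrite ?block_mxKul ?block_mxKur
  ?block_mxKdl ?block_mxKdr // /block_mx !row_mx0 col_mx0.
Qed.

Definition gl_part b : {vspace 'M[k]_(n + n)} := limg (linfun (hpart b)).

Lemma gl_partP b X : reflect (hpart b X = X) (X \in gl_part b).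
Proof.
apply: (iffP memv_imgP) => [[Y _ ->]|XE].
  by rewrite lfunE /= hpart_hpart eqxx.
by exists X; rewrite ?memvf // lfunE.
Qed.

(* The bilinear extension of [X, Y] = XY - (-1)^{|X||Y|} YX. *)
Definition superbracket X Y : 'M[k]_(n + n) :=
  X *m Y - \sum_(a : bool) \sum_(b : bool)
             (-1) ^+ (a && b) *: (hpart b Y *m hpart a X).

Lemma superbracket_homogeneous a b X Y : X \in gl_part a -> Y \in gl_part b ->
  superbracket X Y = X *m Y - (-1) ^+ (a && b) *: (Y *m X).
Proof.
move=> /gl_partP <- /gl_partP <-; rewrite /superbracket !big_bool /=.
rewrite !hpart_hpart.
by case: a; case: b; rewrite /= ?mul0mx ?mulmx0 ?scaler0 ?addr0 ?add0r.
Qed.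

Fact superbracket_is_linear_l Y : linear (superbracket^~ Y).
Proof.
move=> c X X'; rewrite /superbracket mulmxDl -scalemxAl scalerBr addrACA.
rewrite -opprD; congr (_ - _); rewrite scaler_sumr -big_split.
apply: eq_bigr => a _ /=; rewrite scaler_sumr -big_split.
apply: eq_bigr => b _ /=; rewrite linearP mulmxDr -scalemxAr scalerDr.
by rewrite !scalerA mulrC.
Qed.

Fact superbracket_is_linear_r X : linear (superbracket X).
Proof.
move=> c Y Y'; rewrite /superbracket mulmxDr -scalemxAr scalerBr addrACA.
rewrite -opprD; congr (_ - _); rewrite scaler_sumr -big_split.
apply: eq_bigr => a _ /=; rewrite scaler_sumr -big_split.
apply: eq_bigr => b _ /=; rewrite linearP mulmxDl -scalemxAl scalerDr.
by rewrite !scalerA mulrC.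
Qed.
HB.instance Definition _ X :=
  GRing.isLinear.Build k 'M[k]_(n + n) 'M[k]_(n + n) _ (superbracket X)
    (superbracket_is_linear_r X).

Definition lie_subsuperalgebra (g : {vspace 'M[k]_(n + n)}) : Prop :=
  (forall b X, X \in g -> hpart b X \in g) /\
  (forall X Y, X \in g -> Y \in g -> superbracket X Y \in g).

Definition periplectic : {vspace 'M[k]_(n + n)} :=
  (lker (linfun (fun X => drsubmx X + (ulsubmx X)^T)%R) :&:
   lker (linfun (fun X => ursubmx X - (ursubmx X)^T)%R) :&:
   lker (linfun (fun X => dlsubmx X + (dlsubmx X)^T)%R))%VS.

Definition queer : {vspace 'M[k]_(n + n)} :=
  (lker (linfun (fun X => drsubmx X - ulsubmx X)%R) :&:
   lker (linfun (fun X => dlsubmx X - ursubmx X)%R))%VS.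

Lemma mem_lker_linfun (W : vectType k) (f : 'M[k]_(n + n) -> W) X :
  linear f -> (X \in lker (linfun f)) = (f X == 0).
Proof.
move=> f_lin; pose h := GRing.isLinear.Build k _ _ _ f f_lin.
pose F : {linear 'M[k]_(n + n) -> W} := HB.pack f h.
by rewrite memv_ker -[f]/(F : _ -> _) lfunE.
Qed.

Lemma periplecticP X :
  reflect (exists A B C : 'M[k]_n,
             [/\ X = block_mx A B C (- A^T), B = B^T & C = - C^T])
          (X \in periplectic).
Proof.
rewrite /periplectic !memv_cap !mem_lker_linfun; first last.
- by move=> c Y Z; apply/matrixP => ? ?; rewrite !mxE; ring.
- by move=> c Y Z; apply/matrixP => ? ?; rewrite !mxE; ring.
- by move=> c Y Z; apply/matrixP => ? ?; rewrite !mxE; ring.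
apply: (iffP andP) => [[/andP[]]|[A [B [C [-> BE CE]]]]].
  rewrite addr_eq0 subr_eq0 addr_eq0 => /eqP drE /eqP urE /eqP dlE.
  exists (ulsubmx X), (ursubmx X), (dlsubmx X); split=> //.
  by rewrite -drE submxK.
rewrite block_mxKul block_mxKur block_mxKdl block_mxKdr addNr -BE subrr eqxx.
by rewrite {1}CE addNr eqxx.
Qed.

Lemma queerP X :
  reflect (exists A B : 'M[k]_n, X = block_mx A B B A) (X \in queer).
Proof.
rewrite /queer !memv_cap !mem_lker_linfun; first last.
- by move=> c Y Z; apply/matrixP => ? ?; rewrite !mxE; ring.
- by move=> c Y Z; apply/matrixP => ? ?; rewrite !mxE; ring.
rewrite !subr_eq0; apply: (iffP andP) => [[/eqP drE /eqP dlE]|[A [B ->]]].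
  exists (ulsubmx X), (ursubmx X).
  by rewrite -{2}dlE -[in X in block_mx _ _ _ X]drE submxK.
by rewrite block_mxKul block_mxKur block_mxKdl block_mxKdr !eqxx.
Qed.

Lemma superbracket_block (A B C D A' B' C' D' : 'M[k]_n) :
  superbracket (block_mx A B C D) (block_mx A' B' C' D') =
  block_mx (A *m A' - A' *m A + (B *m C' + B' *m C))
           (A *m B' - B' *m D + (B *m D' - A' *m B))
           (C *m A' - D' *m C + (D *m C' - C' *m A))
           (D *m D' - D' *m D + (C *m B' + C' *m B)).
Proof.
rewrite /superbracket !big_bool /hpart /= expr0 expr1 !scale1r scaleN1r.
rewrite !block_mxKul !block_mxKur !block_mxKdl !block_mxKdr !mulmx_block.
rewrite !mulmx0 !mul0mx !addr0 !add0r !opp_block_mx !add_block_mx !opp_block_mx.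
rewrite !add_block_mx !oppr0 !addr0 !add0r.
by congr block_mx; mx_zmod.
Qed.

Lemma periplectic_lie : lie_subsuperalgebra periplectic.
Proof.
have trD (P Q : 'M[k]_n) : (P + Q)^T = P^T + Q^T by exact: raddfD.
have trN (P : 'M[k]_n) : (- P)^T = - P^T by exact: raddfN.
split=> [b X /periplecticP[A [B [C [-> BE CE]]]]|X Y].
  apply/periplecticP; rewrite /hpart !block_mxKul !block_mxKur !block_mxKdl.
  rewrite block_mxKdr; case: b; [exists 0, B, C | exists A, 0, 0];
  by rewrite ?trmx0 ?oppr0.
move=> /periplecticP[A [B [C [-> BE CE]]]].
move=> /periplecticP[A' [B' [C' [-> BE' CE']]]].
rewrite superbracket_block; apply/periplecticP; do 3!eexists; split.
- congr block_mx; rewrite !(trD, trN) !trmx_mul -BE -BE'.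
  have -> : C^T = - C by rewrite {2}CE opprK.
  have -> : C'^T = - C' by rewrite {2}CE' opprK.
  by rewrite ?(mulmxN, mulNmx); mx_zmod.
- rewrite !(trD, trN) !trmx_mul !trN !trmxK -BE -BE'.
  by rewrite ?(mulmxN, mulNmx); mx_zmod.
rewrite !(trD, trN) !trmx_mul !trN !trmxK.
have -> : C^T = - C by rewrite {2}CE opprK.
have -> : C'^T = - C' by rewrite {2}CE' opprK.
by rewrite ?(mulmxN, mulNmx); mx_zmod.
Qed.

Lemma queer_lie : lie_subsuperalgebra queer.
Proof.
split=> [b X /queerP[A [B ->]]|X Y /queerP[A [B ->]] /queerP[A' [B' ->]]].
  apply/queerP; rewrite /hpart block_mxKul block_mxKur block_mxKdl block_mxKdr.
  by case: b; [exists 0, B | exists A, 0].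
rewrite superbracket_block; apply/queerP; do 2!eexists; congr block_mx.
exact: addrC.
Qed.

End GeneralLinear.

Section Coadjoint.
Variables (k : fieldType) (n : nat) (g : {vspace 'M[k]_(n + n)}).

Definition even_dual := 'Hom(subvs_of (g :&: gl_part k n false)%VS, k^o).

Implicit Types theta : even_dual.

(* Extension by zero on the odd part of g; only its values on g matter. *)
Definition extend_form theta (X : 'M[k]_(n + n)) : k :=
  theta (vsproj (g :&: gl_part k n false)%VS (hpart false X)).

(* The radical of (X, Y) |-> theta([X, Y]) on g, see [centralizerP]. *)
Definition centralizer theta : {vspace 'M[k]_(n + n)} :=
  (g :&: \bigcap_(Y <- vbasis g)
           lker (linfun (fun X => extend_form theta (superbracket X Y) : k^o)))%VS.

Fact extend_form_is_linear theta : linear (extend_form theta : _ -> k^o).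
Proof. by move=> c X Y; rewrite /extend_form !linearP. Qed.

Lemma centralizerP theta X :
  reflect (X \in g /\
           forall Y, Y \in g -> extend_form theta (superbracket X Y) = 0)
          (X \in centralizer theta).
Proof.
have lin Y : linear (fun Z => extend_form theta (superbracket Z Y) : k^o).
  by move=> c Z Z'; rewrite superbracket_is_linear_l extend_form_is_linear.
pose F := GRing.isLinear.Build k _ _ _ _ (extend_form_is_linear theta).
pose f : {linear 'M[k]_(n + n) -> k^o} :=
  HB.pack (extend_form theta : _ -> k^o) F.
have bigcapP (s : seq 'M[k]_(n + n)) :
    X \in (\bigcap_(Y <- s)
      lker (linfun (fun Z => extend_form theta (superbracket Z Y) : k^o)))%VS
    = all (fun Y => extend_form theta (superbracket X Y) == 0) s.
  elim: s => [|Y s IHs]; first by rewrite big_nil memvf.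
  by rewrite big_cons memv_cap IHs (mem_lker_linfun _ (lin Y)).
rewrite /centralizer memv_cap bigcapP.
apply: (iffP andP) => -[gX fX]; split=> //; last first.
  by apply/allP => Y /vbasis_mem /fX ->.
move=> Y gY; rewrite (coord_vbasis gY) linear_sum.
rewrite -[extend_form _]/(f : _ -> _) linear_sum.
apply: big1 => i _; rewrite !linearZ /=.
have s_i : (vbasis g)`_i \in vbasis g by rewrite mem_nth ?size_tuple.
by move/allP: fX => /(_ _ s_i)/eqP->; rewrite scaler0.
Qed.

(* b_0^theta for [b = false], b_1^theta for [b = true]. *)
Definition orbit_dim (b : bool) theta : nat :=
  (\dim (g :&: gl_part k n b) - \dim (centralizer theta :&: gl_part k n b))%N.

Definition kw_number (p : nat) theta : nat :=
  (p ^ (orbit_dim false theta)./2 * 2 ^ uphalf (orbit_dim true theta))%N.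

End Coadjoint.

Section Modules.
Variables (k : fieldType) (n : nat) (g : {vspace 'M[k]_(n + n)}).

Definition homogeneous (V0 V1 : lmodType k) (b : bool) (v : V0 * V1) : Prop :=
  if b then v.1 = 0 else v.2 = 0.

Record supermodule := Supermodule {
  sm_even : lmodType k;
  sm_odd : lmodType k;
  sm_act : subvs_of g -> sm_even * sm_odd -> sm_even * sm_odd;
  sm_act_linear_l : forall v, linear (sm_act^~ v);
  sm_act_linear_r : forall x, linear (sm_act x);
  sm_act_parity : forall (a b : bool) (x : subvs_of g) (v : sm_even * sm_odd),
    vsval x \in gl_part k n a -> homogeneous b v ->
    homogeneous (a (+) b) (sm_act x v);
  sm_act_bracket : forall (a b : bool) (x y : subvs_of g)
                          (v : sm_even * sm_odd),
    vsval x \in gl_part k n a -> vsval y \in gl_part k n b ->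
    sm_act (vsproj g (superbracket (vsval x) (vsval y))) v =
    sm_act x (sm_act y v) - (-1) ^+ (a && b) *: sm_act y (sm_act x v) }.

Record subsupermodule (M : supermodule) (W : sm_even M * sm_odd M -> Prop) :
    Prop := Subsupermodule {
  ssm_zero : W 0;
  ssm_linear : forall (c : k) u v, W u -> W v -> W (c *: u + v);
  ssm_graded : forall v, W v -> W (v.1, 0) /\ W (0, v.2);
  ssm_stable : forall x v, W v -> W (sm_act x v) }.

Definition irreducible (M : supermodule) : Prop :=
  (exists v : sm_even M * sm_odd M, v <> 0) /\
  forall W : sm_even M * sm_odd M -> Prop, subsupermodule W ->
    (forall v, W v -> v = 0) \/ (forall v, W v).

Definition has_dim (M : supermodule) (d : nat) : Prop :=
  exists d0 d1 : nat,
    [/\ inhabited (Vector.axiom d0 (sm_even M)),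
        inhabited (Vector.axiom d1 (sm_odd M)) & d = (d0 + d1)%N].

(* Modules are not assumed finite-dimensional: the second half includes the
   finite-dimensionality of the irreducible ones. *)
Definition max_irreducible_dim (N : nat) : Prop :=
  (exists2 M : supermodule, irreducible M & has_dim M N) /\
  (forall M : supermodule, irreducible M ->
     exists2 d : nat, has_dim M d & (d <= N)%N).

End Modules.

Definition is_maximum (I : Type) (f : I -> nat) (N : nat) : Prop :=
  (exists i, f i = N) /\ (forall i, (f i <= N)%N).

Definition first_super_KW (k : fieldType) (p n : nat)
    (g : {vspace 'M[k]_(n + n)}) : Prop :=
  exists N : nat,
    is_maximum (fun theta : even_dual g => kw_number p theta) N /\
    max_irreducible_dim g N.

(* Main.v *)
Require Import Defs.
From HB Require Import structures.
From mathcomp Require Import all_boot all_order all_algebra.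
From mathcomp Require Import ring zify.
From mathcomp.multinomials Require Import ssrcomplements mpoly.
From Stdlib Require Import Classical.

Set Implicit Arguments.
Unset Strict Implicit.
Unset Printing Implicit Defensive.

Import GRing.Theory.
Local Open Scope ring_scope.

(** The common value N of the two maxima is [kwdim]: p to the power n(n-1)/2 times 2 to the power
    n(n-1)/2, with an extra factor 2 to the ceiling of n/2 in the queer case. Three facts are
    combined: N is the maximum of the Kac-Weisfeiler numbers ([kw_maximum]), every irreducible
    module has dimension at most N ([irreducible_bound]), and some irreducible module attains N
    ([exists_irreducible]).

    Orbits. A form on the even part gl(n) is A |-> tr(T A), and its even stabilizer is the commutant
    of T, of dimension at least n; in the periplectic case the odd stabilizer has dimension at least
    n as well. A diagonal T with distinct entries t_i such that no t_i + t_j vanishes gives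
    equality, and a zero odd stabilizer in the queer case.

    Upper bound. For even x the operator x^p - x^[p] commutes with the action. An irreducible module
    is therefore finitely generated over a polynomial algebra whose elements act by zero or
    surjectively, and Nakayama's trick with Noether normalization makes it finite-dimensional
    ([irr_findim]). The central operators are then scalars, the p-th power of a linear form in x by
    Jacobson's argument ([p_character]). After a conjugation this form vanishes on strictly upper
    triangular matrices ([borel_twist]), so there is a homogeneous weight vector killed by the
    positive part. Straightening in the style of Poincare-Birkhoff-Witt ([spanning]) bounds the
    dimension by the number of ordered monomials in the remaining letters, with exponents below p
    for even and below 2 for odd letters. In the queer case the odd diagonal matrices act on the
    highest weight vectors as a Clifford algebra; one isotropic combination for each pair of
    consecutive indices can be made to kill the vector too, which leaves the ceiling of n/2 diagonal
    letters.

    Lower bound. When the p-character is diagonal with generic entries, every nonzero module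
    contains N independent vectors ([lower_p], [lower_q]). The negative letters are nilpotent and
    their brackets respect a height, so all ordered monomials are independent as soon as the product
    of all letters to their top powers acts injectively ([independence]). This is verified one root
    at a time by moving through adjacent Borel subalgebras: each reflection sends a highest weight
    vector to a nonzero highest weight vector, by an sl_2 computation in which weight differences
    stay outside the prime field. A module with such a p-character is obtained from the oscillator
    representation of gl(n|n) on a truncated Fock space, and a minimal graded submodule of it is
    irreducible. *)

(** * Linear spans and plain linear maps *)

Section Span.
Variables (S : nzRingType) (M : lmodType S).
Implicit Types G : M -> Prop.

(** Built inductively because modules are arbitrary [lmodType]s, not known to be finite-dimensional,
    and because the scalars are a polynomial ring in one application. *)
Inductive spanP G : M -> Prop :=
| spanP0 : spanP G 0
| spanPD c x m : G x -> spanP G m -> spanP G (c *: x + m).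

Lemma spanP_gen G x : G x -> spanP G x.
Proof. by move=> /(spanPD 1)/(_ (spanP0 G)); rewrite scale1r addr0. Qed.

Lemma spanP_add G x y : spanP G x -> spanP G y -> spanP G (x + y).
Proof.
move=> Gx Gy; elim: Gx => [|c z m Gz _ IH]; first by rewrite add0r.
by rewrite -addrA; apply: spanPD.
Qed.

Lemma spanP_scale G a x : spanP G x -> spanP G (a *: x).
Proof.
elim=> [|c z m Gz _ IH]; first by rewrite scaler0; constructor.
by rewrite scalerDr scalerA; apply: spanPD.
Qed.

Lemma spanP_opp G x : spanP G x -> spanP G (- x).
Proof. by rewrite -scaleN1r; apply: spanP_scale. Qed.

Lemma spanP_sum G (I : Type) (r : seq I) (P : pred I) (F : I -> M) :
  (forall i, P i -> spanP G (F i)) -> spanP G (\sum_(i <- r | P i) F i).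
Proof.
move=> GF; elim/big_ind: _ => //; [exact: spanP0 | exact: spanP_add].
Qed.

Lemma spanP_sub G G' x :
  (forall y, G y -> spanP G' y) -> spanP G x -> spanP G' x.
Proof.
move=> GG'; elim=> [|c z m Gz _ IH]; first exact: spanP0.
by apply: spanP_add => //; apply/spanP_scale/GG'.
Qed.

Lemma spanP_seq (s : seq M) x : spanP (fun y => y \in s) x ->
  exists c : nat -> S, x = \sum_(i < size s) c i *: s`_i.
Proof.
elim=> [|c z m zs _ [c' ->]].
  by exists (fun=> 0); rewrite big1 // => i _; rewrite scale0r.
exists (fun i => (if i == index z s then c else 0) + c' i).
under [RHS]eq_bigr do rewrite scalerDl; rewrite big_split /=; congr (_ + _).
have zi : (index z s < size s)%N by rewrite index_mem.
rewrite (bigD1 (Ordinal zi)) //= eqxx nth_index // big1 ?addr0 // => i.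
by rewrite -val_eqE /= => /negPf ->; rewrite scale0r.
Qed.

End Span.

Section PlainLinear.
Variables (S : nzRingType) (U V : lmodType S) (f : U -> V).
Hypothesis f_lin : linear f.

Lemma plin0 : f 0 = 0.
Proof. by have := f_lin (-1) 0 0; rewrite scaler0 addr0 scaleN1r addNr. Qed.

Lemma plinD x y : f (x + y) = f x + f y.
Proof. by have := f_lin 1 x y; rewrite !scale1r. Qed.

Lemma plinZ a x : f (a *: x) = a *: f x.
Proof. by have := f_lin a x 0; rewrite plin0 !addr0. Qed.

Lemma plinB x y : f (x - y) = f x - f y.
Proof. by rewrite plinD -scaleN1r plinZ scaleN1r. Qed.

Lemma plin_sum (I : Type) (r : seq I) (P : pred I) (F : I -> U) :
  f (\sum_(i <- r | P i) F i) = \sum_(i <- r | P i) f (F i).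
Proof. exact: (big_morph f plinD plin0). Qed.

End PlainLinear.

Section OpLin.
Variables (S : nzRingType) (M : lmodType S) (T : Type) (op : T -> M -> M).
Hypothesis op_lin : forall t, linear (op t).

Lemma opP t a x y : op t (a *: x + y) = a *: op t x + op t y.
Proof. exact: op_lin. Qed.

Lemma op0 t : op t 0 = 0.
Proof. by have := opP t (-1) 0 0; rewrite scaler0 addr0 scaleN1r addNr. Qed.

Lemma opD t x y : op t (x + y) = op t x + op t y.
Proof. by have := opP t 1 x y; rewrite !scale1r. Qed.

Lemma opZ t a x : op t (a *: x) = a *: op t x.
Proof. by have := opP t a x 0; rewrite op0 !addr0. Qed.

Lemma opB t x y : op t (x - y) = op t x - op t y.
Proof. by rewrite opD -scaleN1r opZ scaleN1r. Qed.

End OpLin.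

(** * Straightening words in supercommuting operators *)

Section Words.
Variables (S : comNzRingType) (M : lmodType S) (T : finType).
Variables (op : T -> M -> M) (v : M).
Hypothesis op_lin : forall t, linear (op t).

(** The last letter of a word hits the vector first. *)
Definition wact (w : seq T) (x : M) := foldr op x w.

Let opP := opP op_lin.
Let op0 := op0 op_lin.
Let opD := opD op_lin.
Let opZ := opZ op_lin.
Let opB := opB op_lin.

Lemma wactP w a x y : wact w (a *: x + y) = a *: wact w x + wact w y.
Proof. by elim: w => //= t w ->; rewrite opP. Qed.

Lemma wact_cat w1 w2 x : wact (w1 ++ w2) x = wact w1 (wact w2 x).
Proof. exact: foldr_cat. Qed.

Lemma wact_nseq m t x : wact (nseq m t) x = iter m (op t) x.
Proof. by elim: m => //= m ->. Qed.

Variable (gr : T -> nat).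

Definition wgr (w : seq T) : nat := (\sum_(t <- w) gr t)%N.

(** The error terms of straightening. Keeping track of the grade besides the length is what
    [independence] relies on; [spanning] takes all grades equal to zero. *)
Definition shorter d h :=
  spanP (fun m => exists w, [/\ (size w < d)%N, wgr w = h & m = wact w v]).

(* [op s] and [op t] supercommute up to letters of the expected grade. *)
Hypothesis comm : forall s t, exists (e : bool) (c : T -> S),
  (forall r, c r = 0 \/ gr r = (gr s + gr t)%N) /\
  forall w, op s (op t (wact w v)) =
    (-1) ^+ e *: op t (op s (wact w v)) + \sum_r c r *: op r (wact w v).

Lemma shorter_op t d h x :
  shorter d h x -> shorter d.+1 (gr t + h) (op t x).
Proof.
elim=> [|c z m [w [szw wh ->]] _ IH]; first by rewrite op0; constructor.
rewrite opP; apply: spanPD IH; exists (t :: w); split=> //.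
by rewrite /wgr big_cons -/(wgr w) wh.
Qed.

(** Exchanging [t] with the letter on its left costs a sign and words in which the two letters are
    merged into one of the summed grade: shorter words of the same total grade. *)
Lemma wact_front w1 t w2 : exists e : bool,
  shorter (size (w1 ++ t :: w2)) (wgr (w1 ++ t :: w2))
    (wact (w1 ++ t :: w2) v - (-1) ^+ e *: wact (t :: w1 ++ w2) v).
Proof.
elim: w1 => [|s w1 [e IH]].
  by exists false; rewrite scale1r subrr; constructor.
have /(shorter_op s) := IH.
set x := wact _ v; set y := wact _ v => Fx.
have [e' [c [ce cE]]] := comm s t.
exists (e (+) e').
have -> : wact ((s :: w1) ++ t :: w2) v = op s (x - (-1) ^+ e *: y) +
   (-1) ^+ e *: op s y.
  by rewrite -(opZ s) -(opD s) subrK.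
have -> : op s y = (-1) ^+ e' *: wact (t :: (s :: w1) ++ w2) v +
   \sum_r c r *: op r (wact (w1 ++ w2) v) by rewrite /y /= cE.
rewrite scalerDr scalerA -signr_addb.
rewrite [_ *: wact _ _ + _]addrC addrA addrK.
apply: spanP_add; first by rewrite /= /wgr big_cons -/(wgr _).
apply/spanP_scale/spanP_sum => r _.
have [->|gr_r] := ce r; first by rewrite scale0r; apply: spanP0.
apply/spanP_scale/spanP_gen; exists (r :: w1 ++ w2); split => //.
  by rewrite /= !size_cat /= addnS.
by rewrite /wgr /= !big_cons !big_cat /= !big_cons gr_r; lia.
Qed.

Lemma wact_perm w w' : perm_eq w w' -> exists e : bool,
  shorter (size w) (wgr w) (wact w v - (-1) ^+ e *: wact w' v).
Proof.
elim: w' w => [|t w' IH] w.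
  by move/perm_nilP ->; exists false; rewrite scale1r subrr; constructor.
move=> ww'; have /splitPr : t \in w by rewrite (perm_mem ww') mem_head.
move=> wsplit; case: wsplit ww' => w1 w2 ww'.
have pw : perm_eq (w1 ++ w2) w'.
  by rewrite -(perm_cons t) -(perm_catCA w1 [:: t] w2).
have [e1 F1] := wact_front w1 t w2.
have [e2 /(shorter_op t) F2] := IH _ pw.
exists (e1 (+) e2).
have -> : wact (w1 ++ t :: w2) v - (-1) ^+ (e1 (+) e2) *: wact (t :: w') v =
  (wact (w1 ++ t :: w2) v - (-1) ^+ e1 *: wact (t :: w1 ++ w2) v) +
  (-1) ^+ e1 *: op t (wact (w1 ++ w2) v - (-1) ^+ e2 *: wact w' v).
  rewrite /= (opB t) (opZ t) scalerBr scalerA addrA subrK.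
  by rewrite signr_addb.
apply: spanP_add F1 _; apply: spanP_scale.
have -> : size (w1 ++ t :: w2) = (size (w1 ++ w2)).+1.
  by rewrite !size_cat addnS.
have -> // : wgr (w1 ++ t :: w2) = (gr t + wgr (w1 ++ w2))%N.
by rewrite /wgr !big_cat big_cons /=; lia.
Qed.

End Words.

Section CanonicalWords.
Variable (T : finType).
Implicit Types (e : T -> nat) (w : seq T).

Definition cword (r : seq T) e := flatten [seq nseq (e t) t | t <- r].

Lemma count_cword r e x : uniq r ->
  count_mem x (cword r e) = if x \in r then e x else 0%N.
Proof.
rewrite /cword; elim: r => //= t r IH /andP[tr ur].
rewrite count_cat count_nseq IH // in_cons eq_sym /=.
case: eqVneq => [<-|] //=; by rewrite (negPf tr) addn0 mul1n.
Qed.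

Lemma perm_cword w (r : seq T) e :
  uniq r -> {subset w <= r} -> (forall t, t \in r -> count_mem t w = e t) ->
  perm_eq w (cword r e).
Proof.
move=> ur wr we; apply/allP => x _ /=; apply/eqP.
rewrite count_cword //; case: ifP => [/we//|xr].
by apply/count_memPn; apply: contraFN xr => /wr.
Qed.

Lemma perm_nseq_filter w t : perm_eq w
  (nseq (count_mem t w) t ++ filter (predC1 t) w).
Proof.
have -> : nseq (count_mem t w) t = filter (pred1 t) w.
  by elim: w => //= x w IH; case: eqVneq => [->|_] //=; rewrite IH.
by rewrite perm_sym; apply/permPl/perm_filterC.
Qed.

Lemma perm_rem_rcons w t : t \in w -> perm_eq w (rcons (rem t w) t).
Proof. by move=> tw; rewrite perm_sym perm_rcons perm_sym perm_to_rem. Qed.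

Lemma perm_nseq_ge w t m : (m <= count_mem t w)%N -> exists w',
  perm_eq w (nseq m t ++ w').
Proof.
move=> mc; exists (nseq (count_mem t w - m) t ++ filter (predC1 t) w).
by rewrite catA -nseqD subnKC //; apply: perm_nseq_filter.
Qed.

Lemma wgr_count gr w : wgr gr w = (\sum_t count_mem t w * gr t)%N.
Proof.
elim: w => [|x w IH]; first by rewrite /wgr big_nil big1.
rewrite /wgr big_cons -/(wgr _ _) IH /=.
under [RHS]eq_bigr do rewrite mulnDl; rewrite big_split /=; congr addn.
rewrite (bigD1 x) //= eqxx mul1n big1 ?addn0 // => t tx.
by rewrite eq_sym (negPf tx).
Qed.

Lemma size_count w : size w = (\sum_t count_mem t w)%N.
Proof.
have := wgr_count (fun=> 1%N) w.
rewrite /wgr sum1_size => ->; by apply: eq_bigr => t _; rewrite muln1.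
Qed.

Lemma wgr_perm gr w w' : perm_eq w w' -> wgr gr w = wgr gr w'.
Proof. exact: perm_big. Qed.

End CanonicalWords.

(** * Ordered monomials span *)

Section Spanning.
Variables (S : comNzRingType) (M : lmodType S) (T : finType).
Variables (op : T -> M -> M) (v : M) (Y : pred T) (ord : T -> nat).
Hypothesis op_lin : forall t, linear (op t).
Hypothesis ord_gt1 : forall t, (1 < ord t)%N.
Hypothesis comm : forall s t, exists (e : bool) (c : T -> S), forall w,
  op s (op t (wact op w v)) =
    (-1) ^+ e *: op t (op s (wact op w v)) + \sum_r c r *: op r (wact op w v).
Hypothesis pow : forall t, Y t -> exists (c0 : S) (c : T -> S), forall w,
  iter (ord t) (op t) (wact op w v) =
    c0 *: wact op w v + \sum_r c r *: op r (wact op w v).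
Hypothesis stab : forall t, ~~ Y t -> exists a, op t v = a *: v.

Fixpoint mons (r : seq T) : seq M :=
  if r is t :: r' then
    [seq iter a (op t) u | a <- iota 0 (ord t), u <- mons r']
  else [:: v].

Lemma size_mons r : size (mons r) = (\prod_(t <- r) ord t)%N.
Proof.
elim: r => [|t r IH]; first by rewrite big_nil.
by rewrite big_cons /= size_allpairs size_iota IH.
Qed.

Lemma cword_mons r e : (forall t, t \in r -> (e t < ord t)%N) ->
  wact op (cword r e) v \in mons r.
Proof.
elim: r => [|t r IH] er; first by rewrite inE.
rewrite /cword /= wact_cat wact_nseq.
apply/allpairsP; exists (e t, wact op (cword r e) v); split => //=.
  by rewrite mem_iota add0n er ?mem_head.
by apply: IH => s sr; apply: er; rewrite inE sr orbT.
Qed.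

(** Induction on the length. Modulo shorter words the letters may be permuted, so a letter outside
    [Y] is moved next to [v], where it is a scalar, and [ord t] copies of a letter are gathered at
    the front, where [pow] replaces them by at most one letter. A word that admits neither step is
    an ordered monomial up to a permutation. *)
Lemma spanning w : spanP (fun m => m \in mons (enum Y)) (wact op w v).
Proof.
have [d] := ubnP (size w); elim: d w => // d IH w; rewrite ltnS => szw.
have comm0 s t : exists (e : bool) (c : T -> S),
  (forall r, c r = 0 \/ 0%N = (0 + 0)%N) /\
  forall w, op s (op t (wact op w v)) = (-1) ^+ e *: op t (op s (wact op w v)) +
     \sum_r c r *: op r (wact op w v).
  by have [e [c cE]] := comm s t; exists e, c; split=> // r; right.
have redP w' : perm_eq w w' ->
    spanP (fun m => m \in mons (enum Y)) (wact op w' v) ->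
    spanP (fun m => m \in mons (enum Y)) (wact op w v).
  move=> ww' w'Y; have [e F] := wact_perm op_lin comm0 ww'.
  rewrite -(subrK ((-1) ^+ e *: wact op w' v) (wact op w v)).
  apply: spanP_add; last exact: spanP_scale.
  apply: spanP_sub F => y [w'' [szw'' _ ->]]; apply: IH.
  exact: leq_trans szw'' szw.
have [wY|] := boolP (all Y w); last first.
  case/allPn => t tw nYt; apply: (redP _ (perm_rem_rcons tw)).
  have [a ta] := stab nYt; rewrite -cats1 wact_cat /= ta.
  have := wactP op_lin (rem t w) a v 0.
  have w0 : wact op (rem t w) 0 = 0.
    by elim: (rem _ _) => //= s r ->; exact: op0.
  rewrite w0 !addr0 => ->; apply/spanP_scale/IH.
  rewrite size_rem //; apply: leq_trans szw.
  by rewrite prednK //; case: (w) tw.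
have [/existsP[t /andP[Yt ct]]|] :=
    boolP [exists t, Y t && (ord t <= count_mem t w)%N].
  have [w' pw] := perm_nseq_ge ct; apply: (redP _ pw).
  have szw' : (size w' + 2 <= d)%N.
    apply: leq_trans szw; rewrite (perm_size pw) size_cat size_nseq addnC.
    by rewrite leq_add2r ord_gt1.
  have [c0 [c cE]] := pow Yt; rewrite wact_cat wact_nseq cE.
  apply: spanP_add; first by apply/spanP_scale/IH; lia.
  apply: spanP_sum => r _; apply: spanP_scale; apply: (IH (r :: w')) => /=; lia.
rewrite negb_exists => /forallP small.
apply: (redP (cword (enum Y) (fun t => count_mem t w))).
  apply: perm_cword => //; first exact: enum_uniq.
  by move=> x xw; rewrite mem_enum; move/allP: wY => /(_ _ xw).
apply/spanP_gen/cword_mons => t; rewrite mem_enum => Yt.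
by have := small t; rewrite negb_and (_ : Y t) //= -ltnNge.
Qed.

End Spanning.

(** * Ordered monomials are independent when the top word is injective *)

Section Independence.
Variables (S : comNzRingType) (M : lmodType S) (T : finType).
Variables (op : T -> M -> M) (W : M -> Prop) (ord ht : T -> nat).
Hypothesis op_lin : forall t, linear (op t).
Hypothesis ord_gt0 : forall t, (0 < ord t)%N.
Hypothesis ht_gt0 : forall t, (0 < ht t)%N.
Hypothesis W_op : forall t u, W u -> W (op t u).
Hypothesis comm : forall s t, exists (e : bool) (c : T -> S),
  (forall r, c r = 0 \/ ht r = (ht s + ht t)%N) /\
  forall u, W u -> op s (op t u) =
    (-1) ^+ e *: op t (op s u) + \sum_r c r *: op r u.
Hypothesis pow0 : forall t u, W u -> iter (ord t) (op t) u = 0.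

Let top_ht := (\sum_t (ord t).-1 * ht t)%N.
Let top_deg := (\sum_t (ord t).-1)%N.

Lemma W_wact w u : W u -> W (wact op w u).
Proof. by move=> Wu; elim: w => //= t w; apply: W_op. Qed.

Lemma wact0 w : wact op w 0 = 0.
Proof. by elim: w => //= s r ->; exact: op0. Qed.

(** With all exponents below [ord], the height is at most [top_ht], with equality only for the full
    exponents, whose length is [top_deg]. The words singled out here lie beyond that and will act as
    zero. *)
Let small w := (top_ht < wgr ht w)%N ||
  ((wgr ht w == top_ht) && (size w < top_deg)%N).

(** In these ranges the error terms of a permutation, having the same height and fewer letters, are
    small themselves; only the sign remains. *)
Lemma wact_perm0 w w' u : W u -> (wgr ht w >= top_ht)%N ->
  (size w <= top_deg)%N || (top_ht < wgr ht w)%N ->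
  (forall w'', (size w'' < size w)%N -> small w'' -> wact op w'' u = 0) ->
  perm_eq w w' -> exists e : bool, wact op w u = (-1) ^+ e *: wact op w' u.
Proof.
move=> Wu hw dw IH ww'.
have comm_u s t : exists (e : bool) (c : T -> S),
  (forall r, c r = 0 \/ ht r = (ht s + ht t)%N) /\
  forall w, op s (op t (wact op w u)) = (-1) ^+ e *: op t (op s (wact op w u)) +
     \sum_r c r *: op r (wact op w u).
  have [e [c [ce cE]]] := comm s t; exists e, c; split=> // r.
  by apply: cE; apply: W_wact.
have [e F] := wact_perm op_lin comm_u ww'.
exists e; apply/eqP; rewrite -subr_eq0; apply/eqP.
elim: F => // c x m [w'' [szw'' hw'' ->]] _ ->.
rewrite addr0 IH ?scaler0 // /small hw''.
by move: hw dw szw''; move: (wgr _ _) (size w) (size w'') top_ht top_deg; lia.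
Qed.

Lemma wact_count0 w u t : W u -> (wgr ht w >= top_ht)%N ->
  (size w <= top_deg)%N || (top_ht < wgr ht w)%N ->
  (forall w'', (size w'' < size w)%N -> small w'' -> wact op w'' u = 0) ->
  (ord t <= count_mem t w)%N -> wact op w u = 0.
Proof.
move=> Wu hw dw IH ct; have [w' pw] := perm_nseq_ge ct.
have [e ->] := wact_perm0 Wu hw dw IH pw.
by rewrite wact_cat wact_nseq pow0 ?scaler0 //; apply: W_wact.
Qed.

Lemma all_count w : (forall t, count_mem t w < ord t)%N ->
  (wgr ht w <= top_ht)%N /\ (wgr ht w = top_ht -> size w = top_deg).
Proof.
move=> cw; have cw' t : (count_mem t w <= (ord t).-1)%N.
  by rewrite -ltnS prednK.
rewrite wgr_count size_count; split.
  by apply: leq_sum => t _; rewrite leq_mul2r cw' orbT.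
have /leqif_sum : forall t, true ->
   (count_mem t w * ht t <= (ord t).-1 * ht t ?= iff (count_mem t w == (ord t).-1))%N.
  move=> t _; apply/leqifP; case: eqVneq => [->//|ne].
  by rewrite ltn_pmul2r // ltn_neqAle ne cw'.
rewrite -/top_ht => -[_ eqE] /eqP; rewrite eqE => /forallP cE.
by apply: eq_bigr => t _; move/implyP: (cE t) => /(_ isT)/eqP.
Qed.

(** By [all_count] some letter occurs at least [ord] times. Gathering its copies, which changes only
    the sign by induction on the length, gives zero by [pow0]. *)
Lemma wact_small w u : W u -> small w -> wact op w u = 0.
Proof.
move=> Wu; have [d] := ubnP (size w); elim: d w => // d IH w szw sw.
have IH' w'' : (size w'' < size w)%N -> small w'' -> wact op w'' u = 0.
  by move=> szw''; apply: IH; lia.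
have [/existsP[t ct]|] := boolP [exists t, ord t <= count_mem t w]%N.
  by apply: (wact_count0 Wu _ _ IH' ct); move: sw; rewrite /small; lia.
rewrite negb_exists => /forallP cw.
have [|le_ht eq_ht] := @all_count w; first by move=> t; rewrite ltnNge cw.
case/orP: sw => [|/andP[/eqP /eq_ht ->]]; last by rewrite ltnn.
by rewrite ltnNge le_ht.
Qed.

Lemma wact_top w u : W u -> wgr ht w = top_ht -> size w = top_deg ->
  (exists t, count_mem t w <> (ord t).-1) -> wact op w u = 0.
Proof.
move=> Wu hw sw [t0 ct0].
have [/existsP[t ct]|] := boolP [exists t, ord t <= count_mem t w]%N.
  apply: (wact_count0 Wu _ _ _ ct); rewrite ?hw ?sw ?leqnn //.
  by move=> w'' _; apply: wact_small.
rewrite negb_exists => /forallP cw; case: ct0.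
have cw' t : (count_mem t w <= (ord t).-1)%N.
  by rewrite -ltnS prednK // ltnNge cw.
have /leqif_sum : forall t, true ->
   (count_mem t w <= (ord t).-1 ?= iff (count_mem t w == (ord t).-1))%N.
  by move=> t _; apply/leqifP; case: ifP => // /negbT ne; rewrite ltn_neqAle ne cw'.
rewrite -size_count -/top_deg sw => -[_]; rewrite eqxx => /esym/forallP/(_ t0).
by move/implyP/(_ isT)/eqP.
Qed.

Variables (L : M -> Prop) (topw : seq T).
Hypothesis LW : forall u, L u -> W u.
Hypothesis top_count : forall t, count_mem t topw = (ord t).-1.
Hypothesis top_inj : forall u, L u -> wact op topw u = 0 -> u = 0.

(** In a relation, choose a nonzero coefficient whose monomial has least height and, among those,
    greatest length, and apply the complementary monomial. Every other term turns into a small word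
    or a word with the top height and length but wrong counts, hence zero; the chosen term turns
    into the top word up to sign, which is injective on [L]. *)
Lemma independence (A : finType) (ex : A -> T -> nat) (l : A -> M) :
  (forall a b, ex a =1 ex b -> a = b) ->
  (forall a t, ex a t < ord t)%N -> (forall a, L (l a)) ->
  \sum_a wact op (cword (enum T) (ex a)) (l a) = 0 -> forall a, l a = 0.
Proof.
move=> ex_inj ex_ord Ll sum0 a0; apply/eqP/negPn/negP => la0.
pose wd a := cword (enum T) (ex a).
have cnt a t : count_mem t (wd a) = ex a t.
  by rewrite count_cword ?enum_uniq // mem_enum.
have szle a : (size (wd a) <= top_deg)%N.
  rewrite size_count leq_sum // => t _; rewrite cnt.
  by rewrite -ltnS prednK.
(* Lexicographic order encoded in one number: height first, then the length reversed, as [szle]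
   keeps the second entry within bounds. *)
pose key a := (wgr ht (wd a) * top_deg.+1 + (top_deg - size (wd a)))%N.
case: (@arg_minnP A a0 (fun a => l a != 0) key la0) => a la amin.
pose c := cword (enum T) (fun t => (ord t).-1 - ex a t)%N.
have ccnt t : count_mem t c = ((ord t).-1 - ex a t)%N.
  by rewrite count_cword ?enum_uniq // mem_enum.
have exle b t : (ex b t <= (ord t).-1)%N by rewrite -ltnS prednK.
have hc : (wgr ht c + wgr ht (wd a) = top_ht)%N.
  rewrite !wgr_count -big_split; apply: eq_bigr => t _ /=.
  by rewrite ccnt cnt -mulnDl subnK.
have sc : (size c + size (wd a) = top_deg)%N.
  rewrite !size_count -big_split; apply: eq_bigr => t _ /=.
  by rewrite ccnt cnt subnK.
have wsum (F : A -> M) : wact op c (\sum_b F b) = \sum_b wact op c (F b).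
  have wD x1 x2 : wact op c (x1 + x2) = wact op c x1 + wact op c x2.
    by have := wactP op_lin c 1 x1 x2; rewrite !scale1r.
  exact: (big_morph (wact op c) wD (wact0 c)).
have := congr1 (wact op c) sum0; rewrite wact0 wsum (bigD1 a) //= big1.
  rewrite addr0 -wact_cat => eq0.
  have pt : perm_eq (c ++ wd a) topw.
    apply/allP => x _ /=.
    by rewrite top_count count_cat ccnt cnt subnK.
  have [e E] : exists e : bool,
      wact op (c ++ wd a) (l a) = (-1) ^+ e *: wact op topw (l a).
    apply: wact_perm0 pt; first exact: LW.
    - have -> : wgr ht (c ++ wd a) = (wgr ht c + wgr ht (wd a))%N.
        by rewrite /wgr big_cat.
      by rewrite hc.
    - by rewrite size_cat sc leqnn.
    - by move=> w'' _; apply/wact_small/LW.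
  rewrite eq0 in E; move/negP: la; apply; apply/eqP/top_inj => //.
  have := congr1 (GRing.scale ((-1) ^+ e)) E.
  by rewrite scaler0 scalerA -signr_addb addbb scale1r => <-.
move=> b ba; rewrite -wact_cat.
have [->|lb] := eqVneq (l b) 0; first exact: wact0.
have hcb : wgr ht (c ++ wd b) = (wgr ht c + wgr ht (wd b))%N.
  by rewrite /wgr big_cat.
have scb : size (c ++ wd b) = (size c + size (wd b))%N by rewrite size_cat.
have := amin _ lb; rewrite /key => le_key.
have sza := szle a; have szb := szle b.
have hle : (wgr ht (wd a) <= wgr ht (wd b))%N.
  by rewrite leqNgt; apply/negP => hlt; move: le_key sza szb hlt; nia.
have [hlt|heq] := ltnP (wgr ht (wd a)) (wgr ht (wd b)).
  apply: wact_small; first exact: LW.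
  by rewrite /small hcb; lia.
have {heq hle}heq : wgr ht (wd b) = wgr ht (wd a) by lia.
have sle : (size (wd b) <= size (wd a))%N by move: le_key; rewrite heq; lia.
have [slt|sge] := ltnP (size (wd b)) (size (wd a)).
  apply: wact_small; first exact: LW.
  by rewrite /small hcb scb; lia.
apply: wact_top; [exact: LW | by rewrite hcb heq hc | by rewrite scb; lia |].
apply: NNPP => nex; case/eqP: ba; apply: ex_inj => t.
apply: NNPP => ne; apply: nex; exists t; rewrite count_cat ccnt cnt => E.
by apply: ne; have := exle a t; lia.
Qed.

End Independence.

(** * Modules finitely generated over a polynomial algebra: Noether normalization *)

(** Uniqueness of base [B] expansions, by which Nagata's substitution separates monomials. *)
Lemma digits_inj (B n : nat) (a b : nat -> nat) :
  (forall i, (i < n)%N -> (a i < B)%N /\ (b i < B)%N) ->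
  (\sum_(i < n) a i * B ^ i = \sum_(i < n) b i * B ^ i)%N ->
  forall i, (i < n)%N -> a i = b i.
Proof.
elim: n a b => // n IH a b lt_B; rewrite !big_ord_recl /= !expn0 !muln1.
have shift (f : nat -> nat) : (\sum_(i < n) f (bump 0 i) * B ^ bump 0 i =
   (\sum_(i < n) f i.+1 * B ^ i) * B)%N.
  by rewrite big_distrl /=; apply: eq_bigr => i _; rewrite expnS mulnCA mulnC.
rewrite !shift => E.
have [a0 b0] := lt_B 0%N isT.
have E0 : a 0%N = b 0%N.
  by have := congr1 (modn^~ B) E; rewrite /= ![(_ + _ * B)%N]addnC !modnMDl !modn_small.
move: E; rewrite E0 => /eqP; rewrite eqn_add2l eqn_pmul2r ?(leq_ltn_trans _ a0) //.
move=> /eqP E [|i] // lt_i; apply: (IH (a \o succn) (b \o succn)) => // j lt_j.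
exact: (lt_B j.+1).
Qed.

Lemma seq_argmax (T : eqType) (s : seq T) (D : T -> nat) : s != [::] ->
  exists2 x, x \in s & forall y, y \in s -> (D y <= D x)%N.
Proof.
elim: s => // x [|y s] IH _.
  by exists x; rewrite ?mem_head // => y; rewrite inE => /eqP ->.
have [z zs zmax] := IH isT; have [le_zx|lt_xz] := leqP (D z) (D x).
  exists x; rewrite ?mem_head // => t; rewrite inE => /predU1P[->//|/zmax].
  by move/leq_trans; apply.
exists z => [|t]; first by rewrite inE zs orbT.
by rewrite inE => /predU1P[->|/zmax//]; apply: ltnW.
Qed.

Section RelativeSpan.
Variables (S : nzRingType) (M : lmodType S).

(** Spans with coefficients in a subset [K] of the scalars, here the image of a smaller ring. *)
Inductive rspan (K : S -> Prop) (G : M -> Prop) : M -> Prop :=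
| rspan0 : rspan K G 0
| rspanD c x m : K c -> G x -> rspan K G m -> rspan K G (c *: x + m).

Lemma rspan_add K G x y : rspan K G x -> rspan K G y -> rspan K G (x + y).
Proof.
move=> Gx Gy; elim: Gx => [|c z m Kc Gz _ IH]; first by rewrite add0r.
by rewrite -addrA; apply: rspanD.
Qed.

Lemma rspan_gen (K : S -> Prop) (G : M -> Prop) c x :
  K c -> G x -> rspan K G (c *: x).
Proof. by move=> Kc Gx; rewrite -[_ *: _]addr0; apply: rspanD => //; constructor. Qed.

Lemma rspan_sum K G (I : Type) (r : seq I) (P : pred I) (F : I -> M) :
  (forall i, P i -> rspan K G (F i)) -> rspan K G (\sum_(i <- r | P i) F i).
Proof.
move=> GF; elim/big_ind: _ => //; [exact: rspan0 | exact: rspan_add].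
Qed.

Lemma rspan_seq (R : nzRingType) (f : {rmorphism R -> S}) (s : seq M) x :
  rspan (fun u => exists q, u = f q) (fun y => y \in s) x ->
  exists c : nat -> R, x = \sum_(i < size s) f (c i) *: s`_i.
Proof.
elim=> [|_ z m [a ->] zs _ [c' ->]].
  by exists (fun=> 0); rewrite big1 // => i _; rewrite rmorph0 scale0r.
exists (fun i => (if i == index z s then a else 0) + c' i).
under [RHS]eq_bigr do rewrite rmorphD scalerDl; rewrite big_split /=.
congr (_ + _).
have zi : (index z s < size s)%N by rewrite index_mem.
rewrite (bigD1 (Ordinal zi)) //= eqxx nth_index // big1 ?addr0 // => i.
by rewrite -val_eqE /= => /negPf ->; rewrite rmorph0 scale0r.
Qed.

End RelativeSpan.

(** Multiply the system by the adjugate matrix. *)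
Lemma adj_annihilates (S : comNzRingType) (M : lmodType S) r (A : 'M[S]_r)
    (x : 'I_r -> M) :
  (forall i, \sum_j A i j *: x j = 0) -> forall l, \det A *: x l = 0.
Proof.
move=> Ax l.
have : \sum_j (\adj A *m A) l j *: x j = 0.
  under eq_bigr do rewrite mxE scaler_suml.
  rewrite exchange_big /= big1 // => i _.
  under eq_bigr do rewrite -scalerA.
  by rewrite -scaler_sumr Ax scaler0.
rewrite mul_adj_mx (bigD1 l) //= mxE eqxx big1 ?addr0 // => j jl.
by rewrite mxE eq_sym (negPf jl) scale0r.
Qed.

Lemma mmap_unique (k : nzRingType) (S : comNzRingType) (c : {rmorphism k -> S})
    n (w : 'I_n -> S) (F : {rmorphism {mpoly k[n]} -> S}) :
  (forall a, F a%:MP = c a) -> (forall i, F 'X_i = w i) ->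
  forall q, F q = mmap c w q.
Proof.
move=> Fc Fw q; rewrite [in LHS](mpolyE q) rmorph_sum; apply: eq_bigr => m _.
rewrite -mul_mpolyC rmorphM Fc mpolyXE_id rmorph_prod; congr (_ * _).
by apply: eq_bigr => i _; rewrite rmorphXn Fw.
Qed.

Lemma mmap_scale (R S : comNzRingType) (c : {rmorphism R -> S}) n
    (w : 'I_n -> S) a (f : {mpoly R[n]}) :
  mmap c w (a *: f) = \sum_(m <- msupp f) c (a * f@_m) * mmap1 w m.
Proof.
rewrite mmapZ big_distrr; apply: eq_bigr => m _ /=.
by rewrite mulrA -rmorphM.
Qed.

Section Noether.
Variables (k : fieldType) (S : comNzRingType) (c : {rmorphism k -> S}).
Variables (M : lmodType S).

(** Finite generation of [M] over the subalgebra of [S] generated by the image of [k] and the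
    [w i]. *)
Definition fgen s (w : 'I_s -> S) := exists ms : seq M,
  forall m, rspan (fun u => exists q, u = mmap c w q) (fun y => y \in ms) m.

(** Nakayama's determinant trick. If w_0 acts by zero, take X_0. Otherwise w_0 is surjective, so
    each generator is w_0 times a combination of generators, and the determinant of 1 - X_0 x kills
    [M]. *)
Lemma fgen_annihilator s (w : 'I_s.+1 -> S) :
  (forall u : S, (forall m : M, u *: m = 0) \/ (forall m : M, exists m', m = u *: m')) ->
  fgen w -> exists2 f : {mpoly k[s.+1]}, f != 0 & forall m : M, mmap c w f *: m = 0.
Proof.
move=> simpleM [ms msP].
have [w0|w_surj] := simpleM (w ord0).
  exists 'X_ord0 => [|m]; last by rewrite mmapX mmap1U w0.
  by rewrite -msize_poly_eq0 msizeX mdeg1.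
pose r := size ms.
have [x xE] : exists x : 'I_r -> nat -> {mpoly k[s.+1]}, forall i : 'I_r,
    ms`_i = w ord0 *: \sum_(j < r) mmap c w (x i j) *: ms`_j.
  have : forall i : 'I_r, exists y : nat -> {mpoly k[s.+1]},
     ms`_i = w ord0 *: \sum_(j < r) mmap c w (y j) *: ms`_j.
    move=> i; have [m ->] := w_surj ms`_i.
    by have [y {1}->] := rspan_seq (f := mmap c w) (msP m); exists y.
  by case/fin_all_exists => x xE; exists x.
pose A : 'M[{mpoly k[s.+1]}]_r := \matrix_(i, j) ((i == j)%:R - 'X_ord0 * x i j).
exists (\det A).
  (* Sending all variables to zero turns [A] into the identity, so its determinant is not zero. *)
  apply/eqP => detA0.
  have := det_map_mx (mmap idfun (fun=> 0 : k)) A.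
  rewrite detA0 rmorph0; have -> : map_mx (mmap idfun (fun=> 0 : k)) A = 1%:M.
    apply/matrixP => i j; rewrite !mxE rmorphB rmorphM /= mmapX mmap1U mul0r subr0.
    by case: (i == j); rewrite ?rmorph1 ?rmorph0.
  by rewrite det1 => /eqP; rewrite oner_eq0.
move=> m; have [y ->] := rspan_seq (f := mmap c w) (msP m).
rewrite scaler_sumr big1 // => l _.
rewrite scalerA mulrC -scalerA.
have -> : mmap c w (\det A) = \det (map_mx (mmap c w) A) by rewrite det_map_mx.
rewrite (@adj_annihilates S M r _ (fun l => ms`_l)) ?scaler0 // => i.
under eq_bigr do rewrite !mxE rmorphB rmorphM /= mmapX mmap1U scalerBl -scalerA.
rewrite sumrB -scaler_sumr -xE (bigD1 i) //= eqxx rmorph1 scale1r big1 ?addr0 ?subrr //.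
by move=> j ji; rewrite eq_sym (negPf ji) rmorph0 scale0r.
Qed.

Section Substitution.
Variables (s B : nat).

(** Nagata's substitution: X_0 becomes the new variable X and X_i becomes X_(i-1) + X^(B^i), so that
    the degree in X of a monomial has its exponents as base [B] digits. *)
Let h (i : 'I_s.+1) : {poly {mpoly k[s]}} :=
  if unlift ord0 i is Some j then ('X_j)%:P + 'X^(B ^ i) else 'X.

Let cst : {rmorphism k -> {poly {mpoly k[s]}}} := polyC \o @mpolyC s k.

Let phi := mmap cst h.

Hypothesis B_gt0 : (0 < B)%N.

Lemma h_monic i : h i \is monic /\ size (h i) = (B ^ i).+1.
Proof.
rewrite /h; case: unliftP => [j|] ->; last by rewrite monicX size_polyX expn0.
have szX : (size (('X_j)%:P : {poly {mpoly k[s]}}) <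
   size ('X^(B ^ lift ord0 j) : {poly {mpoly k[s]}}))%N.
  rewrite size_polyXn size_polyC ltnS; apply: leq_trans (leq_b1 _) _.
  by rewrite expn_gt0 B_gt0.
by rewrite monicE addrC lead_coefDl // -monicE monicXn size_polyDl // size_polyXn.
Qed.

Let deg (m : 'X_{1.. s.+1}) := (\sum_i m i * B ^ i)%N.

Lemma phi_monomial (m : 'X_{1.. s.+1}) :
  mmap1 h m \is monic /\ size (mmap1 h m) = (deg m).+1.
Proof.
rewrite /mmap1 /deg; elim/big_ind2: _ => [|p x q y [mp sp] [mq sq]|i _].
- by rewrite monic1 size_poly1.
- by rewrite monicMr // mp size_monicM ?monic_neq0 // sp sq addnS.
have [mh sh] := h_monic i; elim: (m i) => [|d [md sd]].
  by rewrite expr0 monic1 size_poly1.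
by rewrite exprS monicMr // mh size_monicM ?monic_neq0 // sh sd mulSn addSn addnS.
Qed.

(** The exponents in [f] are below [B], so distinct monomials acquire distinct degrees in X. The
    largest degree is attained once, with a constant leading coefficient. *)
Lemma phi_monic (f : {mpoly k[s.+1]}) : f != 0 -> (msize f <= B)%N ->
  exists2 a : k, a != 0 & phi (a *: f) \is monic.
Proof.
move=> f0 fB; have [|m mf mmax] := seq_argmax deg (s := msupp f).
  by rewrite msupp_eq0.
have fm : f@_m != 0 by rewrite -mcoeff_msupp.
exists (f@_m)^-1; first by rewrite invr_eq0.
have -> : phi ((f@_m)^-1 *: f) = mmap1 h m +
    \sum_(m' <- msupp f | m' != m) cst ((f@_m)^-1 * f@_m') * mmap1 h m'.
  rewrite /phi mmap_scale (bigD1_seq m) ?msupp_uniq //; congr (_ + _).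
  by rewrite mulVf // rmorph1 mul1r.
have [mm sm] := phi_monomial m.
rewrite monicE lead_coefDl -?monicE // sm ltnS.
apply: (leq_trans (size_sum _ _ _)); apply/bigmax_leqP_seq => m' m'f m'm.
apply: leq_trans (_ : (deg m').+1 <= _)%N.
  have [_ sm'] := phi_monomial m'; rewrite -sm' mul_polyC.
  exact: size_scale_leq.
rewrite ltn_neqAle mmax // andbT; apply: contra m'm => /eqP degE.
have lt_B (m1 : 'X_{1.. s.+1}) i : m1 \in msupp f -> (m1 i < B)%N.
  move=> m1f; apply: leq_trans fB; apply: leq_ltn_trans (msize_mdeg_lt m1f).
  by rewrite mdegE (bigD1 i) //= leq_addr.
apply/eqP/mnmP => i.
have := @digits_inj B s.+1 (fun i => m' (inord i)) (fun i => m (inord i)).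
move=> /(_ _ _ i (ltn_ord i)); rewrite inord_val; apply.
  by move=> j _; rewrite !lt_B.
by rewrite /deg in degE; under eq_bigr do rewrite inord_val;
   under [RHS]eq_bigr do rewrite inord_val.
Qed.

(** The substitution is undone by evaluating X at w_0 and X_j at w_(j+1) - w_0^(B^(j+1)). *)
Lemma phi_eval (w : 'I_s.+1 -> S) (q : {mpoly k[s.+1]}) :
  (map_poly (mmap c (fun j => w (lift ord0 j) - w ord0 ^+ (B ^ lift ord0 j)))
     (phi q)).[w ord0] = mmap c w q.
Proof.
set w' := fun _ => _.
pose F : {rmorphism {mpoly k[s.+1]} -> S} :=
  horner_eval (w ord0) \o map_poly (mmap c w') \o phi.
rewrite -[LHS]/(F q); apply: mmap_unique => [a|i] /=.
  by rewrite /phi mmapC /= map_polyC /= mmapC /horner_eval hornerC.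
rewrite /phi mmapX mmap1U /h /horner_eval; case: unliftP => [j|] -> /=.
  by rewrite rmorphD /= map_polyC map_polyXn /= mmapX mmap1U hornerD hornerC
    hornerXn /w' subrK.
by rewrite map_polyX hornerX.
Qed.

End Substitution.

(** One step of Noether normalization. After rescaling, [f] becomes the monic polynomial [F], which
    kills [M] when X is w_0; division by [F] bounds the powers of w_0, so the products of these
    powers with the old generators suffice over the remaining variables. *)
Lemma fgen_reduce s (w : 'I_s.+1 -> S) (f : {mpoly k[s.+1]}) : f != 0 ->
  (forall m : M, mmap c w f *: m = 0) -> fgen w -> exists w' : 'I_s -> S, fgen w'.
Proof.
move=> f0 fM [ms msP]; pose B := msize f.
have B_gt0 : (0 < B)%N by rewrite lt0n msize_poly_eq0.
have [a a0 F_monic] := phi_monic B_gt0 f0 (leqnn _).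
set F := mmap _ _ _ in F_monic.
exists (fun j => w (lift ord0 j) - w ord0 ^+ (B ^ lift ord0 j)).
set w' := fun _ => _.
exists [seq w ord0 ^+ l *: x | l <- iota 0 (size F), x <- ms] => m.
elim: (msP m) => [|_ x y [q ->] xms _ IH]; first by constructor.
apply: rspan_add IH; rewrite -(phi_eval B) -/w'.
set G := mmap _ _ q.
rewrite (Pdiv.RingMonic.rdivp_eq F_monic G) rmorphD rmorphM hornerD hornerM.
have F0 (z : M) : (map_poly (mmap c w') F).[w ord0] *: z = 0.
  rewrite /F /w' phi_eval mmapZ.
  by rewrite -scalerA fM scaler0.
rewrite scalerDl -scalerA F0 scaler0 add0r.
set R := Pdiv.Ring.rmodp _ _.
have szR : (size R <= size F)%N.
  by apply/ltnW/Pdiv.Ring.ltn_rmodpN0/monic_neq0.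
rewrite (horner_coef_wide _ (leq_trans (size_poly _ _) szR)) scaler_suml.
apply: rspan_sum => l _; rewrite -scalerA; apply: rspan_gen.
  by rewrite coef_map; eexists.
apply/allpairsP; exists (nat_of_ord l, x); split=> //=.
by rewrite mem_iota add0n ltn_ord.
Qed.

(** A module form of Zariski's lemma, eliminating the variables one after another. *)
Lemma fgen_findim s (w : 'I_s -> S) :
  (forall u : S, (forall m : M, u *: m = 0) \/ (forall m : M, exists m', m = u *: m')) ->
  fgen w -> exists ms : seq M, forall m,
    rspan (fun u => exists a, u = c a) (fun y => y \in ms) m.
Proof.
move=> simpleM; elim: s w => [|s IH] w fgw; last first.
  have [f f0 fM] := fgen_annihilator simpleM fgw.
  by have [w' /IH] := fgen_reduce f0 fM fgw.
have [ms msP] := fgw; exists ms => m.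
elim: (msP m) => [|_ x y [q ->] xms _ IHm]; first by constructor.
apply: rspanD => //; exists q@_0; rewrite -[RHS](mmapC w); congr mmap.
apply/mpolyP => m0; rewrite mcoeffC.
by have -> : m0 = 0%MM; [apply/mnmP => -[] | rewrite eqxx mulr1].
Qed.

End Noether.

(** * The polynomial module defined by commuting operators *)

Section MpolyModule.
Variables (k : fieldType) (M : lmodType k) (N : nat) (z : 'I_N -> M -> M).
Hypothesis z_lin : forall i, linear (z i).
Hypothesis z_comm : forall i j x, z i (z j x) = z j (z i x).

Definition monact (r : seq 'I_N) (m : 'X_{1..N}) (x : M) : M :=
  foldr (fun i y => iter (m i) (z i) y) x r.

Lemma iter_lin i d : linear (iter d (z i)).
Proof. by elim: d => // d IH a x y; rewrite !iterS IH z_lin. Qed.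

Lemma monact_lin r m : linear (monact r m).
Proof. by elim: r => // i r IH a x y; rewrite /= -/(monact r m) IH iter_lin. Qed.

Lemma iter_comm i j d e x :
  iter d (z i) (iter e (z j) x) = iter e (z j) (iter d (z i) x).
Proof.
have z1 e' y : z i (iter e' (z j) y) = iter e' (z j) (z i y).
  by elim: e' => // e' IH; rewrite !iterS z_comm IH.
by elim: d => // d IH; rewrite !iterS IH z1.
Qed.

Lemma monact_comm i d r m x :
  iter d (z i) (monact r m x) = monact r m (iter d (z i) x).
Proof. by elim: r => // j r IH; rewrite /= iter_comm -/(monact r m) IH. Qed.

Lemma monactD r m1 m2 x :
  monact r (m1 + m2)%MM x = monact r m1 (monact r m2 x).
Proof.
elim: r => //= i r; rewrite -/(monact r _) => ->.
by rewrite mnmDE iterD; congr (iter _ _ _); rewrite monact_comm.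
Qed.

Lemma monact0 r x : monact r 0%MM x = x.
Proof. by elim: r => //= i r ->; rewrite mnm0E. Qed.

Let W := monact (enum 'I_N).

Definition mpact (p : {mpoly k[N]}) (x : M) : M :=
  \sum_(m <- msupp p) p@_m *: W m x.

Lemma mpactE d p x : (msize p <= d)%N ->
  mpact p x = \sum_(m : 'X_{1..N < d}) p@_m *: W m x.
Proof.
move=> le_pd; pose I : subFinType _ := 'X_{1..N < d}.
rewrite /mpact (big_mksub I) ?msupp_uniq //=; first last.
  by move=> m /msize_mdeg_lt /leq_trans; apply.
by rewrite big_rmcond //= => m /memN_msupp_eq0 ->; rewrite scale0r.
Qed.

Lemma mpact_linl x a p q : mpact (a *: p + q) x = a *: mpact p x + mpact q x.
Proof.
pose d := maxn (msize (a *: p + q)) (maxn (msize p) (msize q)).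
rewrite !(@mpactE d) ?leq_max ?leqnn ?orbT // scaler_sumr -big_split /=.
by apply: eq_bigr => m _; rewrite mcoeffD mcoeffZ scalerDl scalerA.
Qed.

Lemma mpact_linr p : linear (mpact p).
Proof.
move=> a x y; rewrite /mpact scaler_sumr -big_split /=.
by apply: eq_bigr => m _; rewrite /W monact_lin scalerDr !scalerA mulrC.
Qed.

Lemma mpact_suml (I : Type) (r : seq I) (a : I -> k) (P : I -> {mpoly k[N]}) x :
  mpact (\sum_(i <- r) a i *: P i) x = \sum_(i <- r) a i *: mpact (P i) x.
Proof.
elim: r => [|i r IH]; last by rewrite !big_cons mpact_linl IH.
by rewrite !big_nil /mpact msupp0 big_nil.
Qed.

Lemma mpactX m x : mpact 'X_[m] x = W m x.
Proof. by rewrite /mpact msuppX big_seq1 mcoeffX eqxx scale1r. Qed.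

Lemma mpactC a x : mpact a%:MP x = a *: x.
Proof.
rewrite -[a%:MP]mulr1 -mpolyX0 mul_mpolyC -[_ *: _]addr0 mpact_linl mpactX.
by rewrite [mpact 0 x]/mpact msupp0 big_nil addr0 /W monact0.
Qed.

Lemma mpactXi i x : mpact 'X_i x = z i x.
Proof.
rewrite mpactX /W; have : i \in enum 'I_N by rewrite mem_enum.
elim: (enum _) (enum_uniq 'I_N) => // j r IH /= /andP[jr ur].
rewrite inE -/(monact _ _ _) mnm1E; case: eqVneq => [ij _|_ /= /(IH ur)//].
rewrite ij /=; congr z.
elim: r jr {IH ur} => //= l r IH; rewrite inE negb_or -/(monact _ _ _).
by case/andP=> jl /IH ->; rewrite mnm1E (negPf jl).
Qed.

Lemma mpactA p q x : mpact p (mpact q x) = mpact (p * q) x.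
Proof.
have pX m : mpact p (W m x) = mpact (p * 'X_[m]) x.
  rewrite [in RHS](mpolyE p) mulr_suml.
  under [in RHS]eq_bigr do rewrite -scalerAl -mpolyXD.
  rewrite mpact_suml; apply: eq_bigr => m' _.
  by rewrite mpactX /W monactD.
rewrite [in RHS](mpolyE q) mulr_sumr.
under [in RHS]eq_bigr do rewrite -scalerAr.
rewrite mpact_suml [mpact q x]/mpact.
have := mpact_linr p; elim: (msupp q) => [|m r IH] lin.
  by rewrite !big_nil; have := lin (-1) 0 0;
     rewrite scaler0 addr0 scaleN1r addNr.
by rewrite !big_cons lin IH // pX.
Qed.

Lemma mpact_comm (F : M -> M) p x : linear F ->
  (forall i y, z i (F y) = F (z i y)) -> mpact p (F x) = F (mpact p x).
Proof.
move=> F_lin zF; have F0 : F 0 = 0.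
  by have := F_lin (-1) 0 0; rewrite scaler0 addr0 scaleN1r addNr.
have WF m : W m (F x) = F (W m x).
  rewrite /W; elim: (enum _) => //= i r; rewrite -/(monact _ _ _) => ->.
  by elim: (m i) => // d IH; rewrite !iterS IH zF.
rewrite /mpact; elim: (msupp p) => [|m r IH]; first by rewrite !big_nil F0.
by rewrite !big_cons F_lin IH WF.
Qed.

(** An alias of [M] to carry the new scalars. The body mentions both hypotheses so that the instance
    can be attached to a type depending on them. *)
Definition mpmod := let _ := z_lin in let _ := z_comm in (M : Type).
HB.instance Definition _ := GRing.Zmodule.copy mpmod M.

Definition mpscale (p : {mpoly k[N]}) (x : mpmod) : mpmod := mpact p x.

Fact mpscaleA a b x : mpscale a (mpscale b x) = mpscale (a * b) x.
Proof. exact: mpactA. Qed.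
Fact mpscale1 : left_id 1 mpscale.
Proof. by move=> x; rewrite /mpscale -mpolyC1 mpactC scale1r. Qed.
Fact mpscaleDr : right_distributive mpscale +%R.
Proof. by move=> p x y; have := mpact_linr p 1 x y; rewrite !scale1r. Qed.
Fact mpscaleDl x : {morph mpscale^~ x : a b / a + b}.
Proof. by move=> p q; have := mpact_linl x 1 p q; rewrite !scale1r. Qed.

HB.instance Definition _ := GRing.Zmodule_isLmodule.Build {mpoly k[N]} mpmod
  mpscaleA mpscale1 mpscaleDr mpscaleDl.

End MpolyModule.

(** * Powers of ad in characteristic p *)

Section AdPower.
Variables (k : comNzRingType) (V : lmodType k) (f : V -> V) (G : nat -> V -> V).
Hypothesis f_lin : linear f.
Hypothesis GS : forall m v, G m.+1 v = f (G m v) - G m (f v).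

Lemma lin_sum (F : V -> V) (I : Type) (r : seq I) (c : I -> k) (P : I -> V) :
  linear F -> F (\sum_(i <- r) c i *: P i) = \sum_(i <- r) c i *: F (P i).
Proof.
move=> F_lin; elim: r => [|i r IH]; last by rewrite !big_cons F_lin IH.
by rewrite !big_nil; have := F_lin (-1) 0 0; rewrite scaler0 addr0 scaleN1r addNr.
Qed.

(** [G m] stands for ad(f)^m applied to the operator [G 0]; this is the binomial expansion of left
    minus right multiplication by [f]. *)
Lemma ad_iter m v : G m v =
  \sum_(i < m.+1) ((-1) ^+ i * 'C(m, i)%:R) *: iter (m - i) f (G 0 (iter i f v)).
Proof.
elim: m v => [|m IH] v; first by rewrite big_ord1 mul1r scale1r.
rewrite GS !IH lin_sum //.
pose A i := iter (m.+1 - i) f (G 0%N (iter i f v)).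
have -> : \sum_(i < m.+1) ((-1) ^+ i * 'C(m, i)%:R) *: f (iter (m - i) f (G 0 (iter i f v)))
    = \sum_(i < m.+2) ((-1) ^+ i * 'C(m, i)%:R) *: A i.
  rewrite [in RHS]big_ord_recr /= bin_small // mulr0n mulr0 scale0r addr0.
  by apply: eq_bigr => i _; rewrite /A subSn -?iterS // -ltnS.
have -> : \sum_(i < m.+1) ((-1) ^+ i * 'C(m, i)%:R) *: iter (m - i) f (G 0 (iter i f (f v)))
    = - (\sum_(i < m.+2) ((-1) ^+ i * (if nat_of_ord i is i'.+1 then 'C(m, i') else 0)%:R) *: A i).
  rewrite [in RHS]big_ord_recl /= mulr0n mulr0 scale0r add0r -sumrN.
  by apply: eq_bigr => i _; rewrite /A /= exprS mulN1r mulNr scaleNr opprK -iterSr.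
rewrite opprK -big_split /=; apply: eq_bigr => -[[|i] lt_i] _ /=.
  by rewrite mulr0n mulr0 scale0r addr0 !bin0.
by rewrite -scalerDl -mulrDr -natrD binS.
Qed.

Variable p : nat.
Hypothesis charp : p \in [pchar k].

Lemma ad_iter_p v : odd p -> G p v = iter p f (G 0 v) - G 0 (iter p f v).
Proof.
move=> p_odd; have p_pr := pcharf_prime charp.
rewrite ad_iter; have := p_odd; case: (p) charp p_pr => // p' cp p_pr p_odd'.
rewrite big_ord_recl big_ord_recr /= big1 => [|i _].
  rewrite /= add0r expr0 bin0 mul1r scale1r; congr (_ + _).
  by rewrite -[bump 0 p']/p'.+1 subnn binn mulr1 -signr_odd p_odd' expr1 scaleN1r.
have -> : 'C(p'.+1, bump 0 i)%:R = 0 :> k.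
  apply/eqP; rewrite -(dvdn_pcharf cp); apply: prime_dvd_bin => //.
  by rewrite /bump /= add1n ltnS ltn_ord.
by rewrite mulr0 scale0r.
Qed.

(** Consecutive binomial coefficients of p-1 add up to one of p, which vanishes, so they alternate
    in sign. *)
Lemma bin_pred_p i : (i < p)%N -> (-1) ^+ i * 'C(p.-1, i)%:R = 1 :> k.
Proof.
have p_pr := pcharf_prime charp; elim: i => [|i IH] lt_ip.
  by rewrite bin0 mul1r.
have := binS p.-1 i; rewrite prednK ?prime_gt0 // => /(congr1 (fun x => x%:R : k)).
have -> : 'C(p, i.+1)%:R = 0 :> k.
  by apply/eqP; rewrite -(dvdn_pcharf charp); apply: prime_dvd_bin => //; lia.
rewrite natrD => /esym/eqP; rewrite addr_eq0 => /eqP ->.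
by rewrite exprS mulN1r mulrNN IH // ltnW.
Qed.

Lemma ad_iter_pred v :
  G p.-1 v = \sum_(i < p) iter (p.-1 - i) f (G 0 (iter i f v)).
Proof.
rewrite ad_iter prednK ?prime_gt0 ?(pcharf_prime charp) //.
by apply: eq_bigr => i _; rewrite bin_pred_p // scale1r.
Qed.

End AdPower.

Section Brackets.
Variables (k : fieldType) (n : nat).
Implicit Types x y : 'M[k]_(n + n).

Lemma gl_part_mul a b x y : x \in gl_part k n a -> y \in gl_part k n b ->
  x *m y \in gl_part k n (a (+) b).
Proof.
move=> /gl_partP <- /gl_partP <-; apply/gl_partP; rewrite /hpart.
by case: a; case: b; rewrite /= mulmx_block !(mul0mx, mulmx0, addr0, add0r)
  ?block_mxKul ?block_mxKur ?block_mxKdl ?block_mxKdr.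
Qed.

Lemma gl_part_bracket a b x y : x \in gl_part k n a -> y \in gl_part k n b ->
  superbracket x y \in gl_part k n (a (+) b).
Proof.
move=> xa yb; rewrite (superbracket_homogeneous xa yb).
apply: memvB; first exact: gl_part_mul.
by apply: memvZ; rewrite addbC; apply: gl_part_mul.
Qed.

Lemma gl_part_hpart b x : hpart b x \in gl_part k n b.
Proof. by apply/gl_partP; rewrite hpart_hpart eqxx. Qed.

Lemma superbracket_even b x y : x \in gl_part k n false -> y \in gl_part k n b ->
  superbracket x y = x *m y - y *m x.
Proof. by move=> xa yb; rewrite (superbracket_homogeneous xa yb) scale1r. Qed.

Lemma ad_pow p x b y : p \in [pchar k] -> odd p ->
  x \in gl_part k n false -> y \in gl_part k n b ->
  iter p (superbracket x) y = x ^+ p *m y - y *m x ^+ p.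
Proof.
move=> charp p_odd xa yb.
have yb' m : iter m (superbracket x) y \in gl_part k n b.
  by elim: m => // m IH; apply: (gl_part_bracket xa IH).
have iterx m u : iter m (mulmx x) u = x ^+ m *m u.
  by elim: m => [|m IH]; rewrite ?mul1mx // iterS IH exprS -mulmxA.
(* [ad_iter_p] for left multiplication by [x], evaluated at the identity matrix. *)
have := @ad_iter_p k 'M[k]_(n + n) (mulmx x)
  (fun m u => iter m (superbracket x) y *m u) (linearP _) _ p charp 1%:M p_odd.
rewrite !iterx !mulmx1; apply=> m v.
by rewrite /= (superbracket_even xa (yb' m)) mulmxBl !mulmxA.
Qed.

End Brackets.

(** * Representations on superspaces and the central operators x^p - x^[p] *)

Section Rep.
Variables (k : fieldType) (n : nat) (g : {vspace 'M[k]_(n + n)}).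
Variables (V0 V1 : lmodType k).
Implicit Types (x y : 'M[k]_(n + n)) (v : V0 * V1).

(** The operators are indexed by all matrices, with parity and bracket imposed on [g] only; this
    avoids projections to [subvs_of g] when an action is conjugated. *)
Record srep (op : 'M[k]_(n + n) -> V0 * V1 -> V0 * V1) : Prop := Srep {
  srep_linl : forall v, linear (op^~ v);
  srep_lin : forall x, linear (op x);
  srep_par : forall a b x v, x \in g -> x \in gl_part k n a ->
    homogeneous b v -> homogeneous (a (+) b) (op x v);
  srep_bracket : forall a b x y v, x \in g -> y \in g ->
    x \in gl_part k n a -> y \in gl_part k n b ->
    op (superbracket x y) v = op x (op y v) - (-1) ^+ (a && b) *: op y (op x v) }.

Variable op : 'M[k]_(n + n) -> V0 * V1 -> V0 * V1.
Hypothesis g_lie : lie_subsuperalgebra g.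
Hypothesis op_rep : srep op.

Lemma oplD x y v : op (x + y) v = op x v + op y v.
Proof. by have := srep_linl op_rep v 1 x y; rewrite !scale1r. Qed.
Lemma oplZ c x v : op (c *: x) v = c *: op x v.
Proof.
have op0v : op 0 v = 0.
  by have := srep_linl op_rep v (-1) 0 0; rewrite scaler0 addr0 scaleN1r addNr.
by have := srep_linl op_rep v c x 0; rewrite op0v !addr0.
Qed.
Lemma oprD x v w : op x (v + w) = op x v + op x w.
Proof. exact: (opD (op := op) (srep_lin op_rep)). Qed.
Lemma oprZ c x v : op x (c *: v) = c *: op x v.
Proof. exact: (opZ (op := op) (srep_lin op_rep)). Qed.
Lemma opr0 x : op x 0 = 0.
Proof. exact: (op0 (op := op) (srep_lin op_rep)). Qed.
Lemma oprB x v w : op x (v - w) = op x v - op x w.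
Proof. exact: (opB (op := op) (srep_lin op_rep)). Qed.
Lemma opl0 v : op 0 v = 0.
Proof. by rewrite -(scale0r 0) oplZ scale0r. Qed.
Lemma oplN x v : op (- x) v = - op x v.
Proof. by rewrite -scaleN1r oplZ scaleN1r. Qed.
Lemma opl_sum (I : Type) (r : seq I) (c : I -> k) (P : I -> 'M[k]_(n + n)) v :
  op (\sum_(i <- r) c i *: P i) v = \sum_(i <- r) c i *: op (P i) v.
Proof.
by elim: r => [|i r IH]; rewrite ?big_nil ?opl0 // !big_cons oplD oplZ IH.
Qed.

Definition evenp v : V0 * V1 := (v.1, 0).
Definition oddp v : V0 * V1 := (0, v.2).

Lemma evenp_lin : linear evenp.
Proof. by move=> a x y; rewrite /evenp; congr pair; rewrite /= scaler0 addr0. Qed.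

Lemma evenpD_oddp v : v = evenp v + oddp v.
Proof. by case: v => v0 v1; congr pair; rewrite /= ?addr0 ?add0r. Qed.

Lemma evenp_homog b v : homogeneous b v -> evenp v = if b then 0 else v.
Proof. by case: v => v0 v1; case: b => /= ->. Qed.

Lemma oddpE v : oddp v = v - evenp v.
Proof. by rewrite [X in X - _]evenpD_oddp addrAC subrr add0r. Qed.

Lemma homog_evenp v : homogeneous false (evenp v). Proof. by []. Qed.
Lemma homog_oddp v : homogeneous true (oddp v). Proof. by []. Qed.

Lemma op_evenp x v : x \in g -> x \in gl_part k n false ->
  op x (evenp v) = evenp (op x v).
Proof.
move=> xg xe; rewrite [in RHS](evenpD_oddp v) oprD.
have := srep_par op_rep xg xe (homog_evenp v).
have := srep_par op_rep xg xe (homog_oddp v) => /= ho he.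
rewrite -[evenp (_ + _)]/(evenp _) -[_ + _]/(_ + _).
have -> a b : evenp (a + b) = evenp a + evenp b.
  by have := evenp_lin 1 a b; rewrite !scale1r.
by rewrite (@evenp_homog true _ ho) (@evenp_homog false _ he) addr0.
Qed.

Lemma homog_sum (I : Type) (r : seq I) b (F : I -> V0 * V1) :
  (forall i, homogeneous b (F i)) -> homogeneous b (\sum_(i <- r) F i).
Proof.
move=> hF; elim: r => [|i r IH]; first by rewrite big_nil; case: b {hF}.
rewrite big_cons; have := hF i; move: IH; case: (F i) => f0 f1.
by case: (\sum_(_ <- _) _) => s0 s1; case: b {hF} => /= -> ->; rewrite addr0.
Qed.

Lemma homog_scale b c v : homogeneous b v -> homogeneous b (c *: v).
Proof. by case: v => v0 v1; case: b => /= ->; rewrite scaler0. Qed.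

Lemma homog_add b v w : homogeneous b v -> homogeneous b w -> homogeneous b (v + w).
Proof. by case: v w => v0 v1 [w0 w1]; case: b => /= -> ->; rewrite addr0. Qed.

Lemma sq_odd x v : (2%:R != 0 :> k) -> x \in g -> x \in gl_part k n true ->
  op x (op x v) = op (2%:R^-1 *: superbracket x x) v.
Proof.
move=> two xg xo; rewrite oplZ (srep_bracket op_rep _ xg xg xo xo) /= expr1.
by rewrite scaleN1r opprK -mulr2n -scaler_nat scalerA mulVf // scale1r.
Qed.

Section Frobenius.
Variable p : nat.
Hypothesis charp : p \in [pchar k].
Hypothesis p_odd : odd p.
Hypothesis g_res : forall x, x \in g -> x \in gl_part k n false ->
  x ^+ p \in g /\ x ^+ p \in gl_part k n false.

(** The action of x^p - x^[p], where x^[p] is the p-th matrix power. *)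
Definition xi x v := iter p (op x) v - op (x ^+ p) v.

Lemma iter_op_lin m x : linear (iter m (op x)).
Proof. by elim: m => // m IH a u v; rewrite !iterS IH (srep_lin op_rep). Qed.

Lemma xi_lin x : linear (xi x).
Proof.
move=> a u v; rewrite /xi iter_op_lin (srep_lin op_rep) scalerBr opprD.
by rewrite !addrA; congr (_ + _); rewrite addrAC.
Qed.

(** Bracketing [p] times with [x] equals commuting with the p-th power of its operator by
    [ad_iter_p], and bracketing once with x^[p] by [ad_pow]; the difference commutes with the
    action. *)
Lemma xi_op x b y v : x \in g -> x \in gl_part k n false ->
  y \in g -> y \in gl_part k n b -> xi x (op y v) = op y (xi x v).
Proof.
move=> xg xe yg yb; have [xpg xpe] := g_res xg xe.
have adg m : iter m (superbracket x) y \in g /\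
             iter m (superbracket x) y \in gl_part k n b.
  elim: m => // m [IHg IHb]; split; first by rewrite iterS; apply: g_lie.2.
  by rewrite iterS; apply: (gl_part_bracket xe IHb).
have := @ad_iter_p k (V0 * V1)%type (op x)
  (fun m => op (iter m (superbracket x) y)) (srep_lin op_rep x)
  _ p charp v p_odd.
rewrite (ad_pow charp p_odd xe yb) -(superbracket_even xpe yb).
rewrite (srep_bracket op_rep _ xpg yg xpe yb) /= scale1r => E.
rewrite /xi oprB -[X in X - _](subrK (op y (iter p (op x) v))) -E.
  by rewrite addrAC [X in X - _ + _]addrC addrK addrC.
move=> m w; have [ag ab] := adg m.
by rewrite /= (srep_bracket op_rep _ xg ag xe ab) /= scale1r.
Qed.

End Frobenius.

End Rep.

(** * Irreducible representations: monomials and finite dimension *)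

Section Irreducible.
Variables (k : fieldType) (n : nat) (g : {vspace 'M[k]_(n + n)}).
Variables (V0 V1 : lmodType k).
Variable op : 'M[k]_(n + n) -> V0 * V1 -> V0 * V1.
Hypothesis g_lie : lie_subsuperalgebra g.
Hypothesis op_rep : srep g op.

(** Irreducibility in terms of [op]; closure under [evenp] expresses that [W] is graded. *)
Definition rep_irr : Prop :=
  (exists v : V0 * V1, v <> 0) /\
  forall W : V0 * V1 -> Prop, W 0 ->
    (forall c u v, W u -> W v -> W (c *: u + v)) ->
    (forall v, W v -> W (evenp v)) ->
    (forall x v, x \in g -> W v -> W (op x v)) ->
    (forall v, W v -> v = 0) \/ (forall v, W v).

Hypothesis op_irr : rep_irr.

Lemma irr_homog : exists b (v : V0 * V1), v <> 0 /\ homogeneous b v.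
Proof.
have [[v v0] _] := op_irr; have [e0|e0] := classic (evenp v = 0).
  exists true, v; split=> //; have := congr1 fst e0; exact.
by exists false, (evenp v).
Qed.

Section Letters.
Variables (T : finType) (L : T -> 'M[k]_(n + n)) (par : T -> bool).
Hypothesis L_g : forall t, L t \in g.
Hypothesis L_par : forall t, L t \in gl_part k n (par t).
Hypothesis L_gen : forall x, x \in g -> exists c : T -> k, x = \sum_t c t *: L t.

Let opL t := op (L t).

Lemma wact_homog b v w : homogeneous b v -> exists b', homogeneous b' (wact opL w v).
Proof.
move=> hv; elim: w => [|t w [b' IH]]; first by exists b.
by exists (par t (+) b'); apply: (srep_par op_rep).
Qed.

(** The span of all words applied to [v] is stable by [L_gen], and graded because [v] is
    homogeneous. *)
Lemma cyclic b v : v <> 0 -> homogeneous b v ->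
  forall u, spanP (fun m => exists w, m = wact opL w v) u.
Proof.
move=> v0 hv; have [_ irr] := op_irr.
case: (irr (spanP (fun m => exists w, m = wact opL w v))).
- exact: spanP0.
- by move=> c x y Wx Wy; apply: spanP_add => //; apply: spanP_scale.
- move=> x; elim=> [|c y z [w ->] _ IH].
    by have -> : evenp (0 : V0 * V1) = 0 by []; apply: spanP0.
  rewrite evenp_lin; apply: spanP_add => //; apply: spanP_scale.
  have [b' /evenp_homog ->] := wact_homog w hv.
  by case: b'; [apply: spanP0 | apply: spanP_gen; exists w].
- move=> x y xg; elim=> [|c z u [w ->] _ IH].
    by rewrite (opr0 op_rep); apply: spanP0.
  rewrite (oprD op_rep) (oprZ op_rep); apply: spanP_add => //.
  have [a ->] := L_gen xg; rewrite (opl_sum op_rep).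
  apply/spanP_scale/spanP_sum => t _; apply/spanP_scale/spanP_gen.
  by exists (t :: w).
- by move=> W0; case: v0; apply: W0; apply: spanP_gen; exists [::].
- by [].
Qed.

Lemma comm_letters s t : exists (e : bool) (c : T -> k), forall u,
  opL s (opL t u) = (-1) ^+ e *: opL t (opL s u) + \sum_r c r *: opL r u.
Proof.
have [c cE] := L_gen (g_lie.2 _ _ (L_g s) (L_g t)).
exists (par s && par t), c => u.
rewrite -(opl_sum op_rep) -cE (srep_bracket op_rep u (L_g s) (L_g t) (L_par s) (L_par t)).
by rewrite addrC subrK.
Qed.

Variable p : nat.
Hypothesis charp : p \in [pchar k].
Hypothesis p_odd : odd p.
Hypothesis g_res : forall x, x \in g -> x \in gl_part k n false ->
  x ^+ p \in g /\ x ^+ p \in gl_part k n false.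

Lemma two_neq0 : 2%:R != 0 :> k.
Proof.
rewrite -(dvdn_pcharf charp) dvdn_prime2 ?(pcharf_prime charp) //.
by apply: contraL p_odd => /eqP ->.
Qed.

Definition pord t := if par t then 2%N else p.
(** The central part of the top power of a letter. For an odd letter the square is half a bracket,
    hence already in the span of the letters, and the central part is zero. *)
Definition zxi t (v : V0 * V1) : V0 * V1 := if par t then 0 else xi op p (L t) v.

Lemma pow_letters t : exists c : T -> k, forall u,
  iter (pord t) (opL t) u = zxi t u + \sum_r c r *: opL r u.
Proof.
rewrite /pord /zxi; have := L_par t; case: (par t) => Lt.
  have [|c cE] := L_gen (x := 2%:R^-1 *: superbracket (L t) (L t)).
    by apply/memvZ/g_lie.2.
  by exists c => u; rewrite add0r -(opl_sum op_rep) -cE -(sq_odd op_rep) ?two_neq0.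
have [Lpg _] := g_res (L_g t) Lt; have [c cE] := L_gen Lpg.
by exists c => u; rewrite -(opl_sum op_rep) -cE /xi subrK.
Qed.

Lemma pord_gt1 t : (1 < pord t)%N.
Proof. by rewrite /pord; case: (par t) => //; apply/prime_gt1/pcharf_prime/charp. Qed.

Lemma upper_spanning b v (Y : pred T) : v <> 0 -> homogeneous b v ->
  (forall t, Y t -> exists c, forall u, zxi t u = c *: u) ->
  (forall t, ~~ Y t -> exists a, op (L t) v = a *: v) ->
  forall u, spanP (fun m => m \in mons opL v pord (enum Y)) u.
Proof.
move=> v0 hv zY stab u; apply: spanP_sub (cyclic v0 hv u) => _ [w ->].
apply: spanning => //.
- by move=> t; apply: (srep_lin op_rep).
- exact: pord_gt1.
- by move=> s t; have [e [c cE]] := comm_letters s t; exists e, c.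
- move=> t Yt; have [c cE] := pow_letters t; have [c0 c0E] := zY t Yt.
  by exists c0, c => w'; rewrite cE c0E.
Qed.

Lemma mons_homog b v r u : homogeneous b v -> u \in mons opL v pord r ->
  exists b', homogeneous b' u.
Proof.
move=> hv; elim: r u => [|t r IH] u /=; first by rewrite inE => /eqP ->; exists b.
case/allpairsP => -[a u'] [/= _ /IH[b' hu'] ->].
elim: a => [|a [b'' IHa]]; first by exists b'.
by exists (par t (+) b''); apply: (srep_par op_rep).
Qed.

Lemma zxi_lin t : linear (zxi t).
Proof.
rewrite /zxi; case: (par t); last exact: xi_lin op_rep _ _.
by move=> a x y; rewrite scaler0 addr0.
Qed.

Lemma zxi_op t x v : x \in g -> zxi t (op x v) = op x (zxi t v).
Proof.
move=> xg; rewrite /zxi; have := L_par t; case: (par t) => Lt.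
  by rewrite (opr0 op_rep).
rewrite (hpartD x) !(oplD op_rep) -!(xi_op g_lie op_rep charp p_odd g_res _ (L_g t) Lt _ (gl_part_hpart _ _)).
- have := xi_lin op_rep p (L t) 1; move=> lin; have := lin (op (hpart false x) v) (op (hpart true x) v).
  by rewrite !scale1r.
- exact: g_lie.1.
- exact: g_lie.1.
Qed.

Lemma zxi_evenp t v : zxi t (evenp v) = evenp (zxi t v).
Proof.
rewrite /zxi; have := L_par t; case: (par t) => Lt; first by [].
have [Lpg Lpe] := g_res (L_g t) Lt.
rewrite /xi (op_evenp op_rep) //.
have -> : iter p (op (L t)) (evenp v) = evenp (iter p (op (L t)) v).
  by elim: (p) => // m IH; rewrite !iterS IH (op_evenp op_rep).
by rewrite /evenp; congr pair; rewrite /= subr0.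
Qed.

Lemma zxi_comm s t v : zxi s (zxi t v) = zxi t (zxi s v).
Proof.
rewrite {2 3}/zxi; have := L_par t; case: (par t) => Lt.
  by have := zxi_lin s (-1) 0 0; rewrite scaler0 addr0 scaleN1r addNr.
have [Lpg Lpe] := g_res (L_g t) Lt; rewrite /xi -(zxi_op _ _ Lpg).
have -> : iter p (op (L t)) (zxi s v) = zxi s (iter p (op (L t)) v).
  by elim: (p) => // m IH; rewrite !iterS IH zxi_op.
have := zxi_lin s (-1) (op (L t ^+ p) v) (iter p (op (L t)) v).
by rewrite !scaleN1r ![- _ + _]addrC.
Qed.

(** The operators [zxi t] commute with the action and with each other, so the space is a module over
    a polynomial ring with one variable per letter. Ordered monomials generate it, and the image of
    any polynomial is a graded submodule, hence zero or everything: [fgen_findim] applies. *)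
Lemma irr_findim : exists ms : seq (V0 * V1), forall u, spanP (fun m => m \in ms) u.
Proof.
have [b [v [v0 hv]]] := irr_homog.
pose N := #|T|; pose z (i : 'I_N) := zxi (enum_val i).
have z_lin i : linear (z i) by apply: zxi_lin.
have z_comm i j x : z i (z j x) = z j (z i x) by apply: zxi_comm.
pose S := {mpoly k[N]}; pose M := mpmod z_lin z_comm.
have scaleC a (x : M) : (a%:MP : S) *: x = (a *: (x : V0 * V1)) :> V0 * V1.
  exact: mpactC.
have commP (F : V0 * V1 -> V0 * V1) (q : S) (x : M) : linear F ->
    (forall t y, zxi t (F y) = F (zxi t y)) -> q *: (F x : M) = F (q *: x) :> V0 * V1.
  by move=> F_lin zF; apply: mpact_comm => // i y; apply: zF.
(* Straightening over the polynomial ring: the top power of a letter is now its variable times the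
   vector, plus shorter words. *)
have span : forall u : M, spanP (fun m : M => m \in mons (opL : T -> M -> M) (v : M) pord (enum T)) u.
  move=> u.
  have opL_lin t : linear (opL t : M -> M).
    move=> q x y; rewrite [LHS](oprD op_rep (L t)); congr (_ + _).
    by rewrite (commP (opL t)) //; [apply: srep_lin op_rep _ | move=> s u'; apply: zxi_op].
  have := cyclic v0 hv u; elim=> [|c x y [w ->] _ IH]; first exact: spanP0.
  have -> : (c *: wact opL w v + y)%R = ((c%:MP : S) *: (wact opL w v : M) + (y : M)) :> M.
    by rewrite scaleC.
  apply: spanP_add => //; apply: spanP_scale.
  apply: (@spanning S M T opL v predT pord opL_lin pord_gt1) => //.
  - move=> s t; have [e [a aE]] := comm_letters s t.
    exists e, (fun r => (a r)%:MP) => w'; rewrite [LHS]aE; congr (_ + _).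
      have -> : (-1) ^+ e = ((-1) ^+ e)%:MP :> S by rewrite rmorphXn rmorphN rmorph1.
      by rewrite scaleC.
    by apply: eq_bigr => r _; rewrite scaleC.
  move=> t _; have [a aE] := pow_letters t.
  exists 'X_(enum_rank t), (fun r => (a r)%:MP) => w'; rewrite [LHS]aE; congr (_ + _).
    have := mpactXi z (enum_rank t) (wact opL w' v).
    by rewrite /z enum_rankK => <-.
  by apply: eq_bigr => r _; rewrite scaleC.
have fg : fgen (@mpolyC N k) M (fun i => 'X_i).
  exists (mons (opL : T -> M -> M) (v : M) pord (enum T)) => u.
  elim: (span u) => [|q x y xm _ IH]; first by constructor.
  apply: rspanD => //; exists q; apply: (mmap_unique (F := idfun)) => //.
have simpleM (q : S) : (forall m : M, q *: m = 0) \/ forall m : M, exists m', m = q *: m'.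
  have [_ irr] := op_irr.
  case: (irr (fun m : V0 * V1 => exists m' : M, m = q *: m')).
  - by exists 0; rewrite scaler0.
  - move=> c x y [x' ->] [y' ->]; exists ((c%:MP : S) *: x' + y').
    by rewrite scalerDr scalerA mulrC -scalerA scaleC.
  - move=> x [x' ->]; exists (evenp x').
    by rewrite (commP _ q x' (@evenp_lin _ _ _)) // => t y; apply: zxi_evenp.
  - move=> x y xg [y' ->]; exists (op x y').
    by rewrite (commP _ q y' (srep_lin op_rep x)) // => t u; apply: zxi_op.
  - by move=> q0; left=> m; apply: q0; exists m.
  - by right.
have [ms msP] := fgen_findim simpleM fg.
exists ms => u; have := msP u; elim=> [|_ x y [a ->] xm _ IH]; first exact: spanP0.
by rewrite scaleC; apply: spanPD.
Qed.

End Letters.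
End Irreducible.

(** * Dimension from spanning and independent families *)

Definition indep (k : fieldType) (M : lmodType k) (I : finType) (f : I -> M) :=
  forall c : I -> k, \sum_i c i *: f i = 0 -> forall i, c i = 0.

Lemma spanP_cons_dep (k : fieldType) (M : lmodType k) (x : M) s :
  spanP (fun y => y \in s) x ->
  forall y, spanP (fun y => y \in x :: s) y -> spanP (fun y => y \in s) y.
Proof.
move=> xs y; elim=> [|c z m zs _ IH]; first exact: spanP0.
move: zs; rewrite inE => /predU1P[->|zs]; last exact: spanPD.
by apply: spanP_add => //; apply: spanP_scale.
Qed.

(** Discard vectors depending on the others until the list is independent; coordinates in it give
    the isomorphism with row vectors. *)
Lemma span_vector (k : fieldType) (M : lmodType k) (s : seq M) :
  (forall x, spanP (fun y => y \in s) x) ->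
  exists2 d, (d <= size s)%N & inhabited (Vector.axiom d M).
Proof.
have [m] := ubnP (size s); elim: m s => // m IH s; rewrite ltnS => szs span.
have [ind|dep] := classic (indep (fun i : 'I_(size s) => s`_i)).
  exists (size s) => //; constructor.
  have ex (x : M) : exists c : 'rV[k]_(size s), x == \sum_i c 0 i *: s`_i.
    have [c ->] := spanP_seq (span x); exists (\row_i c i).
    by apply/eqP/eq_bigr => i _; rewrite mxE.
  pose f (x : M) := xchoose (ex x).
  have fE (x : M) : x = \sum_i f x 0 i *: s`_i by apply/eqP/(xchooseP (ex x)).
  have f_uniq x (c : 'rV_(size s)) : x = \sum_i c 0 i *: s`_i -> f x = c.
    rewrite [in LHS](fE x) => /eqP; rewrite -subr_eq0 -sumrB => /eqP E.
    apply/rowP => i; apply/eqP; rewrite -subr_eq0; apply/eqP.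
    apply: (ind (fun i => f x 0 i - c 0 i)).
    by rewrite -[RHS]E; apply: eq_bigr => j _; rewrite scalerBl.
  exists f.
    move=> a x y; apply: f_uniq; rewrite [in LHS](fE x) [in LHS](fE y).
    rewrite scaler_sumr -big_split; apply: eq_bigr => i _ /=.
    by rewrite !mxE scalerDl scalerA.
  exists (fun c : 'rV[k]_(size s) => \sum_i c 0 i *: s`_i) => [x|c]; first by rewrite -fE.
  exact: f_uniq.
have [c cdep] := not_all_ex_not _ _ dep.
have [c0 nall] := imply_to_and _ _ cdep.
have [i ci] := not_all_ex_not _ _ nall.
pose s' := [seq s`_(nat_of_ord j) | j <- rem i (enum 'I_(size s))].
have szs' : (size s' < size s)%N.
  rewrite size_map size_rem ?mem_enum // size_enum_ord.
  by rewrite prednK //; apply: leq_ltn_trans (ltn_ord i).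
have mem_s' (j : 'I_(size s)) : j != i -> s`_j \in s'.
  move=> ji; apply: map_f; rewrite (mem_rem_uniq _ (enum_uniq _)).
  by rewrite !inE ji mem_enum.
have si : spanP (fun y => y \in s') s`_i.
  have -> : s`_i = \sum_(j | j != i) (- (c i)^-1 * c j) *: s`_j.
    have : c i *: s`_i = - \sum_(j | j != i) c j *: s`_j.
      by move: c0; rewrite (bigD1 i) //= => /eqP; rewrite addr_eq0 => /eqP.
    move/(congr1 (fun x => (c i)^-1 *: x)).
    rewrite scalerA mulVf ?scale1r; last exact/eqP.
    move=> ->; rewrite scalerN -scaleNr scaler_sumr.
    by apply: eq_bigr => j _; rewrite scalerA.
  by apply: spanP_sum => j ji; apply/spanP_scale/spanP_gen/mem_s'.
have [||d le_d ax] := IH s'; first exact: leq_trans szs' szs.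
  move=> x; apply: (spanP_cons_dep si); apply: spanP_sub (span x) => y.
  move=> /(nthP 0)[j lt_j <-]; have [->|ji] := eqVneq j (nat_of_ord i).
    exact/spanP_gen/mem_head.
  by apply: spanP_gen; rewrite inE (mem_s' (Ordinal lt_j)) ?orbT.
by exists d => //; apply: leq_trans le_d (ltnW szs').
Qed.

Lemma indep_dim (k : fieldType) (V0 V1 : lmodType k) d0 d1 (I : finType)
    (f : I -> V0 * V1) :
  Vector.axiom d0 V0 -> Vector.axiom d1 V1 -> indep f -> (#|I| <= d0 + d1)%N.
Proof.
move=> [h0 h0_lin [h0' h0K _]] [h1 h1_lin [h1' h1K _]] ind.
pose h v := row_mx (h0 v.1) (h1 v.2).
have h_lin : linear h.
  move=> a u v; rewrite /h scale_row_mx add_row_mx.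
  by rewrite -h0_lin -h1_lin.
pose A : 'M[k]_(#|I|, d0 + d1) := \matrix_i h (f (enum_val i)).
have : row_free A.
  rewrite -kermx_eq0; apply/rowV0P => u /sub_kermxP.
  rewrite mulmx_sum_row => uA.
  have hsum : h (\sum_i u 0 (enum_rank i) *: f i) = 0.
    rewrite -[RHS]uA; have h00 : h 0 = 0.
      by have := h_lin (-1) 0 0; rewrite scaler0 addr0 scaleN1r addNr.
    have -> : h (\sum_i u 0 (enum_rank i) *: f i) =
       \sum_i u 0 (enum_rank i) *: h (f i).
      elim: (index_enum I) => [|i r IH]; first by rewrite !big_nil.
      by rewrite !big_cons h_lin IH.
    rewrite (reindex (@enum_val I (mem predT))) /=; last first.
      by exists enum_rank => i _; [apply: enum_valK | apply: enum_rankK].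
    by apply: eq_bigr => i _; rewrite rowK enum_valK.
  have sum0 : \sum_i u 0 (enum_rank i) *: f i = 0.
    move: hsum; move: (\sum_i _) => v; rewrite /h -[RHS]row_mx0 => /eq_row_mx[E0 E1].
    have h00 : h0 0 = 0.
      by have := h0_lin (-1) 0 0; rewrite scaler0 addr0 scaleN1r addNr.
    have h10 : h1 0 = 0.
      by have := h1_lin (-1) 0 0; rewrite scaler0 addr0 scaleN1r addNr.
    case: v E0 E1 => v0 v1 /= E0 E1; congr pair.
      by rewrite -(h0K v0) -(h0K 0) E0 h00.
    by rewrite -(h1K v1) -(h1K 0) E1 h10.
  by apply/rowP => i; rewrite mxE -(enum_valK i) (ind _ sum0).
by move/eqP <-; apply: rank_leq_col.
Qed.

Section HasDim.
Variables (k : fieldType) (n : nat) (g : {vspace 'M[k]_(n + n)}).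
Variable M : supermodule g.

(** Homogeneous generators split into two lists, one for each component, with total length that of
    [s]. *)
Lemma span_has_dim (s : seq (sm_even M * sm_odd M)) :
  (forall x, x \in s -> exists b, homogeneous b x) ->
  (forall x, spanP (fun y => y \in s) x) ->
  exists2 d, has_dim M d & (d <= size s)%N.
Proof.
move=> hs span.
pose s0 := [seq v.1 | v <- s & v.2 == 0].
pose s1 := [seq v.2 | v <- s & v.2 != 0].
have sp0 : forall x, spanP (fun y => y \in s0) x.
  move=> x; have := span (x, 0).
  rewrite -[x in X in _ -> X]/((x, 0 : sm_odd M).1).
  elim=> [|c z m zs _ IH]; first exact: spanP0.
  rewrite /=; have [z20|z20] := eqVneq z.2 0.
    by apply: spanPD IH; apply: map_f; rewrite mem_filter z20 eqxx.
  have [b hz] := hs z zs; have -> : z.1 = 0.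
    by case: b hz => /= // z2; rewrite z2 eqxx in z20.
  by rewrite scaler0 add0r.
have sp1 : forall x, spanP (fun y => y \in s1) x.
  move=> x; have := span (0, x).
  rewrite -[x in X in _ -> X]/((0 : sm_even M, x).2).
  elim=> [|c z m zs _ IH]; first exact: spanP0.
  rewrite /=; have [z20|z20] := eqVneq z.2 0.
    by rewrite z20 scaler0 add0r.
  by apply: spanPD IH; apply: map_f; rewrite mem_filter z20.
have [d0 le0 ax0] := span_vector sp0; have [d1 le1 ax1] := span_vector sp1.
exists (d0 + d1)%N; first by exists d0, d1.
apply: leq_trans (leq_add le0 le1) _; rewrite !size_map !size_filter.
by rewrite -(count_predC (fun v => v.2 == 0)).
Qed.

Lemma indep_has_dim (I : finType) (f : I -> sm_even M * sm_odd M) d :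
  has_dim M d -> indep f -> (#|I| <= d)%N.
Proof. by move=> [d0 [d1 [[ax0] [ax1] ->]]]; apply: indep_dim. Qed.

Definition sop (x : 'M[k]_(n + n)) (v : sm_even M * sm_odd M) :=
  sm_act (vsproj g x) v.

Lemma sop_rep : srep g sop.
Proof.
split.
- by move=> v a x y; rewrite /sop linearP sm_act_linear_l.
- by move=> x; apply: sm_act_linear_r.
- by move=> a b x v xg xa hv; apply: sm_act_parity; rewrite ?vsprojK.
- move=> a b x y v xg yg xa yb; rewrite /sop.
  by have := @sm_act_bracket _ _ _ M a b (vsproj g x) (vsproj g y) v;
     rewrite !vsprojK //; apply.
Qed.

End HasDim.

(** * Jacobson's argument: x^p - x^[p] is additive in x *)

Lemma map_mx_exp (R S : pzRingType) (f : {rmorphism R -> S}) n (A : 'M[R]_n) m :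
  map_mx f (A ^+ m) = map_mx f A ^+ m.
Proof.
elim: m => [|m IH]; first exact: map_mx1.
by rewrite !exprS -IH; apply: map_mxM.
Qed.

Section DerivMx.
Variable R : comNzRingType.
Notation D := (map_mx (@deriv R)).

Lemma deriv_mxM m n r (A : 'M[{poly R}]_(m, n)) (B : 'M_(n, r)) :
  D (A *m B) = D A *m B + A *m D B.
Proof.
apply/matrixP => i j; rewrite !mxE raddf_sum -big_split /=.
by apply: eq_bigr => l _; rewrite !mxE derivM.
Qed.

Lemma deriv_mxX n (A : 'M[{poly R}]_n) m :
  D (A ^+ m) = \sum_(i < m) A ^+ (m.-1 - i) *m (D A *m A ^+ i).
Proof.
have EA (B C : 'M[{poly R}]_n) : B * C = B *m C by [].
elim: m => [|m IH].
  rewrite big_ord0; apply/matrixP => i j; rewrite !mxE.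
  by case: (i == j); rewrite ?deriv0 // -[1%:R]/(1%:P) derivC.
rewrite exprS EA deriv_mxM IH big_ord_recr /= subnn mul1mx addrC; congr (_ + _).
rewrite mulmx_sumr; apply: eq_bigr => i _.
by rewrite mulmxA -[A *m A ^+ _]EA -exprS; congr (_ ^+ _ *m _); have := ltn_ord i; lia.
Qed.

End DerivMx.

Definition mxbr {R : pzRingType} {n} (A B : 'M[R]_n) := A *m B - B *m A.

Lemma mxbr_linl (R : comPzRingType) n (B : 'M[R]_n) : linear (mxbr^~ B).
Proof.
move=> a X Y; rewrite /mxbr mulmxDl mulmxDr -scalemxAl -scalemxAr scalerBr.
by rewrite opprD addrACA.
Qed.

Lemma mxbr_linr (R : comPzRingType) n (A : 'M[R]_n) : linear (mxbr A).
Proof.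
move=> a X Y; rewrite /mxbr mulmxDl mulmxDr -scalemxAl -scalemxAr scalerBr.
by rewrite opprD addrACA.
Qed.

(** The right-hand side is the derivative of A^p in the direction [B] (compare [deriv_mxX]). *)
Lemma ad_mx_pred (k : fieldType) (p n : nat) (A B : 'M[{poly k}]_n) :
  p \in [pchar k] ->
  iter p.-1 (mxbr A) B = \sum_(i < p) A ^+ (p.-1 - i) *m (B *m A ^+ i).
Proof.
move=> charp; have charp' : p \in [pchar {poly k}].
  by rewrite inE (pcharf_prime charp) -polyC_natr (pcharf0 charp) polyC0 eqxx.
have iterA m u : iter m (mulmx A) u = A ^+ m *m u :> 'M_n.
  by elim: m => [|m IH]; rewrite ?mul1mx // iterS IH exprS -mulmxA.
have := @ad_iter_pred _ 'M[{poly k}]_n (mulmx A)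
  (fun m u => iter m (mxbr A) B *m u) (linearP _) _ p charp' 1%:M.
rewrite mulmx1 => -> => [|m v]; last by rewrite /= /mxbr mulmxBl !mulmxA.
by apply: eq_bigr => i _; rewrite !iterA mulmx1.
Qed.

Section Jacobson.
Variables (k : fieldType) (p : nat) (n d : nat).
Hypothesis charp : p \in [pchar k].
Variable rho : 'M[k]_n -> 'M[k]_d.
Hypothesis rho_lin : linear rho.
Hypothesis rho_lie : forall x y,
  rho (x *m y - y *m x) = rho x *m rho y - rho y *m rho x.

Notation K := {poly k}.
Notation "x ^P" := (map_mx (@polyC k) x) (at level 2).
Notation D := (map_mx (@deriv k)).

(** Extension of [rho] to matrices with polynomial entries. *)
Let rhoP (Z : 'M[K]_n) : 'M[K]_d :=
  \sum_i \sum_j Z i j *: (rho (delta_mx i j))^P.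

Lemma rho_sum (I : Type) (r : seq I) (c : I -> k) (F : I -> 'M[k]_n) :
  rho (\sum_(i <- r) c i *: F i) = \sum_(i <- r) c i *: rho (F i).
Proof.
elim: r => [|i r IH]; last by rewrite !big_cons rho_lin IH.
rewrite !big_nil; have := rho_lin (-1) 0 0.
by rewrite scaler0 addr0 scaleN1r addNr.
Qed.

Lemma rhoE x : rho x = \sum_i \sum_j x i j *: rho (delta_mx i j).
Proof.
by rewrite [in LHS](matrix_sum_delta x) !pair_bigA rho_sum.
Qed.

Lemma rhoP_lin : linear rhoP.
Proof.
move=> a Z Z'; rewrite /rhoP scaler_sumr -big_split; apply: eq_bigr => i _ /=.
rewrite scaler_sumr -big_split; apply: eq_bigr => j _ /=.
by rewrite !mxE scalerDl scalerA.
Qed.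

Lemma rhoP_const x : rhoP x^P = (rho x)^P.
Proof.
rewrite [in RHS]rhoE /rhoP raddf_sum; apply: eq_bigr => i _ /=.
rewrite raddf_sum; apply: eq_bigr => j _ /=.
by rewrite !mxE; apply/matrixP => a b; rewrite !mxE polyCM.
Qed.

Lemma mxK_ext (F G : 'M[K]_n -> 'M[K]_d) : linear F -> linear G ->
  (forall x, F x^P = G x^P) -> F =1 G.
Proof.
move=> F_lin G_lin FG Z.
have expand (H : 'M[K]_n -> 'M[K]_d) : linear H ->
    H Z = \sum_ij Z ij.1 ij.2 *: H (delta_mx ij.1 ij.2)^P.
  move=> H_lin.
  have EZ : Z = \sum_ij Z ij.1 ij.2 *: (delta_mx ij.1 ij.2)^P.
    rewrite [LHS]matrix_sum_delta pair_bigA; apply: eq_bigr => -[i j] _ /=.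
    by congr (_ *: _); apply/matrixP => a b; rewrite !mxE rmorph_nat.
  rewrite [in LHS]EZ.
  elim: (index_enum _) => [|ij r IH]; last first.
    by rewrite !big_cons H_lin IH.
  rewrite !big_nil; have := H_lin (-1) 0 0.
  by rewrite scaler0 addr0 scaleN1r addNr.
by rewrite !expand //; apply: eq_bigr => ij _; rewrite FG.
Qed.

Lemma rhoP_br Z Z' : rhoP (mxbr Z Z') = mxbr (rhoP Z) (rhoP Z').
Proof.
have br_const (x y : 'M[k]_n) : mxbr x^P y^P = (mxbr x y)^P.
  by rewrite /mxbr -!map_mxM -map_mxB.
have br_const' (x y : 'M[k]_d) : mxbr x^P y^P = (mxbr x y)^P.
  by rewrite /mxbr -!map_mxM -map_mxB.
apply: (mxK_ext (F := fun Z => rhoP (mxbr Z Z')) (G := fun Z => mxbr (rhoP Z) (rhoP Z'))).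
- by move=> a X Y; rewrite mxbr_linl rhoP_lin.
- by move=> a X Y; rewrite rhoP_lin mxbr_linl.
move=> {Z} x.
apply: (mxK_ext (F := fun Z => rhoP (mxbr x^P Z)) (G := fun Z => mxbr (rhoP x^P) (rhoP Z))).
- by move=> a X Y; rewrite mxbr_linr rhoP_lin.
- by move=> a X Y; rewrite rhoP_lin mxbr_linr.
by move=> {Z'} y; rewrite br_const !rhoP_const br_const' /mxbr rho_lie.
Qed.

Lemma rhoP_deriv Z : D (rhoP Z) = rhoP (D Z).
Proof.
rewrite /rhoP raddf_sum; apply: eq_bigr => i _ /=.
rewrite raddf_sum; apply: eq_bigr => j _ /=.
apply/matrixP => a b; rewrite !mxE derivM derivC mulr0 addr0 //.
Qed.

Definition mxi x := rho x ^+ p - rho (x ^+ p).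
Definition mxiP Z := rhoP Z ^+ p - rhoP (Z ^+ p).

(** Both p-th powers have derivative ad(Z)^(p-1)(Z'), before and after applying [rhoP], and [rhoP]
    commutes with ad. *)
Lemma mxiP_deriv (x y : 'M[k]_n) : D (mxiP (x^P + 'X *: y^P)) = 0.
Proof.
set Z := x^P + _.
have DZ : D Z = y^P.
  apply/matrixP => i j; rewrite !mxE derivD derivC derivM derivX derivC.
  by rewrite mul1r mulr0 addr0 add0r.
rewrite /mxiP map_mxB rhoP_deriv !deriv_mxX rhoP_deriv DZ -!ad_mx_pred //.
by elim: p.-1 => [|m IH]; rewrite ?subrr // !iterS; apply/eqP; rewrite subr_eq0;
  move/eqP: IH; rewrite subr_eq0 => /eqP ->; rewrite rhoP_br.
Qed.

(** Only the shape matters: besides the two extreme terms there is X times a remainder of degree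
    below [m]. *)
Lemma pow_line (r : nat) (x y : 'M[k]_r) m : exists2 R : 'M[K]_r,
  (x^P + 'X *: y^P) ^+ m.+1 = (x ^+ m.+1)^P + 'X *: R + 'X^(m.+1) *: (y ^+ m.+1)^P
  & forall i j, (size (R i j) <= m)%N.
Proof.
elim: m => [|m [R E szR]].
  exists 0 => [|i j]; last by rewrite mxE size_poly0.
  by rewrite scaler0 addr0.
exists (x^P *m R + y^P *m (x ^+ m.+1)^P + ('X : K) *: (y^P *m R) +
        ('X^m : K) *: (x^P *m (y ^+ m.+1)^P)).
  rewrite exprS E.
  have EA (B C : 'M[K]_r) : B * C = B *m C by [].
  rewrite !map_mx_exp ![_ ^+ m.+2]exprS !EA.
  rewrite mulmxDl !mulmxDr -!scalemxAl -!scalemxAr.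
  move: (_ *m _) (_ *m _) (_ *m _) (_ *m _) (_ *m _) (_ *m _) => M1 M2 M3 M4 M5 M6.
  by apply/matrixP => i j; rewrite !mxE !exprS; ring.
move=> i j.
have addE (A B : 'M[K]_r) : (A + B) i j = A i j + B i j by rewrite mxE.
have sclE a (A : 'M[K]_r) : (a *: A) i j = a * A i j by rewrite mxE.
rewrite !addE !sclE.
have szC (u : 'M[k]_r) (B : 'M[K]_r) l : (forall a b, size (B a b) <= l)%N ->
    (size ((u^P *m B) i j) <= l)%N.
  move=> szB; rewrite mxE; apply: (leq_trans (size_sum _ _ _)).
  apply/bigmax_leqP => a _; rewrite mxE mul_polyC.
  exact: leq_trans (size_scale_leq _ _) _.
have sz1 (u : 'M[k]_r) a b : (size (u^P a b) <= 1)%N.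
  by rewrite mxE size_polyC leq_b1.
have szX (q : K) l a : (size q <= l)%N -> (size ('X^a * q)%R <= a + l)%N.
  by move=> szq; rewrite (leq_trans (size_polyMleq _ _)) // size_polyXn leq_add2l.
have sD (a b : K) l : (size a <= l)%N -> (size b <= l)%N -> (size (a + b)%R <= l)%N.
  by move=> sa sb; rewrite (leq_trans (size_polyD _ _)) // geq_max sa.
apply: (sD); last first.
  by rewrite -addn1; apply: szX; apply: szC.
apply: (sD); last by apply: (szX _ m 1%N); apply: szC.
apply: (sD); first exact: leq_trans (szC _ _ _ szR) _.
exact: leq_trans (szC _ _ _ (sz1 _)) _.
Qed.

(** A zero derivative allows only exponents divisible by [p], while those of X r lie strictly
    between 0 and [p]. *)
Lemma deriv_line (a b : k) (r : K) : (size r <= p.-1)%N ->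
  (a%:P + 'X * r + 'X^p * b%:P)^`() = 0 -> r = 0.
Proof.
move=> szr; rewrite !derivD !derivM derivC derivXn derivC mulr0 addr0 add0r.
have -> : 'X^(p.-1) *+ p = 0 :> K.
  by rewrite -mulr_natl -polyC_natr (pcharf0 charp) mul0r.
rewrite mul0r addr0 -derivM => dXr; apply/polyP => i; rewrite coef0.
have [le_i|lt_i] := leqP p.-1 i; first by rewrite nth_default ?(leq_trans szr).
have := congr1 (fun q : K => q`_i) dXr; rewrite coef_deriv coefXM /= coef0.
rewrite -mulr_natr => /eqP; rewrite mulf_eq0 => /orP[/eqP //|].
rewrite -(dvdn_pcharf charp) => /dvdn_leq; have := pcharf_prime charp.
by case: (p) lt_i => //= p' lt_i _ /(_ isT); lia.
Qed.

(** On the line x + X y the expression has zero derivative, so its middle terms vanish; what is left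
    is [mxi x] plus X^p times [mxi y], and X is set to 1. *)
Lemma mxi_add x y : mxi (x + y) = mxi x + mxi y.
Proof.
have p_gt0 : (0 < p)%N by apply/prime_gt0/pcharf_prime/charp.
pose Z := x^P + 'X *: y^P.
have rhoZ : rhoP Z = (rho x)^P + 'X *: (rho y)^P.
  by rewrite /Z addrC rhoP_lin !rhoP_const addrC.
have [R1 E1 sz1] := pow_line (rho x) (rho y) p.-1.
have [R2 E2 sz2] := pow_line x y p.-1.
rewrite prednK // -/Z -rhoZ in E1 E2.
pose R := R1 - rhoP R2.
have szR i j : (size (R i j) <= p.-1)%N.
  rewrite !mxE (leq_trans (size_polyD _ _)) // geq_max sz1 size_polyN.
  rewrite /rhoP summxE (leq_trans (size_sum _ _ _)) //.
  apply/bigmax_leqP => a _; rewrite summxE (leq_trans (size_sum _ _ _)) //.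
  apply/bigmax_leqP => b _; rewrite !mxE mulrC mul_polyC.
  exact: leq_trans (size_scale_leq _ _) _.
have EZ : mxiP Z = (mxi x)^P + 'X *: R + 'X^p *: (mxi y)^P.
  rewrite /mxiP E1 E2.
  have -> : rhoP ((x ^+ p)^P + 'X *: R2 + 'X^p *: (y ^+ p)^P) =
     (rho (x ^+ p))^P + 'X *: rhoP R2 + 'X^p *: (rho (y ^+ p))^P.
    rewrite addrC rhoP_lin addrC [(x ^+ p)^P + _]addrC rhoP_lin !rhoP_const.
    by rewrite [_ + (rho (x ^+ p))^P]addrC.
  rewrite /mxi /R !map_mxB !scalerBr !opprD; move: (_ ^P) (_ ^P) (_ ^P) (_ ^P) (rhoP R2).
  by move=> *; apply/matrixP => i j; rewrite !mxE; ring.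
have R0 : R = 0.
  apply/matrixP => i j; rewrite [RHS]mxE.
  apply: (deriv_line (a := mxi x i j) (b := mxi y i j) (szR i j)).
  have := congr1 (fun A : 'M[K]_d => A i j) (mxiP_deriv x y).
  rewrite -/Z EZ; move: (mxi x) (mxi y) R {szR EZ} => A B R'.
  by rewrite !mxE.
pose ev := map_mx (horner_eval (1 : k)).
have evC m (A : 'M[k]_m) : ev _ _ A^P = A.
  by apply/matrixP => i j; rewrite !mxE /horner_eval hornerC.
have ev_rho W : ev _ _ (rhoP W) = rho (ev _ _ W).
  rewrite rhoE /ev /rhoP raddf_sum; apply: eq_bigr => i _ /=.
  rewrite raddf_sum; apply: eq_bigr => j _ /=.
  by apply/matrixP => a b; rewrite !mxE /horner_eval hornerM hornerC.
have evZ : ev _ _ Z = x + y.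
  by apply/matrixP => i j; rewrite !mxE /horner_eval hornerD hornerM !hornerC hornerX mul1r.
have : ev _ _ (mxiP Z) = mxi (x + y).
  by rewrite /mxiP /ev map_mxB !map_mx_exp -!/(ev _ _) !ev_rho /ev map_mx_exp -/(ev _ _) evZ.
move=> <-; rewrite EZ R0 scaler0 addr0.
apply/matrixP => i j; move: (mxi x) (mxi y) => A B.
by rewrite !mxE /horner_eval hornerD hornerM !hornerC hornerXn expr1n mul1r.
Qed.

Lemma mxi_scale c x : mxi (c *: x) = c ^+ p *: mxi x.
Proof.
have scX m r (A : 'M[k]_r) : (c *: A) ^+ m = c ^+ m *: A ^+ m.
  elim: m => [|m IH]; first by rewrite !expr0 scale1r.
  rewrite !exprS IH; have EA (B C : 'M[k]_r) : B * C = B *m C by [].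
  by rewrite !EA -scalemxAl -scalemxAr scalerA mulrC.
have rhoZ a A : rho (a *: A) = a *: rho A.
  have rho0 : rho 0 = 0.
    by have := rho_lin (-1) 0 0; rewrite scaler0 addr0 scaleN1r addNr.
  by rewrite -[a *: A]addr0 rho_lin rho0 addr0.
by rewrite /mxi rhoZ !scX rhoZ scalerBr.
Qed.

End Jacobson.

(** * Eigenvectors and triangular form over a closed field *)

Lemma closed_root (k : closedFieldType) (q : {poly k}) : (1 < size q)%N ->
  exists x, root q x.
Proof. by move=> szq; apply/closed_rootP; rewrite neq_ltn szq orbT. Qed.

Lemma pth_root (k : closedFieldType) p (a : k) : (0 < p)%N -> exists b, b ^+ p = a.
Proof.
move=> p_gt0; have [|b] := @closed_root k ('X^p - a%:P).
  by rewrite size_XnsubC.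
by rewrite rootE !hornerE subr_eq0 => /eqP; exists b.
Qed.

Lemma exists_eigenvalue (k : closedFieldType) d (A : 'M[k]_d) : (0 < d)%N ->
  exists c, exists2 v : 'rV[k]_d, v != 0 & v *m A = c *: v.
Proof.
move=> d_gt0; have [|c] := @closed_root k (char_poly A).
  by rewrite size_char_poly ltnS.
rewrite -eigenvalue_root_char => /eigenvalueP[v vA v0].
by exists c, v.
Qed.

(** For a nonzero row vector, [row_ebase] is an invertible matrix whose first row is proportional to
    it; here the vector is an eigenvector of [A]. *)
Lemma eigen_unit (k : closedFieldType) n (A : 'M[k]_(1 + n)) :
  exists2 P, P \in unitmx & exists c, row 0 (P *m A) = c *: row 0 P.
Proof.
have [c [v v0 vA]] := exists_eigenvalue A (ltn0Sn n).
exists (row_ebase v); first exact: row_ebase_unit.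
exists c; have rv : \rank v = 1%N by rewrite rank_rV v0.
have vE : v = col_ebase v 0 0 *: row 0 (row_ebase v).
  rewrite -{1}(mulmx_ebase v) rv; apply/rowP => j; rewrite !mxE.
  rewrite (bigD1 0) //= big1 ?addr0 => [|i i0].
    by rewrite !mxE big_ord1 !mxE eqxx mulr1.
  rewrite !mxE big_ord1 !mxE; have -> : (0 == i :> nat) = false.
    by rewrite eq_sym; apply/negbTE; rewrite -(inj_eq val_inj) in i0.
  by rewrite mulr0 mul0r.
have a0 : col_ebase v 0 0 != 0.
  by apply: contraNneq v0 => a0; rewrite vE a0 scale0r.
apply: (scalerI a0); rewrite row_mul scalemxAl -vE vA {1}vE !scalerA.
by rewrite mulrC.
Qed.

Lemma triangularize (k : closedFieldType) n (A : 'M[k]_n) :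
  exists2 P, P \in unitmx &
    forall i j : 'I_n, (i < j)%N -> (P *m A *m invmx P) i j = 0.
Proof.
elim: n A => [|n IH] A; first by exists 1%:M; [apply: unitmx1 | case].
have [P0 P0u [c Prow]] := @eigen_unit k n A.
pose B : 'M[k]_(1 + n) := P0 *m A *m invmx P0.
have [P' P'u P'tri] := IH (drsubmx B).
have B0 : ursubmx B = 0.
  apply/matrixP => i j; rewrite ord1 [RHS]mxE /ursubmx !mxE.
  have : row 0 B = c *: row 0 (1%:M : 'M_(1 + n)).
    by rewrite /B row_mul Prow -scalemxAl -row_mul mulmxV.
  move/(congr1 (fun w : 'rV_(1 + n) => w 0 (rshift 1 j))); rewrite !mxE.
  have -> : lshift n 0 = 0 :> 'I_(1 + n) by apply: val_inj.
  by rewrite /= mulr0.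
pose Q : 'M[k]_(1 + n) := block_mx 1%:M 0 0 P'.
pose Q' : 'M[k]_(1 + n) := block_mx 1%:M 0 0 (invmx P').
have QQ' : Q *m Q' = 1%:M.
  rewrite mulmx_block !mulmx0 !mul0mx !mulmx1 !addr0 !add0r mulmxV //.
  by rewrite -scalar_mx_block.
have Qu : Q \in unitmx by have [] := mulmx1_unit QQ'.
have invQ : invmx Q = Q' by rewrite -[RHS](mulKmx Qu) QQ' mulmx1.
exists (Q *m P0); first by rewrite unitmx_mul Qu.
have -> : Q *m P0 *m A *m invmx (Q *m P0) = Q *m B *m Q'.
  have -> : invmx (Q *m P0) = invmx P0 *m Q'.
    have QPu : Q *m P0 \in unitmx by rewrite unitmx_mul Qu.
    rewrite -[RHS](mulKmx QPu) -[Q *m P0 *m _]mulmxA (mulmxA P0) mulmxV // mul1mx.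
    by rewrite QQ' mulmx1.
  by rewrite /B !mulmxA.
move=> i j; rewrite -[B]submxK B0 /Q /Q' !mulmx_block.
rewrite !(mul0mx, mulmx0, mul1mx, mulmx1, addr0, add0r).
case: (@split_ordP 1 n i) => i' ->; case: (@split_ordP 1 n j) => j' -> /=.
- by rewrite !ord1 ltnn.
- by move=> _; apply: etrans (block_mxEur _ _ _ _ i' j') _; rewrite mxE.
- by rewrite ord1 ltn0.
move=> lt_ij; apply: etrans (block_mxEdr _ _ _ _ i' j') _.
by apply: P'tri; rewrite -(ltn_add2l 1).
Qed.

(** * Both algebras at once, and conjugation by GL(n) *)

Section Family.
Variables (k : fieldType) (n : nat) (q : bool).

(** The boolean [q] selects the queer algebra when true and the periplectic one when false. *)
Definition gfam : {vspace 'M[k]_(n + n)} := if q then queer k n else periplectic k n.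
(** The lower right block of the even element with upper left block [A]; [gtau] is the corresponding
    map on invertible matrices. *)
Definition tau (A : 'M[k]_n) : 'M[k]_n := if q then A else - A^T.
Definition gtau (P : 'M[k]_n) : 'M[k]_n := if q then P else (invmx P)^T.
Definition evA (A : 'M[k]_n) : 'M[k]_(n + n) := block_mx A 0 0 (tau A).
(** Conjugation by the even group element with blocks [P] and [gtau P], an automorphism of [gfam]
    when [P] is invertible. *)
Definition tconj (P : 'M[k]_n) (X : 'M[k]_(n + n)) :=
  block_mx P 0 0 (gtau P) *m X *m block_mx (invmx P) 0 0 (gtau (invmx P)).

Lemma gfam_lie : lie_subsuperalgebra gfam.
Proof. by rewrite /gfam; case: q; [apply: queer_lie | apply: periplectic_lie]. Qed.

Lemma block_diag_even (A D : 'M[k]_n) : block_mx A 0 0 D \in gl_part k n false.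
Proof. by apply/gl_partP; rewrite /hpart block_mxKul block_mxKdr. Qed.

Lemma block_anti_odd (B C : 'M[k]_n) : block_mx 0 B C 0 \in gl_part k n true.
Proof. by apply/gl_partP; rewrite /hpart block_mxKur block_mxKdl. Qed.

Lemma evA_even A : evA A \in gl_part k n false.
Proof. exact: block_diag_even. Qed.

Lemma evA_gfam A : evA A \in gfam.
Proof.
rewrite /evA /gfam /tau; case: q; first by apply/queerP; exists A, 0.
by apply/periplecticP; exists A, 0, 0; rewrite trmx0 oppr0.
Qed.

Lemma gfam_evenP x : x \in gfam -> x \in gl_part k n false -> exists A, x = evA A.
Proof.
rewrite /gfam /evA /tau => xg /gl_partP; rewrite /hpart.
case: q xg => [/queerP[A [B ->]]|/periplecticP[A [B [C [-> _ _]]]]];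
  by rewrite block_mxKul block_mxKdr => <-; exists A.
Qed.

Lemma evA_lin : linear evA.
Proof.
move=> c A B; rewrite /evA scale_block_mx add_block_mx !scaler0 !addr0.
by congr block_mx; rewrite /tau; case: q => //; rewrite linearP opprD scalerN.
Qed.

Lemma mulmx_diag (A B C D : 'M[k]_n) :
  block_mx A 0 0 B *m block_mx C 0 0 D = block_mx (A *m C) 0 0 (B *m D).
Proof. by rewrite mulmx_block !(mulmx0, mul0mx, addr0, add0r). Qed.

Lemma evA_br A B : evA (A *m B - B *m A) = evA A *m evA B - evA B *m evA A.
Proof.
rewrite /evA !mulmx_diag opp_block_mx add_block_mx !oppr0 !addr0.
congr block_mx; rewrite /tau; case: q => //.
by rewrite raddfB /= !trmx_mul opprB !mulNmx !mulmxN !opprK.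
Qed.

Lemma evA_pow A m : odd m -> evA A ^+ m = evA (A ^+ m).
Proof.
move=> m_odd; have powE j : evA A ^+ j = block_mx (A ^+ j) 0 0 (tau A ^+ j).
  elim: j => [|j IH]; first by rewrite !expr0 -scalar_mx_block.
  have EA r (X Y : 'M[k]_r) : X * Y = X *m Y by [].
  by rewrite !exprS IH !EA mulmx_diag.
rewrite powE /evA; congr block_mx; rewrite /tau; case: q => //.
rewrite exprNn -signr_odd m_odd mulN1r; congr (- _).
elim: (m) => [|j IH]; first by rewrite !expr0 trmx1.
by rewrite exprS exprSr IH -[RHS]/((A ^+ j *m A)^T) trmx_mul.
Qed.

Lemma gfam_res p : odd p -> forall x, x \in gfam -> x \in gl_part k n false ->
  x ^+ p \in gfam /\ x ^+ p \in gl_part k n false.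
Proof.
move=> p_odd x xg xe; have [A ->] := gfam_evenP xg xe.
by rewrite evA_pow // evA_gfam evA_even.
Qed.

Section Conj.
Variable P : 'M[k]_n.
Hypothesis Pu : P \in unitmx.

Lemma gtauK : gtau (invmx P) *m gtau P = 1%:M.
Proof.
rewrite /gtau; case: q; first by rewrite mulVmx.
by rewrite -trmx_mul invmxK mulVmx // trmx1.
Qed.

Lemma conjQ : block_mx (invmx P) 0 0 (gtau (invmx P)) *m block_mx P 0 0 (gtau P) = 1%:M.
Proof. by rewrite mulmx_diag mulVmx // gtauK -scalar_mx_block. Qed.

Lemma conjM X Y : tconj P (X *m Y) = tconj P X *m tconj P Y.
Proof.
rewrite /tconj !mulmxA; congr (_ *m _).
by rewrite -[_ *m block_mx (invmx P) _ _ _ *m _]mulmxA conjQ mulmx1.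
Qed.

Lemma conj_lin : linear (tconj P).
Proof. by move=> c X Y; rewrite /tconj mulmxDr mulmxDl -scalemxAr -scalemxAl. Qed.

Lemma conj1 : tconj P 1%:M = 1%:M.
Proof. by rewrite /tconj mulmx1; apply: mulmx1C; apply: conjQ. Qed.

Lemma conjX X m : tconj P (X ^+ m) = tconj P X ^+ m.
Proof.
elim: m => [|m IH]; first exact: conj1.
by rewrite !exprS -IH; apply: conjM.
Qed.

Lemma conj_part b X : X \in gl_part k n b -> tconj P X \in gl_part k n b.
Proof.
move=> Xb; rewrite -[b]addbF -[b]addFb; apply: gl_part_mul (block_diag_even _ _).
by apply: gl_part_mul Xb; apply: block_diag_even.
Qed.

Lemma conj_br X Y a b : X \in gl_part k n a -> Y \in gl_part k n b ->
  tconj P (superbracket X Y) = superbracket (tconj P X) (tconj P Y).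
Proof.
move=> Xa Yb; rewrite (superbracket_homogeneous Xa Yb).
rewrite (superbracket_homogeneous (conj_part Xa) (conj_part Yb)) -!conjM.
by rewrite addrC -scaleNr conj_lin addrC scaleNr.
Qed.

Lemma conj_evA A : tconj P (evA A) = evA (P *m A *m invmx P).
Proof.
rewrite /tconj /evA !mulmx_diag; congr block_mx; rewrite /tau /gtau; case: q => //.
by rewrite invmxK !trmx_mul mulmxN mulNmx !mulmxA.
Qed.

Lemma conj_gfam X : X \in gfam -> tconj P X \in gfam.
Proof.
rewrite /gfam /tconj /gtau.
case: q => [/queerP[A [B ->]]|/periplecticP[A [B [C [-> BE CE]]]]].
  apply/queerP; exists (P *m A *m invmx P), (P *m B *m invmx P).
  by rewrite !mulmx_block !(mulmx0, mul0mx, addr0, add0r).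
apply/periplecticP; exists (P *m A *m invmx P), (P *m B *m P^T),
  ((invmx P)^T *m C *m invmx P).
rewrite !mulmx_block !(mulmx0, mul0mx, addr0, add0r) invmxK.
split; first by congr block_mx; rewrite !trmx_mul mulmxN mulNmx !mulmxA.
  by rewrite !trmx_mul trmxK -BE mulmxA.
by rewrite !trmx_mul trmxK mulmxA {1}CE mulmxN mulNmx.
Qed.

End Conj.

Lemma conjK P X : P \in unitmx -> tconj P (tconj (invmx P) X) = X.
Proof.
move=> Pu; have Pu' : invmx P \in unitmx by rewrite unitmx_inv.
have Q1 := conjQ Pu'; rewrite invmxK in Q1.
by rewrite /tconj invmxK !mulmxA Q1 mul1mx -mulmxA Q1 mulmx1.
Qed.

Section Twist.
Variables (V0 V1 : lmodType k) (op : 'M[k]_(n + n) -> V0 * V1 -> V0 * V1).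
Variable P : 'M[k]_n.
Hypothesis Pu : P \in unitmx.
Hypothesis op_rep : srep gfam op.

Lemma twist_rep : srep gfam (fun x => op (tconj P x)).
Proof.
split.
- by move=> v c x y; rewrite conj_lin (srep_linl op_rep).
- by move=> x; apply: srep_lin op_rep _.
- by move=> a b x v xg xa; apply: (srep_par op_rep); rewrite ?conj_gfam ?conj_part.
move=> a b x y v xg yg xa yb; rewrite (conj_br Pu xa yb).
by apply: (srep_bracket op_rep); rewrite ?conj_gfam ?conj_part.
Qed.

Lemma twist_irr : rep_irr gfam op -> rep_irr gfam (fun x => op (tconj P x)).
Proof.
move=> [nz irr]; split=> // W W0 Wl We Wop; apply: irr => // x v xg Wv.
rewrite -(conjK x Pu); apply: Wop => //.
by apply: conj_gfam; rewrite ?unitmx_inv.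
Qed.

Lemma twist_xi p x v : xi (fun x => op (tconj P x)) p x v = xi op p (tconj P x) v.
Proof. by rewrite /xi conjX. Qed.

End Twist.
End Family.

(** * The p-character of an irreducible module *)

Section PCharacter.
Variables (k : closedFieldType) (p n : nat) (q : bool).
Hypothesis charp : p \in [pchar k].
Hypothesis p_odd : odd p.
Variables (V0 V1 : lmodType k) (op : 'M[k]_(n + n) -> V0 * V1 -> V0 * V1).
Notation g := (gfam k n q).
Hypothesis op_rep : srep g op.
Hypothesis op_irr : rep_irr g op.
Hypothesis op_fin : exists ms : seq (V0 * V1), forall u, spanP (fun m => m \in ms) u.

(** An eigenspace of the commuting operator [xi] is a graded submodule, so [xi] is a scalar. This
    scalar is additive and p-semilinear in [A] by [mxi_add] and [mxi_scale]; the entries of [T] are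
    p-th roots of its values at matrix units. *)
Lemma p_character : exists T : 'M[k]_n, forall A v,
  xi op p (evA q A) v = (\sum_i \sum_j A i j * T i j) ^+ p *: v.
Proof.
have [ms msP] := op_fin; have [d _ [[Phi Phi_lin [Phi' PhiK Phi'K]]]] := span_vector msP.
have Phi'_lin : linear Phi'.
  by move=> a x y; rewrite -[RHS]PhiK Phi_lin !Phi'K.
have d_gt0 : (0 < d)%N.
  rewrite lt0n; apply/eqP => d0; have [[v vn0] _] := op_irr; case: vn0.
  rewrite -(PhiK v) -(PhiK 0); congr Phi'; apply/rowP => i.
  by have := ltn_ord i; rewrite [X in (_ < X)%N]d0.
pose opPhi (x : 'M[k]_(n + n)) (u : 'rV[k]_d) := Phi (op x (Phi' u)).
have opPhi_lin x : linear (opPhi x).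
  by move=> a u w; rewrite /opPhi Phi'_lin (srep_lin op_rep) Phi_lin.
pose R (x : 'M[k]_(n + n)) : 'M[k]_d := \matrix_i opPhi x (delta_mx 0 i).
have RE x v : Phi (op x v) = Phi v *m R x.
  rewrite -{1}(PhiK v) -/(opPhi x (Phi v)) {1}(row_sum_delta (Phi v)).
  have -> : opPhi x (\sum_j Phi v 0 j *: delta_mx 0 j) =
      \sum_j Phi v 0 j *: opPhi x (delta_mx 0 j).
    rewrite (plin_sum (opPhi_lin x)); apply: eq_bigr => j _.
    exact: plinZ (opPhi_lin x) _ _.
  by rewrite mulmx_sum_row; apply: eq_bigr => j _; rewrite rowK.
(* Row vectors are multiplied on the right, so [R] reverses products; the transpose restores a
   homomorphism of Lie algebras. *)
pose rho (A : 'M[k]_n) : 'M[k]_d := (R (evA q A))^T.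
have R_inj (X Y : 'M[k]_d) : (forall v, Phi v *m X = Phi v *m Y) -> X = Y.
  by move=> XY; apply/row_matrixP => i; have := XY (Phi' (delta_mx 0 i));
     rewrite Phi'K -!rowE.
have R_lin : linear R.
  move=> a x y; apply: R_inj => v; rewrite -RE (srep_linl op_rep) Phi_lin !RE.
  by rewrite mulmxDr -scalemxAr.
have rho_lin : linear rho.
  by move=> a A B; rewrite /rho (evA_lin q) R_lin linearP.
have rho_lie A B : rho (A *m B - B *m A) = rho A *m rho B - rho B *m rho A.
  rewrite /rho -!trmx_mul -raddfB; congr (_ ^T); apply: R_inj => v.
  rewrite -RE mulmxBr !mulmxA -!RE evA_br.
  rewrite -(superbracket_even (evA_even q A) (evA_even q B)).
  rewrite (srep_bracket op_rep _ (evA_gfam q A) (evA_gfam q B) (evA_even q A) (evA_even q B)).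
  by rewrite /= scale1r (plinB Phi_lin).
have mxiE A v : Phi (xi op p (evA q A) v) = Phi v *m (mxi p rho A)^T.
  rewrite /xi /mxi raddfB /= mulmxBr /rho trmxK.
  rewrite (plinB Phi_lin) RE evA_pow //; congr (_ - _).
  elim: (p) => [|m IH]; first by rewrite expr0 trmx1 mulmx1.
  have EA (X Y : 'M[k]_d) : X * Y = X *m Y by [].
  by rewrite iterS RE IH exprS EA trmx_mul trmxK mulmxA.
have scal A : exists c, mxi p rho A = c%:M.
  have [c [u u0 uA]] := exists_eigenvalue (mxi p rho A)^T d_gt0.
  exists c; apply: trmx_inj; rewrite tr_scalar_mx; apply: R_inj => v.
  rewrite -mxiE mul_mx_scalar.
  suff -> : xi op p (evA q A) v = c *: v.
    exact: plinZ Phi_lin _ _.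
  have xl := xi_lin op_rep p (evA q A).
  have [_ irr] := op_irr; case: (irr (fun v => xi op p (evA q A) v = c *: v)).
  - by rewrite scaler0; apply: plin0 xl.
  - move=> a x y Wx Wy; rewrite xl Wx Wy scalerDr !scalerA mulrC //.
  - move=> x Wx; have [Lpg Lpe] := gfam_res p_odd (evA_gfam q A) (evA_even q A).
    rewrite /xi (op_evenp op_rep) //.
    have -> : iter p (op (evA q A)) (evenp x) = evenp (iter p (op (evA q A)) x).
      elim: (p) => // m IH; rewrite !iterS IH (op_evenp op_rep) ?evA_gfam ?evA_even //.
    move: Wx; rewrite /xi => Wx.
    by rewrite -(plinB (@evenp_lin _ _ _)) Wx (plinZ (@evenp_lin _ _ _)).
  - move=> x y xg Wy; rewrite (hpartD x) !(oplD op_rep) (plinD xl) scalerDr.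
    by congr (_ + _);
       rewrite (xi_op (gfam_lie k n q) op_rep charp p_odd (gfam_res p_odd) _
                (evA_gfam q A) (evA_even q A) _ (gl_part_hpart _ _)) ?Wy
               ?(oprZ op_rep) //; apply: (gfam_lie k n q).1.
  - move=> W0; case/eqP: u0; rewrite -(Phi'K u) (W0 (Phi' u)).
      exact: plin0 Phi_lin.
    by rewrite -[LHS]PhiK mxiE Phi'K uA (plinZ Phi'_lin).
  - by apply.
have mxi_add := mxi_add charp rho_lin rho_lie.
have mxiZ := mxi_scale p rho_lin.
have root ij : exists t, mxi p rho (delta_mx ij.1 ij.2) = (t ^+ p)%:M.
  have [c ->] := scal (delta_mx ij.1 ij.2).
  by have [t <-] := pth_root c (prime_gt0 (pcharf_prime charp)); exists t.
have [t tE] := fin_all_exists root.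
exists (\matrix_(i, j) t (i, j)) => A v; rewrite -[LHS]PhiK mxiE.
have -> : mxi p rho A = ((\sum_i \sum_j A i j * (\matrix_(i, j) t (i, j)) i j) ^+ p)%:M.
  rewrite {1}[A]matrix_sum_delta !pair_bigA /=.
  rewrite -[RHS]/((pFrobenius_aut charp _)%:M) rmorph_sum raddf_sum.
  elim: (index_enum _) => [|ij r IH].
    rewrite !big_nil; have := mxiZ 0 0; rewrite scale0r expr0n.
    by rewrite gtn_eqF ?scale0r // prime_gt0 ?(pcharf_prime charp).
  rewrite !big_cons mxi_add IH mxiZ tE /= mxE -surjective_pairing; congr (_ + _).
  by rewrite pFrobenius_autE exprMn scale_scalar_mx.
by rewrite tr_scalar_mx mul_mx_scalar (plinZ Phi'_lin) PhiK.
Qed.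

End PCharacter.

Lemma delta_mxM (R : pzRingType) n (i j a b : 'I_n) :
  delta_mx i j *m delta_mx a b = (j == a)%:R *: delta_mx i b :> 'M[R]_n.
Proof.
have [->|ja] := eqVneq j a; first by rewrite mul_delta_mx scale1r.
by rewrite mul_delta_mx_0 // scale0r.
Qed.

Lemma delta_mx_pow (R : pzRingType) n (i j : 'I_n) m : (1 < m)%N ->
  delta_mx i j ^+ m = (i == j)%:R *: delta_mx i j :> 'M[R]_n.
Proof.
case: m => [|[|m]] // _; have EA (X Y : 'M[R]_n) : X * Y = X *m Y by [].
have [->|ij] := eqVneq i j; rewrite ?scale1r ?scale0r; elim: m => [|m IH].
- by rewrite expr2 EA mul_delta_mx.
- by rewrite exprSr IH EA mul_delta_mx.
- by rewrite expr2 EA mul_delta_mx_0 // eq_sym.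
- by rewrite exprSr IH mul0r.
Qed.

Lemma mul_delta_entry (R : comPzRingType) n (P Q : 'M[R]_n) i j a b :
  (P *m delta_mx i j *m Q) a b = P a i * Q j b.
Proof.
rewrite mxE (bigD1 j) //= big1 ?addr0 => [|l lj].
  rewrite mxE (bigD1 i) //= big1 ?addr0 => [|l li].
    by rewrite !mxE !eqxx mulr1.
  by rewrite !mxE (negPf li) mulr0.
rewrite mxE big1 ?mul0r // => l' _.
by rewrite !mxE (negPf lj) andbF mulr0.
Qed.

(** * Common kernel vectors and common eigenvectors *)

Section Killing.
Variables (k : fieldType) (V : lmodType k).

(** Take the last nonzero iterate of [z] on [v]. *)
Lemma kill (z : V -> V) (Q : V -> Prop) m v :
  (forall v, Q v -> Q (z v)) -> Q v -> v <> 0 -> iter m z v = 0 ->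
  exists v', [/\ v' <> 0, Q v' & z v' = 0].
Proof.
move=> Qz; elim: m v => [|m IH] v Qv v0; first by move=> vE; case: v0.
rewrite iterSr => zv; have [zv0|zv0] := classic (z v = 0); first by exists v.
by apply: (IH (z v)) => //; apply: Qz.
Qed.

(** Operators are treated one at a time; the second hypothesis preserves the vanishing already
    achieved while the next operator is iterated. *)
Lemma kill_all (I : eqType) (z : I -> V -> V) (s : seq I) (Q : V -> Prop) v :
  (forall i v, i \in s -> Q v -> Q (z i v)) ->
  (forall i j v, i \in s -> j \in s -> Q v -> z j v = 0 -> z j (z i v) = 0) ->
  (forall i, i \in s -> exists m, forall v, Q v -> iter m (z i) v = 0) ->
  Q v -> v <> 0 -> exists v', [/\ v' <> 0, Q v' & forall i, i \in s -> z i v' = 0].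
Proof.
elim: s => [|i s IH] Qz zz znil Qv v0; first by exists v.
have [||| v1 [v10 Qv1 kv1]] := IH _ _ _ Qv v0.
- by move=> j u js; apply: Qz; rewrite inE js orbT.
- by move=> j l u js ls; apply: zz; rewrite inE ?js ?ls orbT.
- by move=> j js; apply: znil; rewrite inE js orbT.
have [m mP] := znil i (mem_head _ _).
have [||||v2 [v20 [Qv2 kv2] ziv2]] :=
  @kill (z i) (fun u => Q u /\ forall j, j \in s -> z j u = 0) m v1.
- move=> u [Qu ku]; split=> [|j js]; first by apply: Qz; rewrite ?mem_head.
  by apply: zz; rewrite ?mem_head ?inE ?js ?orbT ?ku.
- by [].
- by [].
- exact: mP.
by exists v2; split=> // j; rewrite inE => /predU1P[->//|/kv2].
Qed.

Definition subspace (Q : V -> Prop) :=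
  forall c u v, Q u -> Q v -> Q (c *: u + v).

Lemma pact_root (h : V -> V) (rs : seq k) v : linear h ->
  \sum_(i < (size rs).+1) (\prod_(r <- rs) ('X - r%:P))`_i *: iter i h v =
  foldr (fun r u => h u - r *: u) v rs.
Proof.
move=> h_lin; elim: rs => [|r rs IH] /=.
  by rewrite big_ord1 big_nil coef1 scale1r.
rewrite -IH (plin_sum h_lin) scaler_sumr big_cons.
set q := \prod_(_ <- rs) _.
have szq : (size q <= (size rs).+1)%N by rewrite size_prod_XsubC.
under eq_bigr do rewrite mulrBl coefB coefXM coefCM scalerBl.
rewrite sumrB big_ord_recl /= scale0r add0r; congr (_ - _).
  by apply: eq_bigr => i _; rewrite add0n (plinZ h_lin).
rewrite big_ord_recr /= nth_default // mulr0 scale0r addr0.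
by apply: eq_bigr => i _; rewrite scalerA.
Qed.

End Killing.

Section Eigen.
Variables (k : closedFieldType) (V : lmodType k) (p : nat).
Hypothesis p_gt1 : (1 < p)%N.

(** X^p - X - t splits, so the product of the h - r over its roots kills [v]; the last nonzero
    partial product applied to [v] is an eigenvector. *)
Lemma eigen_vec (h : V -> V) (Q : V -> Prop) t v : linear h -> subspace Q ->
  (forall u, Q u -> Q (h u)) -> (forall u, Q u -> iter p h u = h u + t *: u) ->
  Q v -> v <> 0 -> exists v' c, [/\ v' <> 0, Q v' & h v' = c *: v'].
Proof.
move=> h_lin Qsub Qh hp Qv v0.
have Q0 : Q 0 by have := Qsub (-1) v v Qv Qv; rewrite scaleN1r addNr.
pose f : {poly k} := 'X^p - 'X - t%:P.
have szf : size f = p.+1.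
  rewrite /f -addrA -opprD size_polyDl size_polyXn // size_polyN.
  rewrite size_XaddC; lia.
have f_monic : f \is monic.
  rewrite monicE /f -addrA -opprD lead_coefDl ?lead_coefXn //.
  by rewrite size_polyXn size_polyN size_XaddC; lia.
have [rs fE] := closed_field_poly_normal f.
rewrite (monicP f_monic) scale1r in fE.
have szrs : (size rs).+1 = p.+1 by rewrite -szf fE size_prod_XsubC.
have : foldr (fun r u => h u - r *: u) v rs = 0.
  rewrite -pact_root // -fE szrs /f.
  have pick a (F : nat -> V) : (a < p.+1)%N -> \sum_(i < p.+1) (i == a :> nat)%:R *: F i = F a.
    move=> lt_a; rewrite (bigD1 (Ordinal lt_a)) //= eqxx scale1r big1 ?addr0 // => i.
    by rewrite -val_eqE /= => /negPf ->; rewrite scale0r.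
  have fcoef i : ('X^p - 'X - t%:P)`_i =
      (i == p)%:R - (i == 1)%:R - t * (i == 0)%:R :> k.
    by rewrite !coefB coefXn coefX coefC; case: (i == 0); rewrite ?mulr1 ?mulr0.
  under eq_bigr do rewrite fcoef !scalerBl -scalerA.
  rewrite !sumrB -scaler_sumr !(pick _ (fun i => iter i h v)) ?ltnS ?(ltnW p_gt1) //.
  by rewrite hp // addrAC addrK subrr.
elim: rs {fE szrs} => [|r rs IH] /=; first by move=> vE; case: v0.
set w := foldr _ _ _; have Qw : Q w.
  rewrite /w; elim: (rs) => //= r' rs' IHr.
  by rewrite addrC -scaleNr; apply: Qsub => //; apply: Qh.
move=> hw; have [w0|w0] := classic (w = 0); first exact: IH.
by exists w, r; split=> //; apply/eqP; rewrite -subr_eq0 hw.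
Qed.

Lemma eigen_all (I : eqType) (h : I -> V -> V) (s : seq I) (Q : V -> Prop)
    (t : I -> k) v : (forall i, linear (h i)) -> subspace Q ->
  (forall i u, Q u -> Q (h i u)) ->
  (forall i j u, Q u -> h i (h j u) = h j (h i u)) ->
  (forall i u, Q u -> iter p (h i) u = h i u + t i *: u) ->
  Q v -> v <> 0 ->
  exists v', [/\ v' <> 0, Q v' & forall i, i \in s -> exists c, h i v' = c *: v'].
Proof.
move=> h_lin Qsub Qh hh hp Qv v0.
suff [v' [l [v'0 Qv' hv']]] : exists v' (l : I -> k),
    [/\ v' <> 0, Q v' & forall i, i \in s -> h i v' = l i *: v'].
  by exists v'; split=> // i /hv' ->; exists (l i).
elim: s => [|i s [v1 [l [v10 Qv1 hv1]]]]; first by exists v, (fun=> 0).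
have [||||||v2 [c [v20 [Qv2 hv2] hiv2]]] := @eigen_vec (h i)
  (fun u => Q u /\ forall j, j \in s -> h j u = l j *: u) (t i) v1.
- exact: h_lin.
- move=> c x y [Qx hx] [Qy hy]; split; first exact: Qsub.
  by move=> j js; rewrite h_lin hx // hy // scalerDr !scalerA mulrC.
- move=> u [Qu hu]; split=> [|j js]; first exact: Qh.
  by rewrite hh // hu // (plinZ (h_lin i)).
- by move=> u [Qu _]; apply: hp.
- by [].
- by [].
exists v2, (fun j => if j == i then c else l j); split=> // j.
by rewrite inE; case: eqVneq => [->|_ /= /hv2].
Qed.

End Eigen.

(** * Matrix units of gl(n), and a triangular p-character *)

Section EvenRelations.
Variables (k : fieldType) (n : nat) (q : bool).
Variables (V0 V1 : lmodType k) (op : 'M[k]_(n + n) -> V0 * V1 -> V0 * V1).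
Notation g := (gfam k n q).
Hypothesis op_rep : srep g op.

Definition eop (i j : 'I_n) := op (evA q (delta_mx i j)).

Lemma ee_lin i j : linear (eop i j).
Proof. exact: srep_lin op_rep _. Qed.

Lemma op_br_even b x y v : x \in g -> y \in g -> x \in gl_part k n false ->
  y \in gl_part k n b -> op x (op y v) = op y (op x v) + op (x *m y - y *m x) v.
Proof.
move=> xg yg xe yb; rewrite -(superbracket_even xe yb).
by rewrite (srep_bracket op_rep _ xg yg xe yb) /= scale1r addrC subrK.
Qed.

Lemma op_br_odd x y v : x \in g -> y \in g -> x \in gl_part k n true ->
  y \in gl_part k n true -> op x (op y v) = - op y (op x v) + op (x *m y + y *m x) v.
Proof.
move=> xg yg xo yo; have := srep_bracket op_rep v xg yg xo yo.
rewrite (superbracket_homogeneous xo yo) /= expr1 !scaleN1r !opprK => ->.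
by rewrite addrC addrK.
Qed.

Lemma op_evA_lin v : linear (fun A => op (evA q A) v).
Proof. by move=> c A B; rewrite (evA_lin q) (srep_linl op_rep). Qed.

Lemma comm_ee i j a b v : eop i j (eop a b v) = eop a b (eop i j v) +
  ((j == a)%:R *: eop i b v - (b == i)%:R *: eop a j v).
Proof.
rewrite /eop (op_br_even _ (evA_gfam _ _) (evA_gfam _ _) (evA_even _ _) (evA_even _ _)).
rewrite -evA_br !delta_mxM; congr (_ + _).
by rewrite (plinB (op_evA_lin v)) !(plinZ (op_evA_lin v)).
Qed.

Lemma ee_pow p i j v : (1 < p)%N -> odd p ->
  iter p (eop i j) v = (i == j)%:R *: eop i j v + xi op p (evA q (delta_mx i j)) v.
Proof.
move=> p_gt1 p_odd; rewrite /xi evA_pow // delta_mx_pow //.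
by rewrite (plinZ (op_evA_lin v)) addrC subrK.
Qed.

Lemma ee_homog i j b v : homogeneous b v -> homogeneous b (eop i j v).
Proof. by move=> hv; apply: (srep_par op_rep) (evA_gfam _ _) (evA_even _ _) hv. Qed.

End EvenRelations.

Section PCharTwist.
Variables (k : closedFieldType) (p n : nat) (q : bool).
Hypothesis charp : p \in [pchar k].
Hypothesis p_odd : odd p.
Variables (V0 V1 : lmodType k) (op : 'M[k]_(n + n) -> V0 * V1 -> V0 * V1).
Notation g := (gfam k n q).
Hypothesis op_rep : srep g op.
Hypothesis op_irr : rep_irr g op.
Hypothesis op_fin : exists ms : seq (V0 * V1), forall u, spanP (fun m => m \in ms) u.

(** After conjugation the p-character at E_ij is the p-th power of an entry of a lower triangular
    conjugate of [T]: it vanishes for i < j, and the diagonal entries give [t]. *)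
Lemma borel_twist : exists P (t : 'I_n -> k), let op' x := op (tconj q P x) in
  [/\ P \in unitmx,
      forall A, exists c, forall v, xi op' p (evA q A) v = c *: v,
      forall (i j : 'I_n) v, (i < j)%N -> iter p (eop q op' i j) v = 0
    & forall i v, iter p (eop q op' i i) v = eop q op' i i v + t i *: v].
Proof.
have p_gt1 := prime_gt1 (pcharf_prime charp).
have [T TP] := p_character charp p_odd op_rep op_irr op_fin.
(* The transpose enters because the form pairs A_ij with T_ij rather than with T_ji. *)
have [Q Qu Qtri] := triangularize T; pose P := Q^T.
have Pu : P \in unitmx by rewrite unitmx_tr.
have xiP A v : xi (fun x => op (tconj q P x)) p (evA q A) v =
    (\sum_i \sum_j (P *m A *m invmx P) i j * T i j) ^+ p *: v.
  by rewrite twist_xi // conj_evA // TP.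
have xiE i j v : xi (fun x => op (tconj q P x)) p (evA q (delta_mx i j)) v =
    ((Q *m T *m invmx Q) i j) ^+ p *: v.
  rewrite xiP; congr (_ ^+ p *: _).
  rewrite -[in RHS]mulmxA [in RHS]mxE; apply: eq_bigr => a _.
  rewrite [in RHS]mxE big_distrr /=.
  apply: eq_bigr => b _; rewrite mul_delta_entry /P -trmx_inv !mxE.
  by rewrite -mulrA [_ * T a b]mulrC.
have op'_rep := twist_rep Pu op_rep.
exists P, (fun i => ((Q *m T *m invmx Q) i i) ^+ p); split=> //.
- by move=> A; eexists=> v; apply: xiP.
- move=> i j v lt_ij; rewrite (ee_pow op'_rep) // xiE Qtri // expr0n.
  rewrite gtn_eqF ?(ltnW p_gt1) // scale0r addr0.
  have -> : (i == j) = false by apply/negbTE; rewrite neq_ltn lt_ij.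
  by rewrite scale0r.
by move=> i v; rewrite (ee_pow op'_rep) // xiE eqxx scale1r.
Qed.

End PCharTwist.

(** * Relations of the odd queer elements *)

Section Queer.
Variables (k : fieldType) (n : nat).
Variables (V0 V1 : lmodType k) (op : 'M[k]_(n + n) -> V0 * V1 -> V0 * V1).
Notation g := (gfam k n true).
Hypothesis op_rep : srep g op.
Notation ee := (eop true op).

Definition qB (B : 'M[k]_n) : 'M[k]_(n + n) := block_mx 0 B B 0.

Lemma qB_gfam B : qB B \in g.
Proof. by apply/queerP; exists 0, B. Qed.

Lemma qB_odd B : qB B \in gl_part k n true.
Proof. exact: block_anti_odd. Qed.

Lemma qB_lin : linear qB.
Proof. by move=> c A B; rewrite /qB scale_block_mx add_block_mx !scaler0 !addr0. Qed.

Lemma op_qB_lin v : linear (fun B => op (qB B) v).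
Proof. by move=> c A B; rewrite qB_lin (srep_linl op_rep). Qed.

Definition ff (i j : 'I_n) := op (qB (delta_mx i j)).

Lemma ff_lin i j : linear (ff i j).
Proof. exact: srep_lin op_rep _. Qed.

Lemma comm_ef i j a b v : ee i j (ff a b v) = ff a b (ee i j v) +
  ((j == a)%:R *: ff i b v - (b == i)%:R *: ff a j v).
Proof.
rewrite /ff -/(ff _ _) /eop
  (op_br_even op_rep _ (evA_gfam _ _) (qB_gfam _) (evA_even _ _) (qB_odd _)).
congr (_ + _); rewrite /ff -!(plinZ (op_qB_lin v)) -(plinB (op_qB_lin v)).
rewrite -!delta_mxM /evA /qB /tau !mulmx_block opp_block_mx add_block_mx.
by rewrite !(mulmx0, mul0mx, addr0, add0r, subr0, oppr0).
Qed.

Lemma comm_fe i j a b v : ff i j (ee a b v) = ee a b (ff i j v) +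
  ((j == a)%:R *: ff i b v - (b == i)%:R *: ff a j v).
Proof. by rewrite (comm_ef a b i j) -addrA [X in _ + X]addrC subrKA subrr addr0. Qed.

Lemma comm_ff i j a b v : ff i j (ff a b v) = - ff a b (ff i j v) +
  ((j == a)%:R *: ee i b v + (b == i)%:R *: ee a j v).
Proof.
rewrite /ff (op_br_odd op_rep _ (qB_gfam _) (qB_gfam _) (qB_odd _) (qB_odd _)).
congr (_ + _); rewrite /eop -!(plinZ (op_evA_lin op_rep v)) -(plinD (op_evA_lin op_rep v)).
rewrite -!delta_mxM /evA /qB /tau !mulmx_block add_block_mx.
by rewrite !(mulmx0, mul0mx, addr0, add0r).
Qed.

Lemma ff_homog i j b v : homogeneous b v -> homogeneous (~~ b) (ff i j v).
Proof. by move=> hv; apply: (srep_par op_rep) (qB_gfam _) (qB_odd _) hv. Qed.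

End Queer.

(** * Relations of the odd periplectic elements *)

Section Periplectic.
Variables (k : fieldType) (n : nat).
Variables (V0 V1 : lmodType k) (op : 'M[k]_(n + n) -> V0 * V1 -> V0 * V1).
Notation g := (gfam k n false).
Hypothesis op_rep : srep g op.
Notation ee := (eop false op).

(** The symmetric and the antisymmetric block are parametrized linearly by arbitrary matrices; both
    parametrizations are onto because 2 is invertible. *)
Definition pB (B : 'M[k]_n) : 'M[k]_(n + n) := block_mx 0 (B + B^T) 0 0.
Definition pC (C : 'M[k]_n) : 'M[k]_(n + n) := block_mx 0 0 (C - C^T) 0.

Lemma pB_gfam B : pB B \in g.
Proof.
apply/periplecticP; exists 0, (B + B^T), 0.
by split; rewrite ?trmx0 ?oppr0 // linearD /= trmxK addrC.
Qed.

Lemma pC_gfam C : pC C \in g.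
Proof.
apply/periplecticP; exists 0, 0, (C - C^T).
by split; rewrite ?trmx0 ?oppr0 // linearB /= trmxK opprB.
Qed.

Lemma pB_odd B : pB B \in gl_part k n true.
Proof. exact: block_anti_odd. Qed.

Lemma pC_odd C : pC C \in gl_part k n true.
Proof. exact: block_anti_odd. Qed.

Lemma op_pB_lin v : linear (fun B => op (pB B) v).
Proof.
move=> c A B; rewrite -(srep_linl op_rep); congr op.
rewrite /pB scale_block_mx add_block_mx !scaler0 !addr0; congr block_mx.
by rewrite linearP scalerDr addrACA.
Qed.

Lemma op_pC_lin v : linear (fun B => op (pC B) v).
Proof.
move=> c A B; rewrite -(srep_linl op_rep); congr op.
rewrite /pC scale_block_mx add_block_mx !scaler0 !addr0; congr block_mx.
by rewrite linearP scalerBr addrACA opprD.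
Qed.

Definition bb (i j : 'I_n) := op (pB (delta_mx i j)).
Definition cc (i j : 'I_n) := op (pC (delta_mx i j)).

Lemma bb_lin i j : linear (bb i j). Proof. exact: srep_lin op_rep _. Qed.
Lemma cc_lin i j : linear (cc i j). Proof. exact: srep_lin op_rep _. Qed.

Lemma bb_sym i j v : bb i j v = bb j i v.
Proof. by rewrite /bb /pB !trmx_delta addrC. Qed.

Lemma cc_anti i j v : cc i j v = - cc j i v.
Proof.
rewrite /cc -(oplN op_rep); congr op; rewrite /pC opp_block_mx !oppr0.
by rewrite !trmx_delta opprB.
Qed.

Lemma cc_diag i v : cc i i v = 0.
Proof.
rewrite /cc /pC trmx_delta subrr.
by rewrite (_ : block_mx _ _ _ _ = 0) ?(opl0 op_rep) // /block_mx !row_mx0 col_mx0.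
Qed.

Lemma evA_pB A B :
  evA false A *m pB B - pB B *m evA false A = pB (A *m B + B *m A^T).
Proof.
rewrite /evA /pB /tau !mulmx_block opp_block_mx add_block_mx.
rewrite !(mulmx0, mul0mx, addr0, add0r, subr0, oppr0); congr block_mx.
rewrite [(_ + _)^T]linearD /= !trmx_mul trmxK mulmxN opprK mulmxDl mulmxDr.
by move: (A *m B) (A *m B^T) (B *m A^T) (B^T *m A^T) => X Y Z W;
   apply/matrixP => i j; rewrite !mxE; ring.
Qed.

Lemma evA_pC A C :
  evA false A *m pC C - pC C *m evA false A = pC (- (A^T *m C + C *m A)).
Proof.
rewrite /evA /pC /tau !mulmx_block opp_block_mx add_block_mx.
rewrite !(mulmx0, mul0mx, addr0, add0r, subr0, oppr0); congr block_mx.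
have trD (P Q : 'M[k]_n) : (P + Q)^T = P^T + Q^T by exact: raddfD.
have trN (P : 'M[k]_n) : (- P)^T = - P^T by exact: raddfN.
rewrite trN trD !trmx_mul trmxK mulNmx mulmxBl mulmxBr.
by move: (A^T *m C) (A^T *m C^T) (C *m A) (C^T *m A) => X Y Z W;
   apply/matrixP => i j; rewrite !mxE; ring.
Qed.

Lemma pB_pC B C :
  pB B *m pC C + pC C *m pB B = evA false ((B + B^T) *m (C - C^T)).
Proof.
rewrite /evA /pB /pC /tau !mulmx_block add_block_mx.
rewrite !(mulmx0, mul0mx, addr0, add0r); congr block_mx.
have trD (P Q : 'M[k]_n) : (P + Q)^T = P^T + Q^T by exact: raddfD.
have trB (P Q : 'M[k]_n) : (P - Q)^T = P^T - Q^T by exact: raddfB.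
by rewrite trmx_mul trB trD !trmxK [B^T + B]addrC -mulNmx opprB.
Qed.

Lemma pB_pB B B' : pB B *m pB B' + pB B' *m pB B = 0.
Proof.
by rewrite /pB !mulmx_block !(mulmx0, mul0mx, addr0) /block_mx !row_mx0 col_mx0 addr0.
Qed.

Lemma pC_pC C C' : pC C *m pC C' + pC C' *m pC C = 0.
Proof.
by rewrite /pC !mulmx_block !(mulmx0, mul0mx, addr0) /block_mx !row_mx0 col_mx0 addr0.
Qed.

Lemma comm_eb i j a b v : ee i j (bb a b v) = bb a b (ee i j v) +
  ((j == a)%:R *: bb i b v + (j == b)%:R *: bb a i v).
Proof.
rewrite /eop /bb (op_br_even op_rep _ (evA_gfam _ _) (pB_gfam _) (evA_even _ _) (pB_odd _)).
rewrite evA_pB trmx_delta !delta_mxM [b == j]eq_sym; congr (_ + _).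
by rewrite (plinD (op_pB_lin v)) !(plinZ (op_pB_lin v)).
Qed.

Lemma comm_ec i j a b v : ee i j (cc a b v) = cc a b (ee i j v) -
  ((i == a)%:R *: cc j b v + (i == b)%:R *: cc a j v).
Proof.
rewrite /eop /cc (op_br_even op_rep _ (evA_gfam _ _) (pC_gfam _) (evA_even _ _) (pC_odd _)).
rewrite evA_pC trmx_delta !delta_mxM [b == i]eq_sym; congr (_ + _).
rewrite -[X in pC X]scaleN1r (plinZ (op_pC_lin v)) scaleN1r; congr (- _).
by rewrite (plinD (op_pC_lin v)) !(plinZ (op_pC_lin v)).
Qed.

Lemma comm_bc i j a b v : bb i j (cc a b v) = - cc a b (bb i j v) +
  ((j == a)%:R *: ee i b v - (j == b)%:R *: ee i a v
   + ((i == a)%:R *: ee j b v - (i == b)%:R *: ee j a v)).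
Proof.
rewrite /bb /cc (op_br_odd op_rep _ (pB_gfam _) (pC_gfam _) (pB_odd _) (pC_odd _)).
rewrite pB_pC !trmx_delta mulmxDl !mulmxBr !delta_mxM; congr (_ + _).
have lin := op_evA_lin op_rep v.
by rewrite (plinD lin) !(plinB lin) !(plinZ lin).
Qed.

Lemma comm_bb i j a b v : bb i j (bb a b v) = - bb a b (bb i j v).
Proof.
rewrite /bb (op_br_odd op_rep _ (pB_gfam _) (pB_gfam _) (pB_odd _) (pB_odd _)).
by rewrite pB_pB (opl0 op_rep) addr0.
Qed.

Lemma comm_cc i j a b v : cc i j (cc a b v) = - cc a b (cc i j v).
Proof.
rewrite /cc (op_br_odd op_rep _ (pC_gfam _) (pC_gfam _) (pC_odd _) (pC_odd _)).
by rewrite pC_pC (opl0 op_rep) addr0.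
Qed.

Lemma bb_homog i j b v : homogeneous b v -> homogeneous (~~ b) (bb i j v).
Proof. by move=> hv; apply: (srep_par op_rep) (pB_gfam _) (pB_odd _) hv. Qed.

Lemma cc_homog i j b v : homogeneous b v -> homogeneous (~~ b) (cc i j v).
Proof. by move=> hv; apply: (srep_par op_rep) (pC_gfam _) (pC_odd _) hv. Qed.

Hypothesis two_neq0 : 2%:R != 0 :> k.

Lemma bb_sq i j v : bb i j (bb i j v) = 0.
Proof.
have /eqP := comm_bb i j i j v; rewrite -addr_eq0 -mulr2n -scaler_nat.
by rewrite scaler_eq0 (negPf two_neq0) => /eqP.
Qed.

Lemma cc_sq i j v : cc i j (cc i j v) = 0.
Proof.
have /eqP := comm_cc i j i j v; rewrite -addr_eq0 -mulr2n -scaler_nat.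
by rewrite scaler_eq0 (negPf two_neq0) => /eqP.
Qed.

End Periplectic.

Lemma nat_scale0 (k : nzRingType) (V : lmodType k) (b : bool) (x : V) :
  (b -> x = 0) -> b%:R *: x = 0.
Proof. by case: b => [->//|_]; rewrite ?scaler0 ?scale0r. Qed.

Lemma homog_sub (k : fieldType) (V0 V1 : lmodType k) b c (u v : V0 * V1) :
  homogeneous b u -> homogeneous b v -> homogeneous b (c *: u + v).
Proof. by move=> hu hv; apply: homog_add => //; apply: homog_scale. Qed.

(** * Highest weight vectors *)

Section HighestWeight.
Variables (k : closedFieldType) (p n : nat).
Hypothesis charp : p \in [pchar k].
Hypothesis p_odd : odd p.
Variables (V0 V1 : lmodType k) (op : 'M[k]_(n + n) -> V0 * V1 -> V0 * V1).
Variable t : 'I_n -> k.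
Notation homogV := (@homogeneous k V0 V1).

Section Q.
Hypothesis op_rep : srep (gfam k n true) op.
Hypothesis nil : forall (i j : 'I_n) v, (i < j)%N -> iter p (eop true op i j) v = 0.
Hypothesis tor : forall i v, iter p (eop true op i i) v = eop true op i i v + t i *: v.
Notation ee := (eop true op).
Notation ff := (ff op).

Lemma ff_sq i j v : i != j -> ff i j (ff i j v) = 0.
Proof.
move=> ij; have /eqP := comm_ff op_rep i j i j v.
rewrite [j == i]eq_sym (negPf ij) !scale0r !addr0 -addr_eq0 -mulr2n -scaler_nat.
by rewrite scaler_eq0 (negPf (two_neq0 charp p_odd)) => /eqP.
Qed.

Lemma ff_diag_sq i v : ff i i (ff i i v) = ee i i v.
Proof.
have /eqP := comm_ff op_rep i i i i v; rewrite !eqxx !scale1r.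
rewrite addrC -subr_eq opprK -!mulr2n -!(scaler_nat 2) -subr_eq0 -scalerBr.
by rewrite scaler_eq0 (negPf (two_neq0 charp p_odd)) subr_eq0 => /eqP.
Qed.

Definition killed_q (v : V0 * V1) :=
  forall i j : 'I_n, (i < j)%N -> ee i j v = 0 /\ ff i j v = 0.

Lemma rows_q m v0 b0 : v0 <> 0 -> homogV b0 v0 -> (m <= n)%N ->
  exists v, [/\ v <> 0, exists b, homogV b v &
    forall i j : 'I_n, (i < m)%N -> (i < j)%N -> ee i j v = 0 /\ ff i j v = 0].
Proof.
move=> v00 hv0; elim: m => [|m IH] lt_mn; first by exists v0; split=> //; exists b0.
have [v [vn0 hv kv]] := IH (ltnW lt_mn).
pose i0 := Ordinal lt_mn.
pose z (x : bool * 'I_n) := if x.1 then ff i0 x.2 else ee i0 x.2.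
pose Q (u : V0 * V1) := (exists b, homogV b u) /\
  forall i j : 'I_n, (i < m)%N -> (i < j)%N -> ee i j u = 0 /\ ff i j u = 0.
have [|||||v' [v'0 [hv' kv'] zv']] := @kill_all k _ _ z
   [seq x : bool * 'I_n <- enum {: bool * 'I_n} | i0 < x.2]%N Q v.
- move=> [c j] u; rewrite mem_filter /= => /andP[lt_ij _] [[b hb] ku]; split.
    rewrite /z; case: c; first by exists (~~ b); apply: ff_homog.
    by exists b; apply: ee_homog.
  move=> a d am ad; have aj : (a < j)%N by apply: ltn_trans lt_ij.
  have ja : (j == a) = false by rewrite -val_eqE gtn_eqF.
  have [e1 f1] := ku a d am ad; have [e2 f2] := ku a j am aj.
  rewrite /z; case: c => /=.
    rewrite (comm_ef op_rep) (comm_ff op_rep) e1 f1 e2 f2 ja !scale0r !scaler0.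
    by rewrite (plin0 (ff_lin op_rep _ _)) !(oppr0, addr0).
  rewrite (comm_ee op_rep) (comm_fe op_rep) e1 f1 e2 f2 ja !scale0r !scaler0.
  by rewrite (plin0 (ee_lin op_rep _ _)) !(oppr0, addr0).
- move=> [c j] [c' j'] u; rewrite !mem_filter /= => /andP[ij _] /andP[ij' _] _.
  have ji : (j == i0) = false by rewrite -val_eqE gtn_eqF.
  have ji' : (j' == i0) = false by rewrite -val_eqE gtn_eqF.
  rewrite /z; case: c; case: c' => /= zu0.
  + rewrite (comm_ff op_rep) zu0 ji ji' !scale0r (plin0 (ff_lin op_rep _ _)).
    by rewrite !(oppr0, addr0).
  + rewrite (comm_ef op_rep) zu0 ji ji' !scale0r (plin0 (ff_lin op_rep _ _)).
    by rewrite !(oppr0, addr0).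
  + rewrite (comm_fe op_rep) zu0 ji ji' !scale0r (plin0 (ee_lin op_rep _ _)).
    by rewrite !(oppr0, addr0).
  + rewrite (comm_ee op_rep) zu0 ji ji' !scale0r (plin0 (ee_lin op_rep _ _)).
    by rewrite !(oppr0, addr0).
- move=> [c j]; rewrite mem_filter /= => /andP[ij _]; rewrite /z; case: c => /=.
    by exists 2%N => u _; apply: ff_sq; rewrite -val_eqE ltn_eqF.
  by exists p => u _; apply: nil.
- by split.
- by [].
exists v'; split=> // i j; rewrite ltnS leq_eqVlt => /predU1P[im|im] ij; last exact: kv'.
have -> : i = i0 by apply: val_inj.
have zin c : (c, j) \in [seq x : bool * 'I_n <- enum {: bool * 'I_n} | i0 < x.2]%N.
  by rewrite mem_filter mem_enum andbT /= -im.
by split; [apply: (zv' (false, j)) | apply: (zv' (true, j))].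
Qed.

(** The diagonal E_ii commute, preserve the vectors killed by the positive part, and satisfy h^p = h
    + t, so [eigen_all] applies inside that space. *)
Lemma highest_weight_q v0 b0 : v0 <> 0 -> homogV b0 v0 ->
  exists v b, [/\ v <> 0, homogV b v, killed_q v &
    forall i, exists c, ee i i v = c *: v].
Proof.
move=> v00 hv0; have [v [vn0 [b hv] kv]] := rows_q v00 hv0 (leqnn n).
have [|||||||v' [v'0 [hv' kv'] ev']] := @eigen_all k _ p
  (prime_gt1 (pcharf_prime charp)) _ (fun i => ee i i) (enum 'I_n)
  (fun u => homogV b u /\ killed_q u) t v.
- by move=> i; apply: ee_lin.
- move=> c x y [hx kx] [hy ky]; split=> [|i j ij]; first exact: homog_sub.
  have [e1 f1] := kx i j ij; have [e2 f2] := ky i j ij.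
  by rewrite (ee_lin op_rep) (ff_lin op_rep) e1 e2 f1 f2 scaler0 addr0.
- move=> i u [hu ku]; split=> [|a d ad]; first exact: ee_homog.
  have [e1 f1] := ku a d ad; rewrite (comm_ee op_rep) (comm_fe op_rep) e1 f1.
  rewrite !(plin0 (ee_lin op_rep _ _)) !add0r.
  have ed : ((d == i)%:R : k) *: ee a i u = 0 by apply: nat_scale0 => /eqP <-.
  have fd : ((d == i)%:R : k) *: ff a i u = 0 by apply: nat_scale0 => /eqP <-.
  have ea : ((i == a)%:R : k) *: ee i d u = 0 by apply: nat_scale0 => /eqP ->.
  have fa : ((i == a)%:R : k) *: ff i d u = 0 by apply: nat_scale0 => /eqP ->.
  by rewrite ed fd ea fa subrr.
- move=> i j u _; rewrite (comm_ee op_rep); have [->|ij] := eqVneq i j.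
    by rewrite subrr addr0.
  by rewrite !scale0r subrr addr0.
- by move=> i u _; apply: tor.
- by split=> // i j; apply: kv (ltn_ord i).
- by [].
by exists v', b; split=> // i; apply: ev'; rewrite mem_enum.
Qed.

End Q.

Section P.
Hypothesis op_rep : srep (gfam k n false) op.
Hypothesis nil : forall (i j : 'I_n) v, (i < j)%N -> iter p (eop false op i j) v = 0.
Hypothesis tor : forall i v, iter p (eop false op i i) v = eop false op i i v + t i *: v.
Notation ee := (eop false op).
Notation bb := (bb op).

Definition killed_p (v : V0 * V1) :=
  (forall i j, bb i j v = 0) /\ forall i j : 'I_n, (i < j)%N -> ee i j v = 0.

(** The [bb] anticommute and square to zero. *)
Lemma killed_bb v0 b0 : v0 <> 0 -> homogV b0 v0 ->
  exists v b, [/\ v <> 0, homogV b v & forall i j, bb i j v = 0].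
Proof.
move=> v00 hv0.
have [||||| v [vn0 [b hb] kv]] := @kill_all k _ _ (fun x : 'I_n * 'I_n => bb x.1 x.2)
   (enum {: 'I_n * 'I_n}) (fun u => exists b, homogV b u) v0.
- by move=> x u _ [b hb]; exists (~~ b); apply: bb_homog.
- move=> x y u _ _ _ /= E; rewrite (comm_bb op_rep) E.
  by rewrite (plin0 (bb_lin op_rep _ _)) oppr0.
- by move=> x _; exists 2%N => u _; apply: (bb_sq op_rep (two_neq0 charp p_odd)).
- by exists b0.
- by [].
by exists v, b; split=> // i j; apply: (kv (i, j)); rewrite mem_enum.
Qed.

Lemma rows_p m v0 b : v0 <> 0 -> homogV b v0 -> (forall i j, bb i j v0 = 0) ->
  (m <= n)%N ->
  exists v, [/\ v <> 0, homogV b v, forall i j, bb i j v = 0 &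
    forall i j : 'I_n, (i < m)%N -> (i < j)%N -> ee i j v = 0].
Proof.
move=> v00 hv0 bv0; elim: m => [|m IH] lt_mn; first by exists v0.
have [v [vn0 hv bv kv]] := IH (ltnW lt_mn).
pose i0 := Ordinal lt_mn.
pose Q (u : V0 * V1) := [/\ homogV b u, forall i j, bb i j u = 0 &
  forall i j : 'I_n, (i < m)%N -> (i < j)%N -> ee i j u = 0].
have [|||||v' [v'0 [hv' bv' kv'] zv']] := @kill_all k _ _ (ee i0)
   [seq j : 'I_n <- enum 'I_n | i0 < j]%N Q v.
- move=> j u; rewrite mem_filter /= => /andP[lt_ij _] [hu bu ku]; split.
  + exact: ee_homog.
  + move=> a d; have /eqP := comm_eb op_rep i0 j a d u.
    by rewrite !bu (plin0 (ee_lin op_rep _ _)) !scaler0 !addr0 eq_sym => /eqP.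
  move=> a d am ad; have aj : (a < j)%N by apply: ltn_trans lt_ij.
  have ja : (j == a) = false by rewrite -val_eqE gtn_eqF.
  rewrite (comm_ee op_rep) (ku a d am ad) (ku a j am aj) ja !scale0r !scaler0.
  by rewrite (plin0 (ee_lin op_rep _ _)) !(oppr0, addr0).
- move=> j j' u; rewrite !mem_filter /= => /andP[ij _] /andP[ij' _] _ zu0.
  have ji : (j == i0) = false by rewrite -val_eqE gtn_eqF.
  have ji' : (j' == i0) = false by rewrite -val_eqE gtn_eqF.
  rewrite (comm_ee op_rep) zu0 ji ji' !scale0r (plin0 (ee_lin op_rep _ _)).
  by rewrite !(oppr0, addr0).
- by move=> j; rewrite mem_filter /= => /andP[ij _]; exists p => u _; apply: nil.
- by split.
- by [].
exists v'; split=> // i j; rewrite ltnS leq_eqVlt => /predU1P[im|im] ij; last exact: kv'.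
have -> : i = i0 by apply: val_inj.
by apply: zv'; rewrite mem_filter mem_enum andbT /= -im.
Qed.

Lemma highest_weight_p v0 b0 : v0 <> 0 -> homogV b0 v0 ->
  exists v b, [/\ v <> 0, homogV b v, killed_p v &
    forall i, exists c, ee i i v = c *: v].
Proof.
move=> v00 hv0; have [v1 [b [v10 hv1 bv1]]] := killed_bb v00 hv0.
have [v [vn0 hv bv kv]] := rows_p v10 hv1 bv1 (leqnn n).
have [|||||||v' [v'0 [hv' kv'] ev']] := @eigen_all k _ p
  (prime_gt1 (pcharf_prime charp)) _ (fun i => ee i i) (enum 'I_n)
  (fun u => homogV b u /\ killed_p u) t v.
- by move=> i; apply: ee_lin.
- move=> c x y [hx [bx kx]] [hy [by_ ky]]; split; first exact: homog_sub.
  split=> [i j|i j ij]; first by rewrite (bb_lin op_rep) bx by_ scaler0 addr0.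
  by rewrite (ee_lin op_rep) kx // ky // scaler0 addr0.
- move=> i u [hu [bu ku]]; split; first exact: ee_homog.
  split=> [a d|a d ad].
    have /eqP := comm_eb op_rep i i a d u.
    by rewrite !bu (plin0 (ee_lin op_rep _ _)) !scaler0 !addr0 eq_sym => /eqP.
  rewrite (comm_ee op_rep) ku // (plin0 (ee_lin op_rep _ _)) add0r.
  have ed : ((d == i)%:R : k) *: ee a i u = 0.
    by apply: nat_scale0 => /eqP <-; apply: ku.
  have ea : ((i == a)%:R : k) *: ee i d u = 0.
    by apply: nat_scale0 => /eqP ->; apply: ku.
  by rewrite ed ea subrr.
- move=> i j u _; rewrite (comm_ee op_rep); have [->|ij] := eqVneq i j.
    by rewrite subrr addr0.
  by rewrite !scale0r subrr addr0.
- by move=> i u _; apply: tor.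
- by split=> //; split=> // i j; apply: kv (ltn_ord i).
- by [].
by exists v', b; split=> // i; apply: ev'; rewrite mem_enum.
Qed.

End P.
End HighestWeight.

(** * Upper bound: the periplectic algebra *)

Lemma spanP_coef (S : nzRingType) (M : lmodType S) (T : finType) (L : T -> M) x :
  spanP (fun y => exists t, y = L t) x -> exists c, x = \sum_t c t *: L t.
Proof.
elim=> [|c _ m [t ->] _ [c' ->]].
  by exists (fun=> 0); rewrite big1 // => t _; rewrite scale0r.
exists (fun s => (if s == t then c else 0) + c' s).
under [RHS]eq_bigr do rewrite scalerDl; rewrite big_split /=; congr (_ + _).
by rewrite (bigD1 t) //= eqxx big1 ?addr0 // => s /negPf ->; rewrite scale0r.
Qed.

Lemma spanP_delta (k : fieldType) (M : lmodType k) n (G : M -> Prop)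
    (f : 'M[k]_n -> M) (A : 'M[k]_n) : linear f ->
  (forall i j, spanP G (f (delta_mx i j))) -> spanP G (f A).
Proof.
move=> f_lin Gf; rewrite [A]matrix_sum_delta (plin_sum f_lin).
apply: spanP_sum => i _; rewrite (plin_sum f_lin); apply: spanP_sum => j _.
by rewrite (plinZ f_lin); apply: spanP_scale.
Qed.

Definition tri n := 'C(n, 2).

Lemma card_gt n : #|[pred x : 'I_n * 'I_n | (x.2 < x.1)%N]| = tri n.
Proof.
rewrite -sum1_card /tri -bin2_sum big_mkord.
rewrite (eq_bigl (fun x : 'I_n * 'I_n => true && (x.2 < x.1)%N)) //.
rewrite -(pair_big_dep xpredT (fun i j : 'I_n => (j < i)%N) (fun _ _ => 1%N)) /=.
apply: eq_bigr => i _; rewrite -(big_ord_widen n (fun=> 1%N)) ?(ltnW (ltn_ord i)) //.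
by rewrite sum1_card card_ord.
Qed.

Lemma card_lt n : #|[pred x : 'I_n * 'I_n | (x.1 < x.2)%N]| = tri n.
Proof.
have swapK : involutive (fun x : 'I_n * 'I_n => (x.2, x.1)) by case.
rewrite -card_gt -!sum1_card (reindex_inj (inv_inj swapK)) /=.
by apply: eq_bigl => x; rewrite !inE.
Qed.

Lemma card_oddlast n : #|[pred i : 'I_n | odd i || (i.+1 == n)]| = uphalf n.
Proof.
case: n => [|n]; first by apply: eq_card0 => -[].
have -> : #|[pred i : 'I_n.+1 | odd i || (i.+1 == n.+1)]| =
    (\sum_(i < n.+1) (odd i || (i.+1 == n.+1)))%N.
  by rewrite -sum1_card big_mkcond; apply: eq_bigr => i _; rewrite inE; case: ifP.
rewrite big_ord_recr eqxx orbT /= addn1; congr S.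
rewrite (eq_bigr (fun i : 'I_n => odd i : nat)) => [|i _]; last first.
  by rewrite /= eqSS (ltn_eqF (ltn_ord i)) orbF.
elim: n => [|n IH]; first by rewrite big_ord0.
by rewrite big_ord_recr /= IH uphalf_half addnC.
Qed.

(** The common value of both maxima; the additional [uphalf n] is the contribution of the odd
    diagonal matrices of the queer algebra. *)
Definition kwdim (p n : nat) (q : bool) :=
  (p ^ tri n * 2 ^ (if q then tri n + uphalf n else tri n))%N.

Section Upper.
Variables (k : closedFieldType) (p n : nat).
Hypothesis charp : p \in [pchar k].
Hypothesis p_odd : odd p.

Definition ltr := (bool * ('I_n * 'I_n))%type.
Definition ltr_par (t : ltr) := t.1.

Lemma size_ltr_mons (V : lmodType k) (op : ltr -> V -> V) v (Ye Yo : pred ('I_n * 'I_n)) :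
  size (mons op v (pord ltr_par p) (enum [pred t : ltr | if t.1 then Yo t.2 else Ye t.2]))
  = (p ^ #|Ye| * 2 ^ #|Yo|)%N.
Proof.
rewrite size_mons big_enum /= [RHS]mulnC.
rewrite -!sum1_card !expn_sum.
rewrite big_mkcond -(pair_big xpredT xpredT (fun b x =>
  if (if b then Yo x else Ye x) then pord ltr_par p (b, x) else 1%N)) /=.
by rewrite big_bool -!big_mkcond.
Qed.

(** An odd pair above the diagonal stands for the antisymmetric block, a pair on or below it for the
    symmetric block, so that pairs index generators of the whole odd part. *)
Definition p_letter (t : ltr) : 'M[k]_(n + n) :=
  let E := delta_mx t.2.1 t.2.2 in
  if t.1 then if (t.2.1 < t.2.2)%N then pC E else pB E else evA false E.

Lemma p_letter_gfam t : p_letter t \in gfam k n false.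
Proof.
by rewrite /p_letter; case: t.1; [case: ifP => _; [apply: pC_gfam | apply: pB_gfam]
  | apply: evA_gfam].
Qed.

Lemma p_letter_par t : p_letter t \in gl_part k n (ltr_par t).
Proof.
rewrite /p_letter /ltr_par; case: t.1; last exact: evA_even.
by case: ifP => _; [apply: pC_odd | apply: pB_odd].
Qed.

Lemma pB_lin : linear (@pB k n).
Proof.
move=> c A B; rewrite /pB scale_block_mx add_block_mx !scaler0 !addr0; congr block_mx.
by rewrite linearP scalerDr addrACA.
Qed.

Lemma pC_lin : linear (@pC k n).
Proof.
move=> c A B; rewrite /pC scale_block_mx add_block_mx !scaler0 !addr0; congr block_mx.
by rewrite linearP scalerBr addrACA opprD.
Qed.

Lemma p_letter_gen x : x \in gfam k n false ->
  exists c, x = \sum_t c t *: p_letter t.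
Proof.
move=> /periplecticP[A [B [C [-> BE CE]]]]; apply: spanP_coef.
have half (D : 'M[k]_n) : 2%:R^-1 *: D + 2%:R^-1 *: D = D.
  by rewrite -scalerDl -(mulr2n (2%:R^-1)) -(mulr_natr (2%:R^-1)) mulVf ?scale1r // (two_neq0 charp p_odd).
have -> : block_mx A B C (- A^T) =
    evA false A + (pB (2%:R^-1 *: B) + pC (2%:R^-1 *: C)).
  rewrite /evA /pB /pC /tau !add_block_mx !(addr0, add0r) !linearZ /= -BE.
  have -> : C^T = - C by rewrite {2}CE opprK.
  by rewrite opprK !half.
have letter t : spanP (fun y => exists t, y = p_letter t) (p_letter t).
  by apply: spanP_gen; exists t.
apply: spanP_add; first by apply: (spanP_delta (f := evA false)) => [|i j];
  [apply: evA_lin | apply: (letter (false, (i, j)))].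
apply: spanP_add.
  apply: (spanP_delta (f := @pB k n)) => [|i j]; first exact: pB_lin.
  have := letter (true, (i, j)); have := letter (true, (j, i)).
  rewrite /p_letter /=; case: ltngtP => // _.
  by rewrite /pB !trmx_delta addrC.
apply: (spanP_delta (f := @pC k n)) => [|i j]; first exact: pC_lin.
have := letter (true, (i, j)); have := letter (true, (j, i)).
rewrite /p_letter /=; case: ltngtP => // [_ + _|/val_inj -> _ _].
  move/spanP_opp; rewrite /pC opp_block_mx !oppr0 !trmx_delta opprB.
  exact.
rewrite /pC trmx_delta subrr /block_mx !row_mx0 col_mx0; exact: spanP0.
Qed.

Section Bound.
Variables (V0 V1 : lmodType k) (op : 'M[k]_(n + n) -> V0 * V1 -> V0 * V1).
Variable t : 'I_n -> k.
Notation homogV := (@homogeneous k V0 V1).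

Definition small_span (q : bool) := exists s : seq (V0 * V1),
  [/\ size s = kwdim p n q, forall x, x \in s -> exists b, homogV b x &
      forall u, spanP (fun m => m \in s) u].

(** The highest weight vector disposes of all [bb] and of the upper triangular [ee]; the letters
    left are one [ee] and one [cc] for each pair of distinct indices. *)
Lemma upper_p (op_rep : srep (gfam k n false) op) :
  rep_irr (gfam k n false) op ->
  (forall A, exists c, forall v, xi op p (evA false A) v = c *: v) ->
  (forall (i j : 'I_n) v, (i < j)%N -> iter p (eop false op i j) v = 0) ->
  (forall i v, iter p (eop false op i i) v = eop false op i i v + t i *: v) ->
  small_span false.
Proof.
move=> op_irr xi_scal nil tor.
have [b0 [v0 [v00 hv0]]] := irr_homog op_irr.
have [v [b [vn0 hv [bv kv] ev]]] := highest_weight_p charp p_odd op_rep nil tor v00 hv0.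
pose Y := [pred l : ltr | if l.1 then (l.2.1 < l.2.2)%N else (l.2.2 < l.2.1)%N].
exists (mons (fun l => op (p_letter l)) v (pord ltr_par p) (enum Y)); split.
- rewrite (size_ltr_mons _ _ [pred x : 'I_n * 'I_n | (x.2 < x.1)%N]
    [pred x : 'I_n * 'I_n | (x.1 < x.2)%N]).
  by rewrite card_gt card_lt.
- by move=> x; apply: (mons_homog op_rep p_letter_gfam p_letter_par hv).
apply: (upper_spanning (gfam_lie k n false) op_rep op_irr p_letter_gfam
  p_letter_par p_letter_gen charp p_odd (gfam_res p_odd) vn0 hv).
- move=> [[] x] Yx; rewrite /zxi /=; first by exists 0 => u; rewrite scale0r.
  by have [c cE] := xi_scal (delta_mx x.1 x.2); exists c.
move=> [[] [i j]] /=; rewrite /p_letter /=.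
  by move=> /negPf ->; exists 0; rewrite scale0r; apply: bv.
rewrite -leqNgt leq_eqVlt => /predU1P[/val_inj ->|ij]; first exact: ev.
by exists 0; rewrite scale0r; apply: kv.
Qed.

End Bound.
End Upper.

(** * Upper bound: the queer algebra and its odd Cartan part *)

(** A nonzero isotropic vector of a binary diagonal quadratic form, normalized so that one
    coordinate is 1. *)
Lemma isotropic (k : closedFieldType) (a b : k) : exists u w : k,
  u ^+ 2 * a + w ^+ 2 * b = 0 /\ (u = 1 \/ (u = 0 /\ w = 1)).
Proof.
have [->|b0] := eqVneq b 0.
  by exists 0, 1; rewrite expr0n /= mul0r mulr0 addr0; split=> //; right.
(* [pth_root] with exponent 2, that is, a square root. *)
have [w wE] := pth_root (- a / b) (ltn0Sn 1).
by exists 1, w; rewrite wE expr1n mul1r divfK // subrr; split=> //; left.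
Qed.

Section UpperQ.
Variables (k : closedFieldType) (n : nat).

Definition dE (i : 'I_n) : 'M[k]_n := delta_mx i i.
(** The default of [insubd] is [i] itself, so the last index is its own successor; [val_nxt] is
    available for [low] indices. *)
Definition nxt (i : 'I_n) : 'I_n := insubd i i.+1.
Definition prv (i : 'I_n) : 'I_n := insubd i i.-1.
(** Indices are paired as (0,1), (2,3), and so on; [low] marks the first member of a complete pair,
    so for odd [n] the last index stays alone. *)
Definition low (i : 'I_n) := ~~ odd i && (i.+1 < n)%N.

Lemma val_nxt i : low i -> nxt i = i.+1 :> nat.
Proof. by case/andP=> _ lt_i; rewrite /nxt val_insubd lt_i. Qed.

Lemma val_prv i : prv i = i.-1 :> nat.
Proof. by rewrite /prv val_insubd; case: ifP => //; have := ltn_ord i; lia. Qed.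

Lemma prv_nxt i : low i -> prv (nxt i) = i.
Proof. by move=> li; apply: val_inj; rewrite /= val_prv val_nxt. Qed.

Lemma dE_sq i : dE i *m dE i = dE i. Proof. exact: mul_delta_mx. Qed.
Lemma dE_neq i j : i != j -> dE i *m dE j = 0.
Proof. exact: mul_delta_mx_0. Qed.

Definition lowmx (u w : 'I_n -> k) i := u i *: dE i + w i *: dE (nxt i).

Lemma lowmx_mul u w u' w' i : low i -> lowmx u w i *m lowmx u' w' i =
  (u i * u' i) *: dE i + (w i * w' i) *: dE (nxt i).
Proof.
move=> li; have ne : i != nxt i by rewrite -val_eqE /= val_nxt //; lia.
rewrite /lowmx mulmxDl !mulmxDr -!scalemxAl -!scalemxAr !dE_sq (dE_neq ne) dE_neq 1?eq_sym //.
by rewrite !scaler0 addr0 add0r !scalerA.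
Qed.

Lemma lowmx_disjoint u w u' w' i j : low i -> low j -> i != j ->
  lowmx u w i *m lowmx u' w' j = 0.
Proof.
move=> li lj ij; have [ei _] := andP li; have [ej _] := andP lj.
have ni := val_nxt li; have nj := val_nxt lj.
rewrite /lowmx mulmxDl !mulmxDr -!scalemxAl -!scalemxAr !dE_neq ?scaler0 ?addr0 //.
- by apply: contra ij => /eqP/(congr1 val) /=; rewrite ni nj => -[/val_inj->].
- by apply/eqP => /(congr1 val) /=; rewrite ni => E; move: ej; rewrite -E /= ei.
- by apply/eqP => /(congr1 val) /=; rewrite nj => E; move: ei; rewrite E /= ej.
Qed.

Variables (u w : 'I_n -> k).
Hypothesis uw : forall i, u i = 1 \/ (u i = 0 /\ w i = 1).

Notation Dlow := (lowmx u w).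
(** A basis of the diagonal matrices adapted to the pairs: the isotropic combination at the low
    index, a complementary matrix unit at the other, and the last unit alone when [n] is odd. *)
Definition Dmx (i : 'I_n) : 'M[k]_n :=
  if odd i then (if u (prv i) == 0 then dE (prv i) else dE i)
  else if (i.+1 < n)%N then Dlow i else dE i.

Definition q_letter (l : ltr n) : 'M[k]_(n + n) :=
  if l.1 then qB (if l.2.1 == l.2.2 then Dmx l.2.1 else delta_mx l.2.1 l.2.2)
  else evA true (delta_mx l.2.1 l.2.2).

Lemma q_letter_gfam l : q_letter l \in gfam k n true.
Proof. by rewrite /q_letter; case: l.1; [apply: qB_gfam | apply: evA_gfam]. Qed.

Lemma q_letter_par l : q_letter l \in gl_part k n (@ltr_par n l).
Proof. by rewrite /q_letter /ltr_par; case: l.1; [apply: qB_odd | apply: evA_even]. Qed.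

Lemma q_letter_gen x : x \in gfam k n true -> exists c, x = \sum_l c l *: q_letter l.
Proof.
move=> /queerP[A [B ->]]; apply: spanP_coef.
have -> : block_mx A B B A = evA true A + qB B.
  by rewrite /evA /qB /tau add_block_mx !(addr0, add0r).
set G := fun y => _; have letter l : spanP G (q_letter l).
  by apply: spanP_gen; exists l.
apply: spanP_add; first by apply: (spanP_delta (f := evA true)) => [|i j];
  [apply: evA_lin | apply: (letter (false, (i, j)))].
apply: (spanP_delta (f := @qB k n)) => [|i j]; first exact: qB_lin.
have Dl i' : spanP G (qB (Dmx i')).
  by have := letter (true, (i', i')); rewrite /q_letter /= eqxx.
have qBZ c D : spanP G (qB D) -> spanP G (qB (c *: D)).
  by rewrite (plinZ (@qB_lin k n)); apply: spanP_scale.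
have pair i' : low i' -> spanP G (qB (dE i')) /\ spanP G (qB (dE (nxt i'))).
  move=> li; have [ei lt_i] := andP li.
  have := Dl i'; have := Dl (nxt i').
  rewrite /Dmx val_nxt //= (negPf ei) /= lt_i prv_nxt //.
  have [u1|[u0 w1]] := uw i'.
    rewrite u1 oner_eq0 => Gn Gi; split=> //.
    have -> : dE i' = Dlow i' - w i' *: dE (nxt i').
      by rewrite /lowmx u1 scale1r addrK.
    rewrite (plinB (@qB_lin k n)); apply: spanP_add => //.
    by apply: spanP_opp; apply: qBZ.
  rewrite u0 eqxx => Gn Gi; split=> //.
  by move: Gi; rewrite /lowmx u0 w1 scale0r scale1r add0r.
have := letter (true, (i, j)); rewrite /q_letter /=.
have [<-{j} _|//] := eqVneq i j.
have [oi|ei] := boolP (odd i).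
  have lp : low (prv i) by rewrite /low val_prv; have := ltn_ord i; case: (i : nat) oi => //= m -> ->.
  have [_] := pair _ lp; congr (spanP G (qB (dE _))).
  by apply: val_inj; rewrite /= val_nxt // val_prv; case: (i : nat) oi.
have [lt_i|ge_i] := boolP (i.+1 < n)%N; first by have [] := pair i; rewrite /low ?ei.
by have := Dl i; rewrite /Dmx (negPf ei) (negPf ge_i).
Qed.

Section Bound.
Variable p : nat.
Hypothesis charp : p \in [pchar k].
Hypothesis p_odd : odd p.
Variables (V0 V1 : lmodType k) (op : 'M[k]_(n + n) -> V0 * V1 -> V0 * V1).
Hypothesis op_rep : srep (gfam k n true) op.
Notation homogV := (@homogeneous k V0 V1).
Notation ee := (eop true op).
Notation ff := (ff op).

Lemma qB_anti D D' v : op (qB D) (op (qB D') v) =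
  - op (qB D') (op (qB D) v) + op (evA true (D *m D' + D' *m D)) v.
Proof.
rewrite (op_br_odd op_rep _ (qB_gfam _) (qB_gfam _) (qB_odd _) (qB_odd _)).
congr (_ + op _ _); rewrite /evA /qB /tau !mulmx_block add_block_mx.
by rewrite !(mulmx0, mul0mx, addr0, add0r).
Qed.

Lemma qB_square D v : op (qB D) (op (qB D) v) = op (evA true (D *m D)) v.
Proof.
have /eqP := qB_anti D D v; rewrite addrC -subr_eq opprK -mulr2n.
rewrite (plinD (op_evA_lin op_rep v)) -mulr2n -subr_eq0 -mulrnBl -scaler_nat.
by rewrite scaler_eq0 (negPf (two_neq0 charp p_odd)) subr_eq0 => /eqP.
Qed.

Lemma op_lowmx i v : op (qB (Dlow i)) v =
  u i *: ff i i v + w i *: ff (nxt i) (nxt i) v.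
Proof. by rewrite /lowmx (plinD (op_qB_lin op_rep v)) !(plinZ (op_qB_lin op_rep v)). Qed.

Section WeightSpace.
Variable lam : 'I_n -> k.

Definition hw_q (v : V0 * V1) :=
  killed_q op v /\ forall i, ee i i v = lam i *: v.

Lemma hw_q_sub : subspace hw_q.
Proof.
move=> c x y [kx ex] [ky ey]; split=> [i j ij|i].
  have [e1 f1] := kx i j ij; have [e2 f2] := ky i j ij.
  by rewrite (ee_lin op_rep) (ff_lin op_rep) e1 e2 f1 f2 scaler0 addr0.
by rewrite (ee_lin op_rep) ex ey scalerDr !scalerA mulrC.
Qed.

Lemma hw_q_ff a v : hw_q v -> hw_q (ff a a v).
Proof.
move=> [kv ev]; split=> [i j ij|i].
  have [e1 f1] := kv i j ij.
  rewrite (comm_ef op_rep) (comm_ff op_rep) e1 f1 (plin0 (ff_lin op_rep _ _)).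
  have ja (b : 'I_n -> V0 * V1) : b j = 0 -> ((j == a)%:R : k) *: b a = 0.
    by move=> b0; apply: nat_scale0 => /eqP <-.
  have ai (b : 'I_n -> V0 * V1) : b i = 0 -> ((a == i)%:R : k) *: b a = 0.
    by move=> b0; apply: nat_scale0 => /eqP ->.
  rewrite (ja (fun a => ff i a v)) // (ai (fun a => ff a j v)) //.
  rewrite (ja (fun a => ee i a v)) // (ai (fun a => ee a j v)) //.
  by rewrite !(oppr0, addr0).
rewrite (comm_ef op_rep) ev (plinZ (ff_lin op_rep _ _)).
have [->|ia] := eqVneq i a; first by rewrite subrr addr0.
by rewrite !scale0r subrr addr0.
Qed.

Lemma hw_q_scale c v : hw_q v -> hw_q (c *: v).
Proof.
move=> hv; have h0 : hw_q 0.
  by have := hw_q_sub (-1) hv hv; rewrite scaleN1r addNr.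
by have := hw_q_sub c hv h0; rewrite addr0.
Qed.

Lemma hw_q_lowmx i v : hw_q v -> hw_q (op (qB (Dlow i)) v).
Proof.
move=> hv; rewrite op_lowmx; apply: hw_q_sub; first exact: hw_q_ff.
exact/hw_q_scale/hw_q_ff.
Qed.

Hypothesis uw0 : forall i, u i ^+ 2 * lam i + w i ^+ 2 * lam (nxt i) = 0.

(** The square of the odd element is an even diagonal one, acting on weight vectors by the quadratic
    form made zero in [uw0]. *)
Lemma lowmx_nil i v : low i -> hw_q v -> op (qB (Dlow i)) (op (qB (Dlow i)) v) = 0.
Proof.
move=> li [_ ev]; rewrite qB_square lowmx_mul // -!expr2.
rewrite (plinD (op_evA_lin op_rep v)) !(plinZ (op_evA_lin op_rep v)) -!/(ee _ _ _).
by rewrite !ev !scalerA -scalerDl uw0 scale0r.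
Qed.

(** Odd diagonal elements preserve the highest weight vectors of weight [lam]. The isotropic ones of
    different pairs anticommute and each squares to zero there, so they have a common kernel
    vector. *)
Lemma isotropic_vec v0 b0 : v0 <> 0 -> homogV b0 v0 -> hw_q v0 ->
  exists v b, [/\ v <> 0, homogV b v, hw_q v &
    forall i, low i -> op (qB (Dlow i)) v = 0].
Proof.
move=> v00 hv0 wv0.
have [|||||v [vn0 [[b hb] wv] kv]] := @kill_all k _ _ (fun i => op (qB (Dlow i)))
   [seq i : 'I_n <- enum 'I_n | low i] (fun u => (exists b, homogV b u) /\ hw_q u) v0.
- move=> i x _ [[b hb] hx]; split; last exact: hw_q_lowmx.
  by exists (~~ b); apply: (srep_par op_rep) (qB_gfam _) (qB_odd _) hb.
- move=> i j x; rewrite !mem_filter => /andP[li _] /andP[lj _] _ jx0.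
  have [->|ij] := eqVneq i j; first by rewrite jx0 (plin0 (srep_lin op_rep _)).
  rewrite qB_anti jx0 (plin0 (srep_lin op_rep _)) oppr0 add0r.
  have ji : j != i by rewrite eq_sym.
  rewrite (lowmx_disjoint _ _ _ _ lj li ji) (lowmx_disjoint _ _ _ _ li lj ij) addr0.
  exact: plin0 (op_evA_lin op_rep x).
- by move=> i; rewrite mem_filter => /andP[li _]; exists 2%N => x [_ hx]; apply: lowmx_nil.
- by split=> //; exists b0.
- by [].
exists v, b; split=> // i li; apply: kv; by rewrite mem_filter li mem_enum.
Qed.

End WeightSpace.
End Bound.
End UpperQ.

(** Of the odd diagonal letters only those at odd indices and at the last index survive, [uphalf n]
    in number by [card_oddlast]. *)
Lemma upper_q (k : closedFieldType) (p n : nat) (charp : p \in [pchar k])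
    (p_odd : odd p) (V0 V1 : lmodType k) (op : 'M[k]_(n + n) -> V0 * V1 -> V0 * V1)
    (t : 'I_n -> k) (op_rep : srep (gfam k n true) op) :
  rep_irr (gfam k n true) op ->
  (forall A, exists c, forall v, xi op p (evA true A) v = c *: v) ->
  (forall (i j : 'I_n) v, (i < j)%N -> iter p (eop true op i j) v = 0) ->
  (forall i v, iter p (eop true op i i) v = eop true op i i v + t i *: v) ->
  small_span p n V0 V1 true.
Proof.
move=> op_irr xi_scal nil tor.
have [b0 [v0 [v00 hv0]]] := irr_homog op_irr.
have [v1 [b1 [v10 hv1 kv1 ev1]]] := highest_weight_q charp p_odd op_rep nil tor v00 hv0.
have [lam lamE] := fin_all_exists ev1.
have ex i : exists uw : k * k, uw.1 ^+ 2 * lam i + uw.2 ^+ 2 * lam (nxt i) = 0 /\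
   (uw.1 = 1 \/ (uw.1 = 0 /\ uw.2 = 1)).
  by have [u [w uw]] := isotropic (lam i) (lam (nxt i)); exists (u, w).
have [uw uwP] := fin_all_exists ex.
pose u i := (uw i).1; pose w i := (uw i).2.
have uw1 i : u i = 1 \/ (u i = 0 /\ w i = 1) by have [] := uwP i.
have uw0 i : u i ^+ 2 * lam i + w i ^+ 2 * lam (nxt i) = 0 by have [] := uwP i.
have [v [b [vn0 hv [kv ev] gv]]] :=
  isotropic_vec charp p_odd op_rep uw0 v10 hv1 (conj kv1 lamE).
pose Yo := [pred x : 'I_n * 'I_n | (x.2 < x.1)%N || ((x.1 == x.2) && (odd x.1 || (x.1.+1 == n)))].
pose Ye := [pred x : 'I_n * 'I_n | (x.2 < x.1)%N].
pose Y := [pred l : ltr n | if l.1 then Yo l.2 else Ye l.2].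
exists (mons (fun l => op (q_letter u w l)) v (pord (@ltr_par n) p) (enum Y)); split.
- rewrite (size_ltr_mons _ _ _ Ye Yo) card_gt; congr (_ * 2 ^ _)%N.
  have dis x : ~~ ((x.2 < x.1)%N && ((x.1 == x.2) && (odd x.1 || (x.1.+1 == n)))).
    by apply/negP => /and3P[lt /eqP E _]; rewrite E ltnn in lt.
  rewrite -sum1_card (bigID [pred x : 'I_n * 'I_n | (x.2 < x.1)%N]) /=.
  rewrite -card_gt -card_oddlast -!sum1_card; congr (_ + _)%N.
    by apply: eq_bigl => x; rewrite !inE; case: (x.2 < x.1)%N; rewrite ?andbF.
  rewrite (reindex_onto (fun i : 'I_n => (i, i)) fst) => [|[i j]] /=; last first.
    rewrite !inE /= => /andP[/orP[lt nlt|/andP[/eqP -> _] _ //]].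
    by rewrite lt in nlt.
  by apply: eq_bigl => i; rewrite !inE /= ltnn !eqxx !andbT.
- by move=> x; apply: (mons_homog op_rep (q_letter_gfam u w) (q_letter_par u w) hv).
apply: (upper_spanning (gfam_lie k n true) op_rep op_irr (q_letter_gfam u w)
  (q_letter_par u w) (q_letter_gen uw1) charp p_odd (gfam_res p_odd) vn0 hv).
- move=> [[] x] Yx; rewrite /zxi /=; first by exists 0 => z; rewrite scale0r.
  by have [c cE] := xi_scal (delta_mx x.1 x.2); exists c.
move=> [[] [i j]]; rewrite /q_letter /= => nY; last first.
  move: nY; rewrite -leqNgt leq_eqVlt => /predU1P[/val_inj ->|ij]; first by exists (lam j); apply: ev.
  by exists 0; rewrite scale0r; have [] := kv i j ij.
exists 0; rewrite scale0r; move: nY; rewrite negb_or -leqNgt => /andP[le_ij].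
have [ij|ij] := eqVneq i j; last first.
  have lt_ij : (i < j)%N by rewrite ltn_neqAle le_ij andbT.
  by have [] := kv i j lt_ij.
rewrite /= negb_or /Dmx => /andP[ei ni]; rewrite (negPf ei).
have lt_i : (i.+1 < n)%N by rewrite ltn_neqAle ni ltn_ord.
by rewrite lt_i; apply: gv; rewrite /low ei lt_i.
Qed.

Lemma irreducible_rep (k : fieldType) (n : nat) (g : {vspace 'M[k]_(n + n)})
    (M : supermodule g) : irreducible M -> rep_irr g (@sop k n g M).
Proof.
move=> [nz irr]; split=> // W W0 Wl We Wop.
apply: irr; split=> //.
  move=> v Wv; split; first exact: We.
  rewrite -/(oddp v) oddpE addrC -scaleN1r; apply: Wl => //; exact: We.
move=> x v Wv; have := Wop (vsval x) v (subvsP x) Wv.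
by rewrite /sop vsvalK.
Qed.

Section IrreducibleBound.
Variables (k : closedFieldType) (p n : nat) (q : bool).
Hypothesis charp : p \in [pchar k].
Hypothesis p_odd : odd p.
Variable M : supermodule (gfam k n q).
Hypothesis M_irr : irreducible M.

(** Conjugation by [P] changes the operators but not the underlying space, so the small spanning
    list of the twisted action bounds the original module. *)
Lemma irreducible_bound : exists2 d, has_dim M d & (d <= kwdim p n q)%N.
Proof.
have op_rep := sop_rep M; have op_irr := irreducible_rep M_irr.
have op_fin : exists ms : seq (sm_even M * sm_odd M), forall u, spanP (fun m => m \in ms) u.
  have lie := gfam_lie k n q; have res := @gfam_res k n q p p_odd.
  move: M op_rep op_irr lie res; case: (q) => M' op_rep op_irr lie res.
    (* For finite dimension any generating letters serve; u = 1 and w = 0 give the plain matrix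
       units. *)
    apply: (irr_findim lie op_rep op_irr (q_letter_gfam (fun=> 1) (fun=> 0))
      (q_letter_par _ _) (q_letter_gen _) charp p_odd res) => i; by left.
  exact: (irr_findim lie op_rep op_irr (@p_letter_gfam k n)
      (@p_letter_par k n) (p_letter_gen charp p_odd) charp p_odd res).
have [P [t [Pu xi_scal nil tor]]] := borel_twist charp p_odd op_rep op_irr op_fin.
have [s [<- hs span]] : small_span p n (sm_even M) (sm_odd M) q.
  have rep' := twist_rep Pu op_rep; have irr' := twist_irr Pu op_irr.
  move: M rep' irr' xi_scal nil tor {op_rep op_irr op_fin}.
  case: (q) => M' rep' irr' xi_scal nil tor.
    exact (@upper_q k p n charp p_odd _ _ _ t rep' irr' xi_scal nil tor).
  exact (@upper_p k p n charp p_odd _ _ _ t rep' irr' xi_scal nil tor).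
exact: span_has_dim hs span.
Qed.

End IrreducibleBound.

(** * Passing from a Borel subalgebra to its opposite by adjacent exchanges *)

Definition npair (n : nat) := {x : 'I_n * 'I_n | (x.2 < x.1)%N}.

Section RankChain.
Variables (n : nat) (V : Type) (St : ('I_n -> nat) -> V -> Prop) (T : finType).
Variables (act : T -> V -> V) (piece : npair n -> seq T).

(** A rank function orders the indices and so selects positive roots (a, b), those with r a < r b.
    Only the order of [i] and [j] changes, which makes them adjacent and (i, j) a simple root. *)
Definition swap_rank (r r' : 'I_n -> nat) (i j : 'I_n) :=
  [/\ (r i < r j)%N, (r' j < r' i)%N &
      forall a b, (a, b) != (i, j) -> (a, b) != (j, i) ->
        (r a < r b)%N = (r' a < r' b)%N].

Hypothesis St_ext : forall r r' v,
  (forall a b, (r a < r b)%N = (r' a < r' b)%N) -> St r v -> St r' v.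
Hypothesis stage : forall r r' (x : npair n) v, swap_rank r r' (val x).2 (val x).1 ->
  St r v -> St r' (foldr act v (piece x)).

(** Indices below [i] have been moved to the end in reverse order, those above [i] keep even ranks
    in their order, and [i] sits at an odd rank just before [j]. *)
Definition lex_rank (i j : nat) (a : 'I_n) : nat :=
  (if a < i then 4 * n - a else if a == i :> nat then 2 * j - 1 else 2 * a)%N.

(** A reduced expression of the longest permutation: index 0 moves past all the others, then index 1
    past the later ones, and so on. Each pair is exchanged once, so the operators applied form a
    word with prescribed letter counts. *)
Lemma rank_chain : exists s : seq (npair n),
  [/\ uniq s, forall x, x \in s &
   forall v, St (fun a => a) v -> exists r, St r (foldr act v (flatten [seq piece x | x <- s]))].
Proof.
pose done_ (i j : nat) (x : npair n) :=
  ((val x).2 < i)%N || (((val x).2 == i :> nat) && ((val x).1 < j)%N).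
suff [s [us ms sP]] : exists s : seq (npair n),
  [/\ uniq s, forall x, (x \in s) = done_ n n.+1 x &
   forall v, St (fun a => a) v ->
     St (lex_rank n n.+1) (foldr act v (flatten [seq piece x | x <- s]))].
  exists s; split=> // [x|v /sP ?]; last by eexists; eassumption.
  by rewrite ms /done_ ltn_ord.
suff row i : (i <= n)%N -> exists s : seq (npair n),
  [/\ uniq s, forall x, (x \in s) = done_ i i.+1 x &
   forall v, St (fun a => a) v ->
     St (lex_rank i i.+1) (foldr act v (flatten [seq piece x | x <- s]))].
  exact: row.
elim: i => [_|i IH lt_in].
  exists [::]; split=> // [x|v].
    by rewrite /done_; case: x => -[a b] /= lt_ba; rewrite in_nil; lia.
  apply: St_ext => a b; rewrite /lex_rank !ltn0.
  by case: eqP => ?; case: eqP => ?; lia.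
have [s0 [us0 ms0 s0P]] := IH (ltnW lt_in).
have col j : (i < j <= n)%N -> exists s : seq (npair n),
  [/\ uniq s, forall x, (x \in s) = done_ i j x &
   forall v, St (fun a => a) v ->
     St (lex_rank i j) (foldr act v (flatten [seq piece x | x <- s]))].
  elim: j => [|j IHj] //; rewrite ltnS => /andP[le_ij lt_jn].
  have [ij|ne_ij] := eqVneq i j; first by rewrite -ij; exists s0.
  have lt_ij : (i < j)%N by rewrite ltn_neqAle ne_ij.
  have [|s [us ms sP]] := IHj; first by rewrite lt_ij ltnW.
  pose oi := Ordinal lt_in; pose oj := Ordinal lt_jn.
  have lt_o : ((oj, oi).2 < (oj, oi).1)%N by [].
  pose x0 : npair n := exist _ (oj, oi) lt_o.
  exists (x0 :: s); split.
  - by rewrite /= us ms /done_ /= ltnn eqxx ltnn.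
  - move=> x; rewrite inE ms /done_ -val_eqE /=; case: x => -[a b] /= lt_ba.
    by rewrite xpair_eqE -!val_eqE /=; lia.
  (* The newest exchange heads the list and is applied last by [foldr]. *)
  move=> v Sv /=; rewrite foldr_cat.
  apply: (stage (r := lex_rank i j)); last exact: sP.
  split; rewrite /lex_rank /=.
  - by do !case: ifP => ?; lia.
  - by do !case: ifP => ?; lia.
  move=> a b; rewrite !xpair_eqE -!val_eqE /= => n1 n2.
  have := ltn_ord a; have := ltn_ord b.
  by do !case: ifP => ?; lia.
have [|s [us ms sP]] := col n; first by rewrite lt_in leqnn.
exists s; split=> // [x|v /sP].
  rewrite ms /done_; case: x => -[a b] /= lt_ba; have := ltn_ord a; lia.
apply: St_ext => a b; rewrite /lex_rank; have := ltn_ord a; have := ltn_ord b.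
by do !case: ifP => ?; lia.
Qed.

End RankChain.

(** * Weights outside the prime field and sl_2 strings *)

Section SL2.
Variables (k : fieldType) (p n : nat) (q : bool).
Hypothesis charp : p \in [pchar k].
Hypothesis p_odd : odd p.
Variables (V0 V1 : lmodType k) (op : 'M[k]_(n + n) -> V0 * V1 -> V0 * V1).
Hypothesis op_rep : srep (gfam k n q) op.
Variable t : 'I_n -> k.
Hypothesis nil : forall i j v, i != j -> iter p (eop q op i j) v = 0.
Hypothesis tor : forall i v, iter p (eop q op i i) v = eop q op i i v + t i *: v.
Notation ee := (eop q op).

Lemma eigen_tor i v a : v <> 0 -> ee i i v = a *: v -> a ^+ p = a + t i.
Proof.
move=> v0 va; have := tor i v.
have -> : iter p (ee i i) v = a ^+ p *: v.
  elim: (p) => [|m IH]; first by rewrite expr0 scale1r.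
  by rewrite iterS IH (plinZ (ee_lin op_rep _ _)) va scalerA exprSr.
rewrite va -scalerDl => /eqP; rewrite -subr_eq0 -scalerBl scaler_eq0.
by case/orP=> [|/eqP //]; rewrite subr_eq0 => /eqP.
Qed.

(** The additive map c |-> c^p - c kills the prime field and takes a - b to t_i - t_j. *)
Lemma weight_sub_notin_Fp i j v a b m : t i != t j -> v <> 0 ->
  ee i i v = a *: v -> ee j j v = b *: v -> a - b != m%:R.
Proof.
move=> tij v0 va vb; apply/eqP => abm.
have ap := eigen_tor v0 va; have bp := eigen_tor v0 vb.
have : (a - b) ^+ p = a - b by rewrite abm -(pFrobenius_autE charp) pFrobenius_aut_nat.
rewrite -(pFrobenius_autE charp) rmorphB /= !pFrobenius_autE ap bp => /eqP.
by rewrite opprD addrACA -[X in _ == X]addr0 (inj_eq (addrI _)) subr_eq0 (negPf tij).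
Qed.

Lemma weight_add_neq0 i j v a b : t i + t j != 0 -> v <> 0 ->
  ee i i v = a *: v -> ee j j v = b *: v -> a + b != 0.
Proof.
move=> tij v0 va vb; apply: contraNneq tij => ab0.
have ap := eigen_tor v0 va; have bp := eigen_tor v0 vb.
have /eqP : (a + b) ^+ p = 0 by rewrite ab0 expr0n gtn_eqF // prime_gt0 // (pcharf_prime charp).
rewrite -(pFrobenius_autE charp) rmorphD /= !pFrobenius_autE ap bp addrACA ab0.
by rewrite add0r.
Qed.

Lemma weight_ee l i j c v : ee l l v = c *: v ->
  ee l l (ee j i v) = (c + ((l == j)%:R - (l == i)%:R)) *: ee j i v.
Proof.
move=> vc; rewrite (comm_ee op_rep) vc (plinZ (ee_lin op_rep _ _)) scalerDl.
rewrite scalerBl [i == l]eq_sym; congr (_ + _).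
have -> : ((l == j)%:R : k) *: ee l i v = (l == j)%:R *: ee j i v.
  by case: (eqVneq l j) => [->|]; rewrite ?scale0r.
have -> // : ((l == i)%:R : k) *: ee j l v = (l == i)%:R *: ee j i v.
by case: (eqVneq l i) => [->|]; rewrite ?scale0r.
Qed.

Section Pair.
Variables (i j : 'I_n) (v : V0 * V1) (a b : k).
Hypotheses (ij : i != j) (va : ee i i v = a *: v) (vb : ee j j v = b *: v).

Lemma weight_iter m :
  ee i i (iter m (ee j i) v) = (a - m%:R) *: iter m (ee j i) v /\
  ee j j (iter m (ee j i) v) = (b + m%:R) *: iter m (ee j i) v.
Proof.
elim: m => [|m [IHi IHj]]; first by rewrite subr0 addr0.
rewrite !iterS (weight_ee _ _ IHi) (weight_ee _ _ IHj) !eqxx.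
rewrite (negPf ij) [j == i]eq_sym (negPf ij) -[m.+1]addn1 natrD /=.
by split; congr (_ *: _); ring.
Qed.

Hypothesis xv : ee i j v = 0.

Lemma sl2_raise m : ee i j (iter m.+1 (ee j i) v) =
  (m.+1%:R * (a - b - m%:R)) *: iter m (ee j i) v.
Proof.
elim: m => [|m IH]; rewrite iterS (comm_ee op_rep) !eqxx !scale1r.
  rewrite xv (plin0 (ee_lin op_rep _ _)) add0r va vb -scalerBl.
  by congr (_ *: _); ring.
rewrite IH (plinZ (ee_lin op_rep _ _)) -iterS.
have [-> ->] := weight_iter m.+1; rewrite -scalerBl -scalerDl.
by congr (_ *: _); rewrite -[m.+2]addn1 -[m.+1]addn1 !natrD; ring.
Qed.

Hypotheses (v0 : v <> 0) (ab : forall m, a - b != m%:R).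

(** The coefficient in [sl2_raise] does not vanish below [p], since a - b avoids all integers. *)
Lemma sl2_iter_neq0 m : (m < p)%N -> iter m (ee j i) v <> 0.
Proof.
elim: m => [|m IH] lt_mp //= E; have := sl2_raise m.
rewrite iterS E (plin0 (ee_lin op_rep _ _)) => /esym/eqP.
rewrite scaler_eq0 mulf_eq0 subr_eq0 (negPf (ab m)) orbF => /orP[|/eqP].
  by rewrite -(dvdn_pcharf charp) gtnNdvd.
by apply: IH; apply: ltnW.
Qed.

End Pair.
End SL2.

(** * Reflections of highest weight vectors *)

Section Stage.
Variables (k : closedFieldType) (p n : nat).
Hypothesis charp : p \in [pchar k].
Hypothesis p_odd : odd p.
Variables (V0 V1 : lmodType k) (op : 'M[k]_(n + n) -> V0 * V1 -> V0 * V1).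
Variable t : 'I_n -> k.
Hypothesis t_inj : forall i j, i != j -> t i != t j.

(** As (i, j) is simple, the bracket of E_ji with a positive root vector other than E_ij involves
    only positive root vectors other than E_ij, which already kill. *)
Lemma swap_rank_kill (Z : 'I_n -> 'I_n -> V0 * V1) r r' (i j : 'I_n) :
  swap_rank r r' i j ->
  (forall a b, (a, b) != (i, j) -> (r a < r b)%N -> Z a b = 0) ->
  forall a b, (a, b) != (i, j) -> (r a < r b)%N ->
  ((b == j)%:R : k) *: Z a i = 0 /\ ((i == a)%:R : k) *: Z j b = 0.
Proof.
move=> [rij r'ij rr'] kZ a b abij rab.
have ne_ij : i != j by apply: contraTneq rij => ->; rewrite ltnn.
split; apply: nat_scale0 => /eqP E.
  rewrite {}E in abij rab.
  have ai : a != i by apply: contraNneq abij => ->.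
  have aj : a != j by apply: contraTneq rab => ->; rewrite ltnn.
  apply: kZ; first by rewrite xpair_eqE negb_and ai.
  rewrite rr' ?xpair_eqE ?negb_and ?ai ?aj //.
  by apply: ltn_trans r'ij; rewrite -rr' // xpair_eqE negb_and aj.
rewrite -{}E in abij rab.
have bj : b != j by apply: contraNneq abij => ->.
have bi : b != i by apply: contraTneq rab => ->; rewrite ltnn.
apply: kZ; first by rewrite xpair_eqE negb_and eq_sym ne_ij.
rewrite rr' ?xpair_eqE ?negb_and ?bi ?bj ?orbT //.
by apply: ltn_trans r'ij _; rewrite -rr' // xpair_eqE negb_and ?bi ?bj ?orbT.
Qed.

Lemma swap_rank_cases r r' (i j a b : 'I_n) : swap_rank r r' i j ->
  (r' a < r' b)%N -> (a, b) = (j, i) \/ ((a, b) != (i, j) /\ (r a < r b)%N).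
Proof.
move=> [rij r'ij rr'] r'ab; have [->|ji] := eqVneq (a, b) (j, i); first by left.
right; have ne : (a, b) != (i, j).
  by apply: contraTneq r'ab => -[-> ->]; rewrite -leqNgt ltnW.
by rewrite rr'.
Qed.

Section P.
Hypothesis op_rep : srep (gfam k n false) op.
Hypothesis nil : forall i j v, i != j -> iter p (eop false op i j) v = 0.
Hypothesis tor : forall i v, iter p (eop false op i i) v = eop false op i i v + t i *: v.
Notation ee := (eop false op).

Definition St_p (r : 'I_n -> nat) (v : V0 * V1) :=
  [/\ v <> 0, forall i, exists c, ee i i v = c *: v &
      forall a b, (r a < r b)%N -> ee a b v = 0].

(** The even reflection by the (p-1)-st power of [ee j i]. The new positive root (j, i) kills the
    image because one more factor gives the p-th power, which is zero. *)
Lemma stage_p r r' (i j : 'I_n) v : swap_rank r r' i j ->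
  St_p r v -> St_p r' (iter p.-1 (ee j i) v).
Proof.
move=> sw [v0 wv kv]; have [rij r'ij rr'] := sw.
have ne_ij : i != j by apply: contraTneq rij => ->; rewrite ltnn.
have p_gt0 := prime_gt0 (pcharf_prime charp).
have [a va] := wv i; have [b vb] := wv j.
split.
- apply: (sl2_iter_neq0 charp op_rep ne_ij va vb (kv _ _ rij) v0); last by rewrite prednK.
  by move=> m; apply: (weight_sub_notin_Fp charp op_rep tor m (t_inj ne_ij) v0 va vb).
- move=> l; have [c0 vc0] := wv l.
  elim: p.-1 => [|m [c IH]]; first by exists c0.
  by eexists; rewrite iterS; apply: (weight_ee op_rep _ _ IH).
have kill m : forall a b, (a, b) != (i, j) -> (r a < r b)%N ->
    ee a b (iter m (ee j i) v) = 0.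
  elim: m => [|m IH] c d cd rcd; first exact: kv.
  have [z1 z2] := swap_rank_kill sw (Z := fun a b => ee a b (iter m (ee j i) v)) IH cd rcd.
  by rewrite iterS (comm_ee op_rep) IH // (plin0 (ee_lin op_rep _ _)) z1 z2 subrr addr0.
move=> c d /(swap_rank_cases sw)[[-> ->]|[cd rcd]]; last exact: kill.
by rewrite -iterS prednK // nil // eq_sym.
Qed.

End P.

Section Q.
Hypothesis op_rep : srep (gfam k n true) op.
Hypothesis nil : forall i j v, i != j -> iter p (eop true op i j) v = 0.
Hypothesis tor : forall i v, iter p (eop true op i i) v = eop true op i i v + t i *: v.
Hypothesis t_add : forall i j, t i + t j != 0.
Notation ee := (eop true op).
Notation ff := (ff op).

Definition St_q (r : 'I_n -> nat) (v : V0 * V1) :=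
  [/\ v <> 0, forall i, exists c, ee i i v = c *: v &
      forall a b, (r a < r b)%N -> ee a b v = 0 /\ ff a b v = 0].

Lemma weight_ff l i j c v : ee l l v = c *: v ->
  ee l l (ff j i v) = (c + ((l == j)%:R - (l == i)%:R)) *: ff j i v.
Proof.
move=> vc; rewrite (comm_ef op_rep) vc (plinZ (ff_lin op_rep _ _)) scalerDl.
rewrite scalerBl [i == l]eq_sym; congr (_ + _).
have -> : ((l == j)%:R : k) *: ff l i v = (l == j)%:R *: ff j i v.
  by case: (eqVneq l j) => [->|]; rewrite ?scale0r.
have -> // : ((l == i)%:R : k) *: ff j l v = (l == i)%:R *: ff j i v.
by case: (eqVneq l i) => [->|]; rewrite ?scale0r.
Qed.

Lemma ff_ee_opp i j v : i != j -> ff j i (ee j i v) = ee j i (ff j i v).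
Proof.
by move=> ij; rewrite (comm_fe op_rep) (negPf ij) !scale0r subrr addr0.
Qed.

(** The vector [ff j i v] is corrected by a multiple of [ee j i w] into [u0], killed by [ee i j];
    the correction disappears under the (p-1)-st power of [ee j i]. [u0] is nonzero because [ff i j]
    sends it to (a + b)(1 - 1/(a - b)) v, where a + b is nonzero and a - b is not 1. *)
Lemma stage_q_neq0 (i j : 'I_n) v : i != j -> v <> 0 ->
  (forall i, exists c, ee i i v = c *: v) -> ee i j v = 0 -> ff i j v = 0 ->
  iter p.-1 (ee j i) (ff j i v) <> 0.
Proof.
move=> ij v0 wv ev fv; have [a va] := wv i; have [b vb] := wv j.
have ji : (j == i) = false by rewrite eq_sym; apply/negbTE.
have p_gt0 := prime_gt0 (pcharf_prime charp).
have abm m : a - b != m%:R.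
  exact: (weight_sub_notin_Fp charp op_rep tor m (t_inj ij) v0 va vb).
have ab0 : a - b != 0 := abm 0%N.
pose w := ff i i v - ff j j v.
have fiw l c : ff i j v = 0 -> ee i j v = 0 -> ee l l v = c *: v -> ee l l w = c *: w.
  move=> _ _ vc; rewrite (plinB (ee_lin op_rep _ _)) scalerBr.
  rewrite (weight_ff i i vc) (weight_ff j j vc) !subrr !addr0 //.
have wa := fiw i a fv ev va; have wb := fiw j b fv ev vb.
have xw : ee i j w = 0.
  rewrite (plinB (ee_lin op_rep _ _)) !(comm_ef op_rep i j) ev fv !eqxx ji.
  rewrite !(plin0 (ff_lin op_rep _ _)) !scale0r !scaler0.
  by rewrite !(oppr0, addr0).
have fw : ff i j w = 0.
  rewrite (plinB (ff_lin op_rep _ _)) (comm_ff op_rep i j i i) (comm_ff op_rep i j j j).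
  rewrite ev fv ji !(plin0 (ff_lin op_rep _ _)) !scale0r !scaler0.
  by rewrite !(oppr0, addr0).
have wsq : ff i i w - ff j j w = (a + b) *: v.
  rewrite /w !(plinB (ff_lin op_rep _ _)) !(ff_diag_sq charp p_odd op_rep) va vb.
  rewrite (comm_ff op_rep j j i i) ji [i == j](negPf ij) !scale0r !addr0 scalerDl.
  by rewrite opprB addrA [X in X + _]addrAC addrAC subrK.
pose u := ff j i v.
have xu : ee i j u = w.
  by rewrite /u (comm_ef op_rep) ev (plin0 (ff_lin op_rep _ _)) !eqxx !scale1r add0r.
(* The factor is right because [ee i j] takes [u] to [w] and [ee j i w] to (a - b) w. *)
pose u0 := u - (a - b)^-1 *: ee j i w.
have yw_a : ee i i (ee j i w) = (a - 1) *: ee j i w.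
  by rewrite (weight_ee op_rep _ _ wa) eqxx [i == j](negPf ij) sub0r.
have yw_b : ee j j (ee j i w) = (b + 1) *: ee j i w.
  by rewrite (weight_ee op_rep _ _ wb) eqxx ji subr0.
have ua : ee i i u0 = (a - 1) *: u0.
  rewrite /u0 (plinB (ee_lin op_rep _ _)) (plinZ (ee_lin op_rep _ _)) yw_a.
  rewrite (weight_ff _ _ va) eqxx [i == j](negPf ij) sub0r scalerBr.
  by rewrite !scalerA [_ * (a - 1)]mulrC.
have ub : ee j j u0 = (b + 1) *: u0.
  rewrite /u0 (plinB (ee_lin op_rep _ _)) (plinZ (ee_lin op_rep _ _)) yw_b.
  rewrite (weight_ff _ _ vb) eqxx ji subr0 scalerBr.
  by rewrite !scalerA [_ * (b + 1)]mulrC.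
have xu0 : ee i j u0 = 0.
  rewrite /u0 (plinB (ee_lin op_rep _ _)) (plinZ (ee_lin op_rep _ _)) xu.
  rewrite (comm_ee op_rep) xw !eqxx !scale1r (plin0 (ee_lin op_rep _ _)) add0r.
  by rewrite wa wb -scalerBl scalerA mulVf // scale1r subrr.
have u00 : u0 <> 0.
  move=> E; have := congr1 (ff i j) E; rewrite (plin0 (ff_lin op_rep _ _)) /u0.
  rewrite (plinB (ff_lin op_rep _ _)) (plinZ (ff_lin op_rep _ _)) /u.
  rewrite (comm_ff op_rep) fv (plin0 (ff_lin op_rep _ _)) oppr0 add0r !eqxx !scale1r.
  rewrite va vb -scalerDl (comm_fe op_rep) fw (plin0 (ee_lin op_rep _ _)) add0r.
  rewrite !eqxx !scale1r wsq scalerA -scalerBl => /eqP.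
  rewrite scaler_eq0 => /orP[|/eqP //].
  rewrite -[X in X - _]mul1r -mulrBl mulf_eq0 subr_eq0.
  rewrite (negPf (weight_add_neq0 charp op_rep tor (t_add i j) v0 va vb)) orbF.
  by rewrite eq_sym invr_eq1; apply/negP; have := abm 1%N.
have -> : iter p.-1 (ee j i) (ff j i v) = iter p.-1 (ee j i) u0.
  have itl : linear (iter p.-1 (ee j i)) by exact: iter_op_lin op_rep _ _.
  rewrite /u0 (plinB itl) (plinZ itl) -iterSr prednK // nil ?ji //.
  by rewrite scaler0 subr0.
apply: (sl2_iter_neq0 charp op_rep ij ua ub xu0 u00); last by rewrite prednK.
(* The weight difference of [u0] is a - b - 2, still outside the prime field. *)
move=> m; apply/eqP => E; have /eqP := abm m.+2; apply.
by rewrite -[m.+2]addn2 natrD -E; ring.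
Qed.

(** Queer root spaces contain an even and an odd vector; both [ee j i] and [ff j i] are used to
    their top powers, so either one more factor gives zero. *)
Lemma stage_q r r' (i j : 'I_n) v : swap_rank r r' i j ->
  St_q r v -> St_q r' (iter p.-1 (ee j i) (ff j i v)).
Proof.
move=> sw [v0 wv kv]; have [rij r'ij rr'] := sw.
have ne_ij : i != j by apply: contraTneq rij => ->; rewrite ltnn.
have p_gt0 := prime_gt0 (pcharf_prime charp).
have [ev fv] := kv _ _ rij.
split; first exact: stage_q_neq0.
  move=> l; have [c0 vc0] := wv l.
  elim: p.-1 => [|m [c IH]]; first by eexists; apply: (weight_ff _ _ vc0).
  by eexists; rewrite iterS; apply: (weight_ee op_rep _ _ IH).
have kill m : forall a b, (a, b) != (i, j) -> (r a < r b)%N ->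
    ee a b (iter m (ee j i) (ff j i v)) = 0 /\
    ff a b (iter m (ee j i) (ff j i v)) = 0.
  elim: m => [|m IH] c d cd rcd.
    have kve a b : (a, b) != (i, j) -> (r a < r b)%N -> ee a b v = 0.
      by move=> _ /kv[].
    have kvf a b : (a, b) != (i, j) -> (r a < r b)%N -> ff a b v = 0.
      by move=> _ /kv[].
    have [z1 z2] := swap_rank_kill sw (Z := fun a b => ee a b v) kve cd rcd.
    have [z3 z4] := swap_rank_kill sw (Z := fun a b => ff a b v) kvf cd rcd.
    rewrite /= (comm_ef op_rep) (comm_ff op_rep) (kve c d) // (kvf c d) //.
    by rewrite (plin0 (ff_lin op_rep _ _)) z1 z2 z3 z4 !(oppr0, addr0).
  have IHe a b (ab : (a, b) != (i, j)) (rab : (r a < r b)%N) := (IH a b ab rab).1.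
  have IHf a b (ab : (a, b) != (i, j)) (rab : (r a < r b)%N) := (IH a b ab rab).2.
  have [z1 z2] := swap_rank_kill sw (Z := fun a b => ee a b (iter m (ee j i) (ff j i v))) IHe cd rcd.
  have [z3 z4] := swap_rank_kill sw (Z := fun a b => ff a b (iter m (ee j i) (ff j i v))) IHf cd rcd.
  rewrite iterS (comm_ee op_rep) (comm_fe op_rep) (IHe c d) // (IHf c d) //.
  by rewrite (plin0 (ee_lin op_rep _ _)) z1 z2 z3 z4 !(oppr0, addr0).
move=> c d /(swap_rank_cases sw)[[-> ->]|[cd rcd]]; last exact: kill.
split; first by rewrite -iterS prednK // nil // eq_sym.
have -> m : ff j i (iter m (ee j i) (ff j i v)) = iter m (ee j i) (ff j i (ff j i v)).
  by elim: m => // m IH; rewrite !iterS (ff_ee_opp _ ne_ij) IH.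
rewrite (ff_sq charp p_odd op_rep) 1?eq_sym //.
exact: plin0 (iter_op_lin op_rep _ _).
Qed.

End Q.
End Stage.

(** * Lower bound: independent monomials in the negative letters *)

Lemma card_npair n : #|{: npair n}| = tri n.
Proof. by rewrite card_sig -card_gt; apply: eq_card => x; rewrite !inE. Qed.

(** The negative letters: for each pair of distinct indices one even letter and one odd letter. *)
Definition lowl (n : nat) := (bool * npair n)%type.
Definition lord (n p : nat) (l : lowl n) := if l.1 then 2%N else p.
Definition lexp (n p : nat) := ({ffun npair n -> 'I_p} * {ffun npair n -> bool})%type.
Definition lex_fun n p (a : lexp n p) (l : lowl n) : nat :=
  if l.1 then nat_of_bool (a.2 l.2) else nat_of_ord (a.1 l.2).
(** The odd letter, present when [q] is true, stands at the right and acts first, as in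
    [stage_q]. *)
Definition lpiece n p (q : bool) (x : npair n) : seq (lowl n) :=
  nseq p.-1 (false, x) ++ nseq q (true, x).

Lemma card_lexp n p : #|{: lexp n p}| = (p ^ tri n * 2 ^ tri n)%N.
Proof. by rewrite card_prod !card_ffun card_npair card_ord card_bool. Qed.

Lemma lex_fun_inj n p (a b : lexp n p) : lex_fun a =1 lex_fun b -> a = b.
Proof.
case: a b => a1 a2 [b1 b2] E; congr pair; apply/ffunP => x.
  by apply: val_inj; apply: (E (false, x)).
by have := E (true, x); rewrite /lex_fun /=; case: (a2 x); case: (b2 x).
Qed.

Lemma lex_fun_lt n p (a : lexp n p) l : (lex_fun a l < lord p l)%N.
Proof. by rewrite /lex_fun /lord; case: l.1 => //; case: (a.2 _). Qed.

Lemma count_flatten_piece (A T : eqType) (piece : A -> seq T) (s : seq A) t x m :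
  uniq s -> x \in s -> (forall y, count_mem t (piece y) = (y == x) * m)%N ->
  count_mem t (flatten [seq piece y | y <- s]) = m.
Proof.
move=> us xs pieceE; rewrite count_flatten -map_comp.
rewrite (eq_map (g := fun y => ((y == x) * m)%N)) => [|y]; last exact: pieceE.
have -> : sumn [seq ((y == x) * m)%N | y <- s] = (count_mem x s * m)%N.
  by elim: s {us xs} => //= y s ->; rewrite mulnDl.
by rewrite count_uniq_mem // xs mul1n.
Qed.

Lemma count_lpiece n p q (x y : npair n) c :
  count_mem (c, x) (lpiece p q y) = ((y == x) * (if c then q : nat else p.-1))%N.
Proof.
rewrite /lpiece count_cat !count_nseq /= !xpair_eqE /=.
by case: c => /=; rewrite ?mul0n ?addn0 ?add0n.
Qed.

Section Support.
Variables (k : fieldType) (V : lmodType k) (T : finType) (op : T -> V -> V).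
Variable ht : T -> nat.

(** Combinations of letters of height [h]: the shape that [independence] requires of commutators. *)
Definition supp (h : nat) (F : V -> V) := exists c : T -> k,
  (forall r, c r = 0 \/ ht r = h) /\ forall u, F u = \sum_r c r *: op r u.

Lemma supp0 h : supp h (fun=> 0).
Proof.
exists (fun=> 0); split=> [r|u]; first by left.
by rewrite big1 // => r _; rewrite scale0r.
Qed.

Lemma suppD h F G : supp h F -> supp h G -> supp h (fun u => F u + G u).
Proof.
move=> [c [ch cE]] [d [dh dE]]; exists (fun r => c r + d r); split=> [r|u].
  case: (ch r) => [->|]; last by right.
  by case: (dh r) => [->|]; [left; rewrite addr0 | right].
by rewrite cE dE -big_split; apply: eq_bigr => r _; rewrite scalerDl.
Qed.

Lemma suppZ h a F : supp h F -> supp h (fun u => a *: F u).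
Proof.
move=> [c [ch cE]]; exists (fun r => a * c r); split=> [r|u].
  by case: (ch r) => [->|]; [left; rewrite mulr0 | right].
by rewrite cE scaler_sumr; apply: eq_bigr => r _; rewrite scalerA.
Qed.

Lemma suppN h F : supp h F -> supp h (fun u => - F u).
Proof.
move=> /(suppZ (-1))[c [ch cE]]; exists c; split=> // u.
by rewrite -cE scaleN1r.
Qed.

Lemma supp1 h r : ht r = h -> supp h (op r).
Proof.
move=> hr; exists (fun s => (s == r)%:R); split=> [s|u].
  by case: eqP => [->|_]; [right | left].
by rewrite (bigD1 r) //= eqxx scale1r big1 ?addr0 // => s /negPf ->; rewrite scale0r.
Qed.

Lemma supp_if h (b : bool) F : (b -> supp h F) -> supp h (fun u => b%:R *: F u).
Proof.
case: b => [/(_ isT)|_]; first exact: suppZ.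
have [c [ch cE]] := supp0 h; exists c; split=> // u.
by rewrite scale0r -cE.
Qed.

Lemma supp_ext h F G : (forall u, F u = G u) -> supp h F -> supp h G.
Proof. by move=> FG [c [ch cE]]; exists c; split=> // u; rewrite -FG. Qed.

End Support.

Section LowerIndep.
Variables (k : fieldType) (p n : nat).
Hypothesis p_gt0 : (0 < p)%N.
Variables (V : lmodType k) (op : lowl n -> V -> V).
Variable ht : lowl n -> nat.
Hypothesis op_lin : forall l, linear (op l).
Hypothesis ht_gt0 : forall l, (0 < ht l)%N.
Hypothesis comm : forall s r, exists e : bool, exists2 F : V -> V,
  supp op ht (ht s + ht r) F &
  forall u, op s (op r u) = (-1) ^+ e *: op r (op s u) + F u.
Hypothesis pow0 : forall l u, iter (lord p l) (op l) u = 0.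
Variables (topw : seq (lowl n)) (I : finType) (f : I -> V).
Hypothesis top_count : forall l, count_mem l topw = (lord p l).-1.
Hypothesis top_inj : forall c : I -> k,
  wact op topw (\sum_i c i *: f i) = 0 -> \sum_i c i *: f i = 0.
Hypothesis f_ind : indep f.

(** [independence] with coefficients in the span of the base family [f], so that each base vector
    contributes a full set of monomials. *)
Lemma lower_indep : exists (J : finType) (h : J -> V),
  indep h /\ #|J| = (p ^ tri n * 2 ^ tri n * #|I|)%N.
Proof.
exists (lexp n p * I)%type, (fun x => wact op (cword (enum {: lowl n}) (lex_fun x.1)) (f x.2)).
split; last by rewrite card_prod card_lexp.
move=> c sum0 [a i].
have comm' s r : exists (e : bool) (d : lowl n -> k),
  (forall l, d l = 0 \/ ht l = (ht s + ht r)%N) /\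
  forall u, True -> op s (op r u) = (-1) ^+ e *: op r (op s u) + \sum_l d l *: op l u.
  have [e [F [d [dh dE]] FE]] := comm s r; exists e, d; split=> // u _.
  by rewrite FE dE.
have lord_gt0 (l : lowl n) : (0 < lord p l)%N by rewrite /lord; case: l.1.
have := @independence k V (lowl n) op (fun=> True) (lord p) ht op_lin lord_gt0 ht_gt0
  (fun _ _ _ => Logic.I) comm' (fun l u _ => pow0 l u)
  (fun u => exists c, u = \sum_i c i *: f i) topw (fun _ _ => Logic.I) top_count.
move=> /(_ _ (lexp n p) (@lex_fun n p) (fun b => \sum_j c (b, j) *: f j)) H.
have {H} := H _ (@lex_fun_inj n p) (@lex_fun_lt n p) _ _ a.
move=> H; apply: (f_ind (c := fun j => c (a, j))); apply: H.
- by move=> u [d ->]; apply: top_inj.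
- by move=> b; exists (fun j => c (b, j)).
rewrite -[RHS]sum0; transitivity (\sum_b \sum_j c (b, j) *:
   wact op (cword (enum {: lowl n}) (lex_fun b)) (f j)); last first.
  by rewrite pair_bigA; apply: eq_bigr => -[].
apply: eq_bigr => b _.
have lin : linear (wact op (cword (enum {: lowl n}) (lex_fun b))).
  by move=> *; apply: wactP.
by rewrite (plin_sum lin); apply: eq_bigr => j _; rewrite (plinZ lin).
Qed.

End LowerIndep.

(** * Lower bound: the periplectic algebra *)

Section LowerP.
Variables (k : closedFieldType) (p n : nat).
Hypothesis charp : p \in [pchar k].
Hypothesis p_odd : odd p.
Variables (V0 V1 : lmodType k) (op : 'M[k]_(n + n) -> V0 * V1 -> V0 * V1).
Variable t : 'I_n -> k.
Hypothesis t_inj : forall i j, i != j -> t i != t j.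
Hypothesis op_rep : srep (gfam k n false) op.
Hypothesis nil : forall i j v, i != j -> iter p (eop false op i j) v = 0.
Hypothesis tor : forall i v, iter p (eop false op i i) v = eop false op i i v + t i *: v.
Notation ee := (eop false op).
Notation bb := (bb op).
Notation cc := (cc op).

(** [P] marks the pairs whose odd reflection has been performed: there [cc] kills instead of [bb],
    while the upper triangular [ee] kill throughout. *)
Definition Sc (P : 'I_n -> 'I_n -> bool) (v : V0 * V1) :=
  [/\ v <> 0, forall i, exists c, ee i i v = c *: v,
      forall a b : 'I_n, (a < b)%N -> ee a b v = 0,
      forall a b : 'I_n, (a < b)%N -> P a b -> cc a b v = 0
    & forall a b : 'I_n, (a < b)%N -> ~~ P a b -> bb a b v = 0].

(** An odd reflection. [bb i j] takes [cc i j v] to (b - a) v with a different from b, so the new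
    vector is nonzero. Treating pairs in decreasing lexicographic order makes all other brackets
    fall on elements that already kill. *)
Lemma Sc_step (P P' : 'I_n -> 'I_n -> bool) (i j : 'I_n) v : (i < j)%N ->
  (forall a b : 'I_n, (a < b)%N -> P a b = (i < a)%N || ((a == i) && (j < b)%N)) ->
  (forall a b : 'I_n, (a < b)%N -> P' a b = (i < a)%N || ((a == i) && (j <= b)%N)) ->
  Sc P v -> Sc P' (cc i j v).
Proof.
move=> ij PE P'E [v0 wv ev cv bv].
have ne_ij : i != j by rewrite -val_eqE ltn_eqF.
have ji : (j == i) = false by rewrite eq_sym; apply/negbTE.
have [a va] := wv i; have [b vb] := wv j.
have bij : bb i j v = 0.
  by apply: bv; rewrite // PE // ltnn eqxx /= ltnn.
have ab0 := weight_sub_notin_Fp charp op_rep tor 0 (t_inj ne_ij) v0 va vb.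
have cv' (c d : 'I_n) : (c < d)%N -> (i < c)%N || ((c == i) && (j < d)%N) -> cc c d v = 0.
  by move=> cd H; apply: cv; rewrite // PE.
have c_lin c d := plin0 (cc_lin op_rep c d).
split.
- move=> E; have := comm_bc op_rep i j i j v.
  rewrite E bij (plin0 (bb_lin op_rep _ _)) c_lin oppr0 add0r !eqxx ji.
  rewrite [i == j](negPf ne_ij) !scale0r !scale1r va vb sub0r subr0.
  rewrite addrC -scalerBl => /esym/eqP; rewrite scaler_eq0 => /orP[|/eqP //].
  by rewrite -oppr_eq0 opprB; apply/negP.
- move=> l; have [c vc] := wv l.
  exists (c - ((l == i)%:R + (l == j)%:R)).
  rewrite (comm_ec op_rep) vc (plinZ (cc_lin op_rep _ _)) scalerBl scalerDl.
  have -> : ((l == i)%:R : k) *: cc l j v = (l == i)%:R *: cc i j v.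
    by case: (eqVneq l i) => [->|]; rewrite ?scale0r.
  have -> // : ((l == j)%:R : k) *: cc i l v = (l == j)%:R *: cc i j v.
  by case: (eqVneq l j) => [->|]; rewrite ?scale0r.
- move=> c d cd; rewrite (comm_ec op_rep) ev // c_lin sub0r.
  have t1 : ((c == i)%:R : k) *: cc d j v = 0.
    apply: nat_scale0 => /eqP E; rewrite {}E in cd.
    have [dj|jd|/val_inj ->] := ltngtP d j; last exact: cc_diag.
      by rewrite cv' // cd.
    by rewrite (cc_anti op_rep) cv' ?oppr0 // ij.
  have t2 : ((c == j)%:R : k) *: cc i d v = 0.
    apply: nat_scale0 => /eqP E; rewrite {}E in cd.
    by rewrite cv' ?(ltn_trans ij cd) // ltnn eqxx.
  by rewrite t1 t2 addr0 oppr0.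
- move=> c d cd; rewrite P'E // => H.
  have [E|ne] := eqVneq (c, d) (i, j).
    by case: E => -> ->; apply: (cc_sq op_rep (two_neq0 charp p_odd)).
  rewrite (comm_cc op_rep) cv' ?c_lin ?oppr0 //.
  case/orP: H => [->//|/andP[ci jd]]; rewrite ci /=.
  rewrite xpair_eqE ci /= -val_eqE in ne.
  by rewrite [(j < d)%N]ltn_neqAle jd eq_sym ne orbT.
move=> c d cd; rewrite P'E // negb_or -leqNgt => /andP[ci nd].
have bcd : bb c d v = 0.
  apply: bv; rewrite // PE // negb_or -leqNgt ci /=.
  by apply: contra nd => /andP[-> /ltnW].
rewrite (comm_bc op_rep) bcd c_lin oppr0 add0r.
have t1 : ((d == i)%:R : k) *: ee c j v = 0.
  by apply: nat_scale0 => /eqP E; apply: ev; rewrite E in cd; apply: ltn_trans ij.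
have t2 : ((d == j)%:R : k) *: ee c i v = 0.
  apply: nat_scale0 => /eqP E; apply: ev; rewrite ltn_neqAle ci andbT.
  by apply: contra nd => ci'; rewrite -val_eqE ci' E leqnn.
have t3 : ((c == i)%:R : k) *: ee d j v = 0.
  by apply: nat_scale0 => /eqP E; apply: ev; move: nd; rewrite E eqxx -ltnNge.
have t4 : ((c == j)%:R : k) *: ee d i v = 0.
  by apply: nat_scale0 => /eqP E; move: ci ij; rewrite E; lia.
by rewrite t1 t2 t3 t4 !(oppr0, addr0).
Qed.

(** Every pair once, in decreasing lexicographic order; [d] and [e] count rows and columns from the
    end. *)
Lemma odd_chain : exists s : seq (npair n), [/\ uniq s, forall x, x \in s &
  forall v, Sc (fun _ _ => false) v ->
    Sc (fun _ _ => true) (foldr (fun x => cc (val x).2 (val x).1) v s)].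
Proof.
have ext P P' v : (forall a b : 'I_n, (a < b)%N -> P a b = P' a b) -> Sc P v -> Sc P' v.
  move=> PP' [v0 wv ev cv bv]; split=> // a b ab.
    by rewrite -PP' //; apply: cv.
  by rewrite -PP' //; apply: bv.
suff rows d : (d <= n)%N -> exists s : seq (npair n),
    [/\ uniq s, forall x, (x \in s) = (n - d <= (val x).2)%N &
     forall v, Sc (fun _ _ => false) v ->
     Sc (fun a _ => n - d <= a)%N (foldr (fun x => cc (val x).2 (val x).1) v s)].
  have [s [us ms sP]] := rows n (leqnn n); exists s; split=> // [x|v /sP].
    by rewrite ms subnn.
  by apply: ext => a b _; rewrite subnn.
elim: d => [_|d IH lt_dn].
  exists [::]; split=> // [x|v].
    by rewrite in_nil subn0 leqNgt ltn_ord.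
  by apply: ext => a b _; rewrite subn0 leqNgt ltn_ord.
have [s0 [us0 ms0 s0P]] := IH (ltnW lt_dn).
pose i := (n - d.+1)%N; have iE : (n - d = i.+1)%N by rewrite /i; lia.
have lt_in : (i < n)%N by rewrite /i; lia.
pose oi := Ordinal lt_in.
have col e : (e <= n - i.+1)%N -> exists s : seq (npair n),
    [/\ uniq s, forall x, (x \in s) = (i < (val x).2)%N ||
         (((val x).2 == oi) && (n - e <= (val x).1)%N) &
     forall v, Sc (fun _ _ => false) v ->
     Sc (fun a b => (i < a)%N || ((a == oi) && (n - e <= b)%N))
        (foldr (fun x => cc (val x).2 (val x).1) v s)].
  elim: e => [_|e IHe lt_e].
    exists s0; split=> // [x|v /s0P].
      by rewrite ms0 iE subn0 [(n <= _)%N]leqNgt ltn_ord andbF orbF.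
    by apply: ext => a b _; rewrite iE subn0 [(n <= _)%N]leqNgt ltn_ord andbF orbF.
  have [s [us ms sP]] := IHe (ltnW lt_e).
  pose j := (n - e.+1)%N; have jE : (n - e = j.+1)%N by rewrite /j; lia.
  have lt_jn : (j < n)%N by rewrite /j; lia.
  have lt_ij : (i < j)%N by rewrite /j; lia.
  pose oj := Ordinal lt_jn; have lt_o : ((oj, oi).2 < (oj, oi).1)%N by [].
  pose x0 : npair n := exist _ (oj, oi) lt_o.
  exists (x0 :: s); split.
  - by rewrite /= us ms /= ltnn eqxx /= jE ltnn.
  - move=> x; rewrite inE ms -/j jE -val_eqE /=; case: x => -[a b] /= lt_ba.
    by rewrite xpair_eqE -!val_eqE /=; lia.
  move=> v /sP; apply: Sc_step => // a b _; first by rewrite jE.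
have [|s [us ms sP]] := col (n - i.+1)%N; first by [].
exists s; split=> // [x|v /sP].
  rewrite ms subKn // -/i; case: x => -[a b] /= lt_ba.
  by rewrite -val_eqE /=; lia.
by apply: ext => a b lt_ab; rewrite subKn // -/i -val_eqE /=; lia.
Qed.

Definition low_p (l : lowl n) : V0 * V1 -> V0 * V1 :=
  if l.1 then cc (val l.2).2 (val l.2).1 else ee (val l.2).1 (val l.2).2.
(** Bracketing with a lower triangular E_ij replaces an index [i] of an antisymmetric generator by
    the smaller [j], raising 2n minus the index sum by i - j: heights add. *)
Definition ht_p (l : lowl n) : nat :=
  (if l.1 then 2 * n - (val l.2).1 - (val l.2).2 else (val l.2).1 - (val l.2).2)%N.

Lemma low_p_lin l : linear (low_p l).
Proof. by rewrite /low_p; case: l.1; [apply: cc_lin | apply: ee_lin]. Qed.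

Lemma supp_ee (a b : 'I_n) h : (b < a)%N -> h = (a - b)%N -> supp low_p ht_p h (ee a b).
Proof.
by move=> ba ->; apply: (@supp1 _ _ _ low_p ht_p _ (false, exist _ (a, b) ba)).
Qed.

Lemma supp_cc (a b : 'I_n) h : h = (2 * n - a - b)%N -> supp low_p ht_p h (cc a b).
Proof.
move=> ->; have [ab|ba|/val_inj ->] := ltngtP a b.
- have ab' : ((b, a).2 < (b, a).1)%N by [].
  apply: (@supp1 _ _ _ low_p ht_p _ (true, exist _ (b, a) ab')).
  by rewrite /ht_p /=; lia.
- have ba' : ((a, b).2 < (a, b).1)%N by [].
  apply: (@supp_ext _ _ _ _ _ _ (fun u => - cc b a u)) => [u|].
    by rewrite [RHS](cc_anti op_rep).
  by apply: suppN; apply: (@supp1 _ _ _ low_p ht_p _ (true, exist _ (a, b) ba')).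
apply: (@supp_ext _ _ _ _ _ _ (fun u => 0)) => [u|]; last exact: supp0.
by rewrite (cc_diag op_rep).
Qed.

Lemma low_p_comm s r : exists e : bool, exists2 F : V0 * V1 -> V0 * V1,
  supp low_p ht_p (ht_p s + ht_p r) F &
  forall u, low_p s (low_p r u) = (-1) ^+ e *: low_p r (low_p s u) + F u.
Proof.
case: s r => [c [[i j] ij]] [c' [[a b] ab]]; have /= ij' := ij; have /= ab' := ab.
rewrite /low_p /ht_p /=; have li := ltn_ord i; have la := ltn_ord a.
case: c; case: c'.
- exists true, (fun=> 0); first exact: supp0.
  by move=> u; rewrite addr0 expr1 scaleN1r (comm_cc op_rep).
- exists false, (fun u => (a == j)%:R *: cc b i u + (a == i)%:R *: cc j b u).
    by apply: suppD; apply: supp_if => /eqP/(congr1 val) /= E; apply: supp_cc => /=; lia.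
  by move=> u; rewrite scale1r (comm_ec op_rep) subrK.
- exists false, (fun u => - ((i == b)%:R *: cc j a u + (i == a)%:R *: cc b j u)).
    by apply/suppN/suppD; apply: supp_if => /eqP/(congr1 val) /= E; apply: supp_cc => /=; lia.
  by move=> u; rewrite scale1r (comm_ec op_rep).
exists false, (fun u => (j == a)%:R *: ee i b u + - ((b == i)%:R *: ee a j u)).
  apply: suppD; last apply: suppN; apply: supp_if => /eqP/(congr1 val) /= E;
    apply: supp_ee => /=; lia.
by move=> u; rewrite scale1r (comm_ee op_rep).
Qed.

(** The top word performs all odd reflections and then all even ones on a highest weight vector. Its
    value is nonzero, which makes all ordered monomials on that one vector independent. *)
Lemma lower_p v0 b0 : v0 <> 0 -> @homogeneous k V0 V1 b0 v0 ->
  exists (J : finType) (h : J -> V0 * V1), indep h /\ #|J| = kwdim p n false.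
Proof.
move=> v00 hv0; have p_pr := pcharf_prime charp.
have nil' (i j : 'I_n) v : (i < j)%N -> iter p (ee i j) v = 0.
  by move=> ij; apply: nil; rewrite -val_eqE ltn_eqF.
have [v [b [vn0 hv [bv kv] wv]]] := highest_weight_p charp p_odd op_rep nil' tor v00 hv0.
have [s1 [us1 ms1 s1P]] := odd_chain.
have [||s2 [us2 ms2 s2P]] := @rank_chain n _ (St_p op) _ low_p (@lpiece n p false).
- by move=> r r' u rr' [u0 wu ku]; split=> // c d; rewrite -rr'; apply: ku.
- move=> r r' [[j i] ij] u; rewrite /lpiece cats0 -[foldr _ _ _]/(wact low_p _ u) wact_nseq.
  exact: (stage_p charp t_inj op_rep nil tor).
(* The odd letters stand on the right and so act first. *)
pose topw := flatten [seq lpiece p false x | x <- s2] ++ [seq (true, x) | x <- s1].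
have topv : wact low_p topw v <> 0.
  rewrite /topw wact_cat.
  have -> : wact low_p [seq (true, x) | x <- s1] v =
      foldr (fun x => cc (val x).2 (val x).1) v s1.
    by elim: (s1) => //= x s ->.
  have [|r [] //] := s2P (foldr (fun x => cc (val x).2 (val x).1) v s1).
  by have [u0 wu eu _ _] : Sc (fun _ _ => true) (foldr (fun x => cc (val x).2 (val x).1) v s1)
    by apply: s1P; split=> // ? ? ?; apply: kv.
have ht_gt0 l : (0 < ht_p l)%N.
  case: l => [c [[i j] ij]]; have /= ij' := ij; rewrite /ht_p /=.
  by case: c; have := ltn_ord i; lia.
have [||||J [h [hi hc]]] := @lower_indep k p n (prime_gt0 p_pr) _ low_p ht_p low_p_lin ht_gt0
  low_p_comm _ topw 'I_1 (fun=> v).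
- move=> [[] [[i j] ij]] u; rewrite /lord /low_p /=.
    exact: (cc_sq op_rep (two_neq0 charp p_odd)).
  by apply: nil; rewrite -val_eqE gtn_eqF.
- move=> [c x]; rewrite count_cat (count_flatten_piece us2 (ms2 x) (fun y => count_lpiece p false x y c)).
  rewrite count_map; case: c => /=.
    rewrite (eq_count (a2 := pred1 x)) ?count_uniq_mem ?ms1 //.
  by rewrite (eq_count (a2 := pred0)) ?count_pred0 ?addn0 // => y /=; rewrite xpair_eqE.
- move=> c; rewrite big_ord1 /= => E; have := wactP low_p_lin topw (c ord0) v 0.
  have w0 : wact low_p topw 0 = 0 by apply: wact0 low_p_lin _.
  rewrite w0 !addr0 E => /esym/eqP; rewrite scaler_eq0 => /orP[/eqP ->|/eqP //].
  by rewrite scale0r.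
- move=> c; rewrite big_ord1 /= => /eqP; rewrite scaler_eq0 => /orP[/eqP c0 i|/eqP //]; by rewrite [i]ord1.
by exists J, h; rewrite hc card_ord muln1.
Qed.

End LowerP.

(** * Lower bound: the queer algebra and Clifford modules *)

Section LowerQ.
Variables (k : closedFieldType) (p n : nat).
Hypothesis charp : p \in [pchar k].
Hypothesis p_odd : odd p.
Variables (V0 V1 : lmodType k) (op : 'M[k]_(n + n) -> V0 * V1 -> V0 * V1).
Hypothesis op_rep : srep (gfam k n true) op.
Notation ee := (eop true op).
Notation ff := (ff op).
Notation homogV := (@homogeneous k V0 V1).

Section Clifford.
Variables (lam w : 'I_n -> k).
Hypothesis lam_neq0 : forall i, lam i != 0.
Hypothesis w_sq : forall i, w i ^+ 2 * lam (nxt i) = - lam i.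
Notation one := (fun _ : 'I_n => 1 : k).
Notation G i := (op (qB (lowmx one w i))).
Notation G' i := (op (qB (lowmx one (fun j => - w j) i))).
Notation W := (hw_q op lam).

Definition lowt := {i : 'I_n | low i}.

Lemma card_lowt : #|{: lowt}| = n./2.
Proof.
rewrite card_sig; have := cardC [pred i : 'I_n | odd i || (i.+1 == n)].
rewrite card_oddlast card_ord => E; have -> : #|[pred x | @low n x]| =
    #|[predC [pred i : 'I_n | odd i || (i.+1 == n)]]|.
  apply: eq_card => i; rewrite !inE negb_or /low ltn_neqAle ltn_ord andbT //.
by apply: (@addnI (uphalf n)); rewrite E uphalf_half -addnA addnn odd_double_half.
Qed.

Lemma anti_disjoint D D' v : D *m D' = 0 -> D' *m D = 0 ->
  op (qB D) (op (qB D') v) = - op (qB D') (op (qB D) v).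
Proof.
move=> DD' D'D; rewrite (qB_anti op_rep) DD' D'D addr0.
by rewrite (plin0 (op_evA_lin op_rep v)) addr0.
Qed.

Lemma lowt_neq (a b : lowt) : a != b -> val a != val b.
Proof. by rewrite (inj_eq val_inj). Qed.

Lemma G'_comm (a b : lowt) v : W v -> G' (val a) (G' (val b) v) = - G' (val b) (G' (val a) v).
Proof.
move=> Wv; have [<-|ab] := eqVneq a b.
  rewrite (lowmx_nil charp p_odd op_rep (lam := lam)) ?oppr0 //; last exact: (valP a).
  by move=> i; rewrite expr1n mul1r sqrrN w_sq subrr.
have ba : val b != val a by rewrite eq_sym lowt_neq.
exact (anti_disjoint _ (lowmx_disjoint _ _ _ _ (valP a) (valP b) (lowt_neq ab))
  (lowmx_disjoint _ _ _ _ (valP b) (valP a) ba)).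
Qed.

(** [G a] and [G' a] span the two isotropic lines of the plane of the pair at [a]; their bracket is
    4 times [lam a], so they behave as annihilation and creation operators. *)
Lemma G_G' a v : low a -> W v -> G a v = 0 -> G a (G' a v) = (lam a *+ 4) *: v.
Proof.
move=> la [_ ev] Gv; rewrite (qB_anti op_rep) Gv (plin0 (srep_lin op_rep _)) oppr0 add0r.
rewrite !lowmx_mul // !(plinD (op_evA_lin op_rep v)) !(plinZ (op_evA_lin op_rep v)).
rewrite -!/(eop _ _ _ _ _) !ev !scalerA -!scalerDl; congr (_ *: _).
transitivity (lam a *+ 2 - (w a ^+ 2 * lam (nxt a)) *+ 2); first by ring.
by rewrite w_sq; ring.
Qed.

Lemma G_word (a : lowt) s v : W v -> a \notin s -> G (val a) v = 0 ->
  G (val a) (wact (fun b : lowt => G' (val b)) s v) = 0.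
Proof.
move=> Wv + Gv; elim: s => [//|b s IH]; rewrite inE negb_or /= => /andP[ab as_].
have ba : val b != val a by rewrite eq_sym lowt_neq.
rewrite (anti_disjoint _ (lowmx_disjoint _ _ _ _ (valP a) (valP b) (lowt_neq ab))
  (lowmx_disjoint _ _ _ _ (valP b) (valP a) ba)).
by rewrite IH // (plin0 (srep_lin op_rep _)) oppr0.
Qed.

Lemma W_word s v : W v -> W (wact (fun b : lowt => G' (val b)) s v).
Proof. by move=> Wv; elim: s => //= b s; apply: hw_q_lowmx. Qed.

(** [G a] anticommutes with the creation letters of the other pairs and cancels [G' a] up to a
    nonzero scalar, so letters are peeled off one by one. *)
Lemma G'_word_inj s v : W v -> (forall a : lowt, G (val a) v = 0) -> uniq s ->
  wact (fun b : lowt => G' (val b)) s v = 0 -> v = 0.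
Proof.
move=> Wv Gv; elim: s => //= a s IH /andP[nas us] E; apply: IH us _.
have := G_G' (valP a) (W_word s Wv) (G_word Wv nas (Gv a)).
rewrite E (plin0 (srep_lin op_rep _)) => /esym/eqP; rewrite scaler_eq0 -mulr_natl.
rewrite (natrM _ 2 2) !mulf_eq0 (negPf (two_neq0 charp p_odd)) (negPf (lam_neq0 _)).
by move/eqP.
Qed.

Definition killed_G v := W v /\ forall a : lowt, G (val a) v = 0.

(** For odd [n] the unpaired index [l] yields a second vector [ff l l v]: nonzero because [ff l l]
    squares to the nonzero weight, and independent of [v] because its parity is opposite. *)
Lemma clifford_base v0 b0 : v0 <> 0 -> homogV b0 v0 -> W v0 ->
  exists f : 'I_(odd n).+1 -> V0 * V1, indep f /\ forall i, killed_G (f i).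
Proof.
move=> v00 hv0 Wv0; have uw0 i : 1 ^+ 2 * lam i + w i ^+ 2 * lam (nxt i) = 0.
  by rewrite w_sq expr1n mul1r subrr.
have [v [b [vn0 hv Wv kv]]] :=
  isotropic_vec charp p_odd op_rep (u := one) uw0 v00 hv0 Wv0.
have Gv (a : lowt) : G (val a) v = 0 by apply/kv/(valP a).
case odd_n: (odd n) => /=; last first.
  exists (fun=> v); split=> // c; rewrite big_ord1 /= => /eqP.
  by rewrite scaler_eq0 => /orP[/eqP c0 i|/eqP //]; rewrite [i]ord1.
have n_gt0 : (n.-1 < n)%N by case: (n) odd_n.
pose l := Ordinal n_gt0; pose v' := ff l l v.
have Wv' : W v' by apply: hw_q_ff.
have hv' : homogV (~~ b) v' by apply: ff_homog op_rep _ _ _ _ hv.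
have v'0 : v' <> 0.
  move=> E; have := ff_diag_sq charp p_odd op_rep l v.
  rewrite -/v' E (plin0 (ff_lin op_rep _ _)) Wv.2 => /esym/eqP.
  by rewrite scaler_eq0 (negPf (lam_neq0 _)) => /eqP.
have low_neq (x : 'I_n) : low x -> x != l /\ nxt x != l.
  move=> lx; have /andP[ex lt_x] := lx; have nx := val_nxt lx.
  by split; apply/eqP => /(congr1 val) /= E; rewrite ?nx in E; lia.
have Gv' (a : lowt) : G (val a) v' = 0.
  have [al nl] := low_neq _ (valP a).
  rewrite /v' /ff anti_disjoint ?Gv ?(plin0 (srep_lin op_rep _)) ?oppr0 //.
    by rewrite /lowmx mulmxDl -!scalemxAl !dE_neq ?scaler0 ?addr0.
  by rewrite /lowmx mulmxDr -!scalemxAr !dE_neq 1?eq_sym ?scaler0 ?addr0 // eq_sym.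
exists (fun i => if i == ord0 then v else v'); split; last by move=> i; case: ifP.
move=> c; rewrite !big_ord_recl big_ord0 /= addr0 => E.
have [cv cv'] : c ord0 *: v = 0 /\ c (lift ord0 ord0) *: v' = 0.
  move: E hv hv'; set x := c ord0 *: v; set y := _ *: v'.
  have hx u d e : homogV e u -> homogV e (d *: u).
    by rewrite /homogeneous; case: e => /= ->; rewrite scaler0.
  move=> E hv hv'; have := hx _ (c ord0) _ hv; have := hx _ (c (lift ord0 ord0)) _ hv'.
  rewrite -/x -/y; move: E; case: x => x0 x1; case: y => y0 y1; rewrite /homogeneous.
  by case: b {hv hv'} => /= -[E0 E1] H1 H2; subst; rewrite ?addr0 ?add0r in E0 E1 *; rewrite E0 E1.
have c0 : c ord0 = 0 by move/eqP: cv; rewrite scaler_eq0 => /orP[/eqP|/eqP].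
have c1 : c (lift ord0 ord0) = 0 by move/eqP: cv'; rewrite scaler_eq0 => /orP[/eqP|/eqP].
move=> i; case: (unliftP ord0 i) => [j|] ->; last exact: c0.
by rewrite [j]ord1 c1.
Qed.

(** [independence] with the creation operators [G'] as letters of order 2: one monomial per set of
    complete pairs, on each base vector. *)
Lemma clifford_indep v0 b0 : v0 <> 0 -> homogV b0 v0 -> W v0 ->
  exists (I : finType) (f : I -> V0 * V1),
    [/\ indep f, forall i, W (f i) & #|I| = (2 ^ uphalf n)%N].
Proof.
move=> v00 hv0 Wv0; have [f [f_ind kf]] := clifford_base v00 hv0 Wv0.
pose ex (A : {ffun lowt -> bool}) (t : lowt) : nat := A t.
pose op2 (a : lowt) := G' (val a).
pose wd A := wact op2 (cword (enum {: lowt}) (ex A)).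
exists ({ffun lowt -> bool} * 'I_(odd n).+1)%type, (fun x => wd x.1 (f x.2)).
have W0 : W 0.
  by have := hw_q_sub op_rep (-1) Wv0 Wv0; rewrite scaleN1r addNr.
split; last first.
- rewrite card_prod card_ffun card_bool card_ord card_lowt uphalf_half.
  by case: (odd n); rewrite ?muln1 //= expnD mulnC.
- by move=> [A i]; apply: W_word; case: (kf i).
move=> c sum0 [A i]; apply: (f_ind (fun j => c (A, j))).
have lin a : linear (op2 a) by apply: srep_lin op_rep _.
(* On [W] the letters anticommute without error terms, so the heights may all be 1. *)
have comm' (s t : lowt) : exists (e : bool) (d : lowt -> k),
  (forall l, d l = 0 \/ 1%N = (1 + 1)%N) /\
  forall u, W u -> op2 s (op2 t u) = (-1) ^+ e *: op2 t (op2 s u) + \sum_l d l *: op2 l u.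
  exists true, (fun=> 0); split=> [l|u Wu]; first by left.
  rewrite big1 ?addr0 ?scaleN1r => [|l _]; last exact: scale0r.
  exact: G'_comm.
have pow0 (t : lowt) u : W u -> iter 2 (op2 t) u = 0.
  move=> Wu; apply: (lowmx_nil charp p_odd op_rep (lam := lam) _ (valP t) Wu) => j.
  by rewrite expr1n mul1r sqrrN w_sq subrr.
have W_op (t : lowt) u : W u -> W (op2 t u) by apply: hw_q_lowmx.
apply: (@independence k _ lowt op2 W (fun=> 2%N) (fun=> 1%N) lin (fun=> isT) (fun=> isT)
  W_op comm' pow0 killed_G (enum {: lowt}) _ _ _ _ ex
  (fun B => \sum_j c (B, j) *: f j)) => //.
- by move=> u [].
- by move=> t; rewrite count_uniq_mem ?enum_uniq // mem_enum.
- by move=> u [Wu Gu]; apply: G'_word_inj => //; apply: enum_uniq.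
- by move=> B C BC; apply/ffunP => t; have := BC t; rewrite /ex; case: (B t); case: (C t).
- by move=> B t; rewrite /ex; case: (B t).
- move=> B; split.
    apply: (big_ind W) => // [x y Wx Wy|j _].
      by have := hw_q_sub op_rep 1 Wx Wy; rewrite scale1r.
    by apply: hw_q_scale => //; case: (kf j).
  move=> a; rewrite (plin_sum (srep_lin op_rep _)) big1 // => j _.
  by rewrite (plinZ (srep_lin op_rep _)) (kf j).2 scaler0.
rewrite -[RHS]sum0; transitivity (\sum_B \sum_j c (B, j) *: wd B (f j)); last first.
  by rewrite pair_bigA; apply: eq_bigr => -[].
apply: eq_bigr => B _.
have wlin : linear (wact op2 (cword (enum {: lowt}) (ex B))) by move=> *; apply: wactP.
by rewrite /wd (plin_sum wlin); apply: eq_bigr => j _; rewrite (plinZ wlin).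
Qed.

End Clifford.

Variable t : 'I_n -> k.
Hypothesis t_inj : forall i j, i != j -> t i != t j.
Hypothesis t_add : forall i j, t i + t j != 0.
Hypothesis nil : forall i j v, i != j -> iter p (ee i j) v = 0.
Hypothesis tor : forall i v, iter p (ee i i) v = ee i i v + t i *: v.

Definition low_q (l : lowl n) : V0 * V1 -> V0 * V1 :=
  if l.1 then ff (val l.2).1 (val l.2).2 else ee (val l.2).1 (val l.2).2.
Definition ht_q (l : lowl n) : nat := ((val l.2).1 - (val l.2).2)%N.

Lemma low_q_lin l : linear (low_q l).
Proof. by rewrite /low_q; case: l.1; [apply: ff_lin | apply: ee_lin]. Qed.

Lemma supp_low_q c (a b : 'I_n) h : (b < a)%N -> h = (a - b)%N ->
  supp low_q ht_q h (if c then ff a b else ee a b).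
Proof.
move=> ba ->; have := @supp1 _ _ _ low_q ht_q _ (c, exist _ (a, b) ba) erefl.
by rewrite /low_q; case: c.
Qed.

Lemma low_q_comm s r : exists e : bool, exists2 F : V0 * V1 -> V0 * V1,
  supp low_q ht_q (ht_q s + ht_q r) F &
  forall u, low_q s (low_q r u) = (-1) ^+ e *: low_q r (low_q s u) + F u.
Proof.
case: s r => [c [[i j] ij]] [c' [[a b] ab]]; have /= ij' := ij; have /= ab' := ab.
rewrite /low_q /ht_q /=.
have H d e : supp low_q ht_q (i - j + (a - b)) (fun u =>
    (j == a)%:R *: (if d then ff i b else ee i b) u +
    (-1) ^+ e *: ((b == i)%:R *: (if d then ff a j else ee a j) u)).
  apply: suppD; last apply: suppZ; apply: supp_if => /eqP/(congr1 val) /= E;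
  by apply: supp_low_q; lia.
case: c; case: c'.
- exists true; eexists; first exact: (H false false).
  by move=> u; rewrite ?expr1 ?expr0 ?scaleN1r ?scale1r (comm_ff op_rep).
- exists false; eexists; first exact: (H true true).
  by move=> u; rewrite ?expr1 ?expr0 ?scaleN1r ?scale1r (comm_fe op_rep).
- exists false; eexists; first exact: (H true true).
  by move=> u; rewrite ?expr1 ?expr0 ?scaleN1r ?scale1r (comm_ef op_rep).
exists false; eexists; first exact: (H false true).
by move=> u; rewrite ?expr1 ?expr0 ?scaleN1r ?scale1r (comm_ee op_rep).
Qed.

(** The weights [lam i] are nonzero because t_i + t_i is, so the Clifford family has full size.
    Every nonzero combination of it is again a highest weight vector, so the chain of reflections is
    injective on its span. *)
Lemma lower_q v0 b0 : v0 <> 0 -> homogV b0 v0 ->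
  exists (J : finType) (h : J -> V0 * V1), indep h /\ #|J| = kwdim p n true.
Proof.
move=> v00 hv0; have p_pr := pcharf_prime charp.
have nil' (i j : 'I_n) v : (i < j)%N -> iter p (ee i j) v = 0.
  by move=> ij; apply: nil; rewrite -val_eqE ltn_eqF.
have [v [b [vn0 hv kv wv]]] := highest_weight_q charp p_odd op_rep nil' tor v00 hv0.
have [lam lamE] := fin_all_exists wv.
have lam_neq0 i : lam i != 0.
  have := weight_add_neq0 charp op_rep tor (t_add i i) vn0 (lamE i) (lamE i).
  by apply: contraNneq => ->; rewrite addr0.
have ex i : exists w : k, w ^+ 2 * lam (nxt i) = - lam i.
  have [w wE] := pth_root (- lam i / lam (nxt i)) (ltn0Sn 1).
  by exists w; rewrite wE divfK.
have [w wE] := fin_all_exists ex.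
have [I [f [f_ind Wf cI]]] := clifford_indep lam_neq0 wE vn0 hv (conj kv lamE).
have [||s [us ms sP]] := @rank_chain n _ (St_q op) _ low_q (@lpiece n p true).
- by move=> r r' u rr' [u0 wu ku]; split=> // c d; rewrite -rr'; apply: ku.
- move=> r r' [[j i] ij] u.
  rewrite /lpiece -[foldr _ _ _]/(wact low_q _ u) wact_cat !wact_nseq.
  exact: (stage_q charp p_odd t_inj op_rep nil tor t_add).
pose topw := flatten [seq lpiece p true x | x <- s].
have ht_gt0 l : (0 < ht_q l)%N.
  by case: l => [c [[i j] ij]]; have /= ij' := ij; rewrite /ht_q subn_gt0.
have [||||J [h [hi hc]]] := @lower_indep k p n (prime_gt0 p_pr) _ low_q ht_q low_q_lin ht_gt0
  low_q_comm _ topw I f.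
- move=> [c [[i j] ij]] u; have ne : i != j by rewrite -val_eqE gtn_eqF.
  by case: c; rewrite /lord /low_q /=; [apply: (ff_sq charp p_odd op_rep) | apply: nil].
- by move=> [c x]; rewrite (count_flatten_piece us (ms x) (fun y => count_lpiece p true x y c));
     case: c.
- move=> c E; have Wsum : hw_q op lam (\sum_i c i *: f i).
    have W0 : hw_q op lam 0.
      by have := hw_q_sub op_rep (-1) (conj kv lamE) (conj kv lamE); rewrite scaleN1r addNr.
    apply: (big_ind (hw_q op lam)) => // [x y Wx Wy|j _].
      by have := hw_q_sub op_rep 1 Wx Wy; rewrite scale1r.
    exact: hw_q_scale.
  apply: NNPP => n0; have [|r [] //] := sP (\sum_i c i *: f i).
  by case: Wsum => ku eu; split=> // i; exists (lam i).
- exact: f_ind.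
by exists J, h; rewrite hc cI /kwdim -mulnA -expnD.
Qed.

End LowerQ.

(** * The oscillator representation of gl(n|n) *)

Section SuperFock.
Variables (k : fieldType) (n : nat) (F : lmodType k).

Definition ipar (I : 'I_(n + n)) : bool := if split I is inr _ then true else false.

Variable zop : bool -> 'I_(n + n) -> 'I_n -> F -> F.
Hypothesis zop_lin : forall b I a, linear (zop b I a).
Hypothesis zop_comm : forall b c I a K e f, zop b I a (zop c K e f) =
  (-1) ^+ (ipar I && ipar K) *: zop c K e (zop b I a f) +
  (((I, a) == (K, e)) && (b != c))%:R *: ((-1) ^+ (b && ~~ ipar I) *: f).

(** [zop true] creates and [zop false] annihilates, so this is the operator x_I d_J in the copy [a]
    of the natural module, and [fockR] is the action of gl(n|n) on polynomial functions in [n]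
    copies. *)
Definition zd I J a f := zop true I a (zop false J a f).
Definition fockE I J f := \sum_a zd I J a f.
Definition fockR (X : 'M[k]_(n + n)) f := \sum_I \sum_J X I J *: fockE I J f.

Lemma zd_lin I J a : linear (zd I J a).
Proof. by move=> c x y; rewrite /zd !zop_lin. Qed.

Lemma fockE_lin I J : linear (fockE I J).
Proof.
move=> c x y; rewrite /fockE scaler_sumr -big_split; apply: eq_bigr => a _.
by rewrite zd_lin.
Qed.

Lemma fockR_linr X : linear (fockR X).
Proof.
move=> c x y; rewrite /fockR scaler_sumr -big_split; apply: eq_bigr => I _ /=.
rewrite scaler_sumr -big_split; apply: eq_bigr => J _ /=.
by rewrite fockE_lin scalerDr !scalerA mulrC.
Qed.

Lemma fockR_linl f : linear (fockR^~ f).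
Proof.
move=> c X Y; rewrite /fockR scaler_sumr -big_split; apply: eq_bigr => I _ /=.
rewrite scaler_sumr -big_split; apply: eq_bigr => J _ /=.
by rewrite !mxE scalerDl scalerA.
Qed.

Lemma zd_comm I J K L a e f :
  let s := (-1) ^+ ((ipar I (+) ipar J) && (ipar K (+) ipar L)) : k in
  zd I J a (zd K L e f) = s *: zd K L e (zd I J a f) +
    (((J == K) && (a == e))%:R *: zd I L a f - s *: (((L == I) && (a == e))%:R *: zd K J a f)).
Proof.
move=> s; rewrite /zd.
have zZ b M d (c : k) g : zop b M d (c *: g) = c *: zop b M d g := plinZ (zop_lin b M d) c g.
have zD b M d g h : zop b M d (g + h) = zop b M d g + zop b M d h := plinD (zop_lin b M d) g h.
rewrite (zop_comm false true J a K e) (zop_comm false true L e I a) /=.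
rewrite !zD !zZ !xpair_eqE !andbT [e == a]eq_sym !expr0 !scale1r.
rewrite (zop_comm true true K e I a) (zop_comm false false L e J a) !andbF !scale0r !addr0 !zZ.
have [E|] := eqVneq a e; last by rewrite !andbF !scale0r !addr0 scaler0 subr0 addr0 !scalerA /s;
  move=> _; congr (_ *: _); case: (ipar I); case: (ipar J); case: (ipar K); case: (ipar L);
  rewrite /= ?expr0 ?expr1; ring.
rewrite E scalerDr !scalerA /s.
set X := zop true I _ (zop true K _ _); set Y := zop true I _ _; set Z := zop true K _ _.
rewrite [RHS]addrACA subrr addr0; congr (_ *: X + _).
by case: (ipar I); case: (ipar J); case: (ipar K); case: (ipar L); rewrite /= ?expr0 ?expr1; ring.
Qed.

Lemma fockE_comm I J K L f :
  let s := (-1) ^+ ((ipar I (+) ipar J) && (ipar K (+) ipar L)) : k in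
  fockE I J (fockE K L f) = s *: fockE K L (fockE I J f) +
    ((J == K)%:R *: fockE I L f - s *: ((L == I)%:R *: fockE K J f)).
Proof.
move=> s; rewrite {1}/fockE.
under eq_bigr => a _ do rewrite {1}/fockE (plin_sum (zd_lin I J a)).
have -> : fockE K L (fockE I J f) = \sum_a \sum_e zd K L e (zd I J a f).
  rewrite exchange_big /=; apply: eq_bigr => e _.
  by rewrite -(plin_sum (zd_lin K L e)).
have dlt (b : bool) (G : 'I_n -> F) : b%:R *: \sum_a G a =
    \sum_a \sum_e ((b && (a == e))%:R : k) *: G a.
  rewrite scaler_sumr; apply: eq_bigr => a _.
  rewrite (bigD1 a) //= eqxx andbT big1 ?addr0 // => e; rewrite eq_sym => /negPf->.
  by rewrite andbF scale0r.
rewrite [X in X - _]dlt [X in _ - s *: X]dlt !scaler_sumr -sumrB -big_split.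
apply: eq_bigr => a _ /=; rewrite !scaler_sumr -sumrB -big_split.
by apply: eq_bigr => e _ /=; rewrite zd_comm.
Qed.

Lemma gl_part_ipar b (X : 'M[k]_(n + n)) I J : X \in gl_part k n b ->
  ipar I (+) ipar J != b -> X I J = 0.
Proof.
move=> /gl_partP <-; rewrite /hpart /ipar /block_mx.
by case: b; rewrite !mxE; case: (split I) => i; rewrite !mxE; case: (split J) => j; rewrite ?mxE.
Qed.

(** Both sides are expanded in matrix units. Entries of the wrong parity vanish by [gl_part_ipar],
    and for the others the sign in [fockE_comm] is the constant [s]. *)
Lemma fockR_bracket b c X Y f : X \in gl_part k n b -> Y \in gl_part k n c ->
  fockR (superbracket X Y) f =
  fockR X (fockR Y f) - (-1) ^+ (b && c) *: fockR Y (fockR X f).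
Proof.
move=> Xb Yc; set s := (-1) ^+ _ : k.
have E4 A B (G : 'I_(n + n) -> 'I_(n + n) -> 'I_(n + n) -> 'I_(n + n) -> F) :
    \sum_I \sum_J A I J *: \sum_K \sum_L B K L *: G I J K L =
    \sum_I \sum_J \sum_K \sum_L (A I J * B K L) *: G I J K L.
  apply: eq_bigr => I _; apply: eq_bigr => J _; rewrite scaler_sumr.
  apply: eq_bigr => K _; rewrite scaler_sumr; apply: eq_bigr => L _.
  by rewrite scalerA.
have RR A B : fockR A (fockR B f) = \sum_I \sum_J \sum_K \sum_L
    (A I J * B K L) *: fockE I J (fockE K L f).
  rewrite -E4; apply: eq_bigr => I _; apply: eq_bigr => J _; congr (_ *: _).
  rewrite (plin_sum (fockE_lin I J)); apply: eq_bigr => K _.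
  rewrite (plin_sum (fockE_lin I J)); apply: eq_bigr => L _.
  exact: plinZ (fockE_lin I J) _ _.
have RM A B : fockR (A *m B) f = \sum_I \sum_J \sum_K \sum_L
    (A I J * B K L) *: ((J == K)%:R *: fockE I L f).
  apply: eq_bigr => I _; rewrite exchange_big /=.
  under [RHS]eq_bigr => J _ do rewrite exchange_big /=.
  rewrite [RHS]exchange_big /=; apply: eq_bigr => L _.
  rewrite mxE scaler_suml; apply: eq_bigr => J _.
  rewrite (bigD1 J) //= eqxx scale1r big1 ?addr0 // => K; rewrite eq_sym => /negPf->.
  by rewrite scale0r scaler0.
rewrite (superbracket_homogeneous Xb Yc) -/s (plinB (fockR_linl f)) (plinZ (fockR_linl f)).
rewrite !RR !RM.
have swap (G : 'I_(n + n) -> 'I_(n + n) -> 'I_(n + n) -> 'I_(n + n) -> F) :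
    \sum_I \sum_J \sum_K \sum_L G I J K L = \sum_K \sum_L \sum_I \sum_J G I J K L.
  under eq_bigr => I _ do rewrite exchange_big /=.
  rewrite exchange_big /=; apply: eq_bigr => K _.
  under eq_bigr => I _ do rewrite exchange_big /=.
  by rewrite exchange_big.
rewrite [X in _ - s *: X = _]swap [X in _ = _ - s *: X]swap.
rewrite !scaler_sumr -!sumrB; apply: eq_bigr => I _.
rewrite !scaler_sumr -!sumrB; apply: eq_bigr => J _.
rewrite !scaler_sumr -!sumrB; apply: eq_bigr => K _.
rewrite !scaler_sumr -!sumrB; apply: eq_bigr => L _.
have [IJ|IJ] := eqVneq (ipar I (+) ipar J) b; last first.
  by rewrite (gl_part_ipar Xb IJ) mul0r mulr0 !scale0r.
have [KL|KL] := eqVneq (ipar K (+) ipar L) c; last first.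
  by rewrite (gl_part_ipar Yc KL) mul0r mulr0 !scale0r.
rewrite fockE_comm IJ KL -/s [Y K L * _]mulrC.
rewrite ![s *: (_ *: _)]scalerA ![s * (_ * _)]mulrC -!scalerA -!scalerBr.
by have -> : forall x y : F, x + y - x = y by move=> x y; rewrite addrAC subrr add0r.
Qed.

End SuperFock.

(** * A truncated Fock space with shifted diagonal modes *)

Section Fock.
Variables (k : fieldType) (p n : nat).
Hypothesis charp : p \in [pchar k].
Variable t : 'I_n -> k.

Definition mode := ('I_n * 'I_n)%type.
(** Occupation numbers: below [p] for bosonic modes, 0 or 1 for fermionic ones. A vector of [fock]
    is its coefficient function, so the space is finite-dimensional. *)
Definition fstate := ({ffun mode -> 'I_p} * {ffun mode -> bool})%type.
Definition fock := {ffun fstate -> k^o}.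
Implicit Types (u v : mode) (f : fock) (d : fstate) (b : bool).

Definition wop (w : fstate -> k) (s : fstate -> fstate) f : fock :=
  [ffun c => w c *: f (s c)].

Lemma wopE w s f d : wop w s f d = w d *: f (s d). Proof. exact: ffunE. Qed.
Lemma fock_add f g d : (f + g) d = f d + g d. Proof. exact: ffunE. Qed.
Lemma fock_opp f d : (- f) d = - f d. Proof. exact: ffunE. Qed.
Lemma fock_scale (a : k) f d : (a *: f) d = a *: f d. Proof. exact: ffunE. Qed.
Let fockE' := (wopE, fock_add, fock_opp, fock_scale).

Lemma wop_lin w s : linear (wop w s).
Proof. by move=> a f g; apply/ffunP => c; rewrite !ffunE scalerDr !scalerA mulrC. Qed.

Definition upd (T : Type) u (g : T -> T) (c : {ffun mode -> T}) : {ffun mode -> T} :=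
  [ffun v => if v == u then g (c v) else c v].

Lemma updE (T : Type) u (g : T -> T) c : upd u g c u = g (c u).
Proof. by rewrite ffunE eqxx. Qed.

Lemma upd_neq (T : Type) u v (g : T -> T) c : v != u -> upd u g c v = c v.
Proof. by rewrite ffunE => /negPf ->. Qed.

Lemma upd_comm (T : Type) u v (g h : T -> T) c : u != v ->
  upd u g (upd v h c) = upd v h (upd u g c).
Proof.
move=> uv; apply/ffunP => w; rewrite !ffunE; case: eqVneq => [->|//].
by rewrite (negPf uv).
Qed.

Lemma updK (T : Type) u (g h : T -> T) c : cancel h g -> upd u g (upd u h c) = c.
Proof. by move=> hK; apply/ffunP => w; rewrite !ffunE; case: eqP => // _; rewrite hK. Qed.

(** A diagonal mode (i, i) carries x^(t_i) k[x]/(x^p - 1), where x is invertible and x d/dx has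
    eigenvalues t_i + m; any other mode carries k[x]/(x^p). [bweight] lists the coefficients of x
    and of d/dx in these spaces. *)
Definition shift_t u : k := if u.1 == u.2 then t u.1 else 0.
Definition bweight b u (i : 'I_p) : k :=
  if b then ((u.1 == u.2) || (i != 0 :> nat))%:R else i.+1%:R + shift_t u.
Definition bmove b : 'I_p -> 'I_p := if b then @ord_pred p else @ordS p.
Definition bos b u := wop (fun c => bweight b u (c.1 u)) (fun c => (upd u (bmove b) c.1, c.2)).

(** The Jordan-Wigner sign, by which fermionic operators of different modes anticommute. *)
Definition jw_sign u (S : {ffun mode -> bool}) : k :=
  \prod_(v | (enum_rank v < enum_rank u)%N) (-1) ^+ S v.
Definition fer b u := wop (fun c => (c.2 u == b)%:R * jw_sign u c.2)
  (fun c => (c.1, upd u negb c.2)).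

Lemma natp0 : p%:R = 0 :> k. Proof. exact: pcharf0. Qed.

Lemma bweight_FT u i : bweight false u i * bweight true u (ordS i) = i.+1%:R + shift_t u.
Proof.
rewrite /bweight /shift_t; case: eqP => _ /=; first by rewrite mulr1.
rewrite addr0; have [lt_ip|] := boolP (i.+1 < p)%N; first by rewrite modn_small // mulr1.
rewrite -leqNgt => le_pi; have -> : i.+1 = p by apply/eqP; rewrite eqn_leq ltn_ord.
by rewrite natp0 mul0r.
Qed.

Lemma bweight_TF u i : bweight true u i * bweight false u (ord_pred i) = i%:R + shift_t u.
Proof.
have iE : (ord_pred i).+1%:R = i%:R :> k.
  rewrite /=; case: i => -[|m] /= lt_mp.
    by rewrite add0n modn_small ?prednK ?natp0 // ltn_predL.
  by rewrite modnDr modn_small // ltnW.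
rewrite /bweight iE /shift_t; case: eqP => _ /=; first by rewrite mul1r.
by case: (nat_of_ord i) => [|m]; rewrite /= ?mul1r // mul0r !addr0.
Qed.

Lemma bos_comm b c u v f : bos b u (bos c v f) = bos c v (bos b u f) +
  ((u == v) && (b != c))%:R *: ((-1) ^+ b *: f).
Proof.
apply/ffunP => d; rewrite !fockE' /= !scalerA.
have [<-|uv] := eqVneq u v; last first.
  have vu : v != u by rewrite eq_sym.
  by rewrite /= mul0r scale0r addr0 !upd_neq // (upd_comm _ _ _ uv) [X in X *: _]mulrC.
rewrite !updE /=; case: b; case: c; rewrite /= ?mul0r ?scale0r ?addr0 //.
  rewrite bweight_TF bweight_FT !updK ?ord_predK //; try exact: ordSK; try exact: ord_predK.
  by rewrite -surjective_pairing -scalerDl; congr (_ *: _); rewrite -natr1; ring.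
rewrite bweight_TF bweight_FT !updK ?ord_predK //; try exact: ordSK; try exact: ord_predK.
by rewrite -surjective_pairing -scalerDl; congr (_ *: _); rewrite -natr1; ring.
Qed.

Lemma jw_upd u v S : jw_sign u (upd v negb S) =
  (-1) ^+ (enum_rank v < enum_rank u)%N * jw_sign u S.
Proof.
rewrite /jw_sign; have [lt_vu|ge_vu] := boolP (enum_rank v < enum_rank u)%N.
  rewrite (bigD1 v) //= [in RHS](bigD1 v) //= updE mulrA; congr (_ * _).
    by case: (S v); rewrite /= ?expr0 ?expr1 ?mulN1r ?mulr1 ?opprK.
  by apply: eq_bigr => w /andP[_ wv]; rewrite upd_neq.
rewrite mul1r; apply: eq_bigr => w lt_wu; rewrite upd_neq //.
by apply: contraTneq lt_wu => ->.
Qed.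

Lemma jw_sq u S : jw_sign u S * jw_sign u S = 1.
Proof.
rewrite /jw_sign -big_split big1 //= => v _.
by case: (S v); rewrite /= ?expr1 ?expr0 ?mulr1 // mulN1r opprK.
Qed.

Lemma fer_comm b c u v f : fer b u (fer c v f) = - fer c v (fer b u f) +
  ((u == v) && (b != c))%:R *: f.
Proof.
apply/ffunP => d; rewrite !fockE' /= !scalerA.
have [<-|uv] := eqVneq u v.
  rewrite !updE /= !jw_upd ltnn expr0 !mul1r updK; last exact: negbK.
  rewrite -surjective_pairing -scaleNr -scalerDl !mulrA.
  have sg x y : x * jw_sign u d.2 * y * jw_sign u d.2 = x * y.
    by transitivity (x * y * (jw_sign u d.2 * jw_sign u d.2)); [ring | rewrite jw_sq mulr1].
  rewrite !sg; congr (_ *: _).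
  by case: b; case: c; case: (d.2 u); rewrite /= ?(mulr0, mul0r, mulr1, oppr0, addr0, add0r, subrr, addNr, mul1r) //; rewrite ?addNr //.
have vu : v != u by rewrite eq_sym.
rewrite /= scale0r addr0 !upd_neq // (upd_comm _ _ _ uv) !jw_upd -scaleNr; congr (_ *: _).
have : enum_rank u != enum_rank v by rewrite (inj_eq enum_rank_inj).
rewrite -val_eqE neq_ltn; case: ltngtP => //= _ _; rewrite expr0 expr1; ring.
Qed.

Lemma bos_fer b c u v f : bos b u (fer c v f) = fer c v (bos b u f).
Proof. by apply/ffunP => d; rewrite !fockE' /= !scalerA mulrC. Qed.

Definition zop b (I : 'I_(n + n)) (a : 'I_n) : fock -> fock :=
  match split I with inl i => bos b (i, a) | inr i => fer b (i, a) end.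

Lemma zop_lin b I a : linear (zop b I a).
Proof. by rewrite /zop; case: split => i; apply: wop_lin. Qed.

Lemma zop_comm b c I a K e f : zop b I a (zop c K e f) =
  (-1) ^+ (ipar I && ipar K) *: zop c K e (zop b I a f) +
  (((I, a) == (K, e)) && (b != c))%:R *: ((-1) ^+ (b && ~~ ipar I) *: f).
Proof.
rewrite -(splitK I) -(splitK K) /zop /ipar !unsplitK !xpair_eqE (can_eq unsplitK).
case: (split I) => i; case: (split K) => j /=.
- by rewrite scale1r andbT bos_comm xpair_eqE.
- by rewrite scale1r scale0r addr0 bos_fer.
- by rewrite scale1r scale0r addr0 bos_fer.
by rewrite expr1 scaleN1r andbF scale1r fer_comm xpair_eqE.
Qed.

Lemma zd_bos i a f d : zd zop (lshift n i) (lshift n i) a f d =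
  ((d.1 (i, a))%:R + shift_t (i, a)) *: f d.
Proof.
rewrite /zd /zop -[lshift n i]/(unsplit (inl i)) unsplitK !fockE' /= scalerA updE /=.
move: (bweight_TF (i, a) (d.1 (i, a))) => /= ->.
by rewrite updK -?surjective_pairing //; apply: ord_predK.
Qed.

Lemma zd_fer i a f d : zd zop (rshift n i) (rshift n i) a f d = (d.2 (i, a))%:R *: f d.
Proof.
rewrite /zd /zop -[rshift n i]/(unsplit (inr i)) unsplitK !fockE' /= scalerA updE.
rewrite jw_upd ltnn mul1r updK -?surjective_pairing; last exact: negbK.
by congr (_ *: _); case: (d.2 _); rewrite /= ?mul0r // !mul1r jw_sq.
Qed.

(** Off the diagonal, [m] applications leave zero coefficients at the first [m] occupation numbers
    for x and at the last [m] for d/dx; [p] applications leave nothing. *)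
Lemma bos_iter b u f : u.1 != u.2 -> iter p (bos b u) f = 0.
Proof.
move=> nd; have nd' := negPf nd.
suff key m d : (if b then d.1 u < m else p - m <= d.1 u)%N -> iter m (bos b u) f d = 0.
  apply/ffunP => d; rewrite [RHS]ffunE; apply: key.
  by rewrite subnn; case: b.
elim: m d => [|m IH] d.
  by case: b; rewrite // subn0 leqNgt ltn_ord.
rewrite iterS !fockE' /= /bweight /shift_t nd' => H.
case: b IH H => IH H.
  have [_|d0] := eqVneq (d.1 u : nat) 0%N; first by rewrite /= scale0r.
  rewrite IH ?scaler0 //= updE /=; have := ltn_ord (d.1 u).
  by case: (d.1 u : nat) d0 H => //= x _ xm xp; rewrite modnDr modn_small // ltnW.
rewrite addr0; have [lt_p|] := boolP ((d.1 u).+1 < p)%N.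
  by rewrite IH ?scaler0 //= updE /= modn_small //; lia.
rewrite -leqNgt => le_p; have -> : (d.1 u).+1 = p by apply/eqP; rewrite eqn_leq ltn_ord.
by rewrite natp0 scale0r.
Qed.

End Fock.

(** Additivity of Frobenius in the polynomial ring acting through the commuting operators. *)
Lemma iter_sum_comm (k : fieldType) (M : lmodType k) N (z : 'I_N -> M -> M) p x :
  p \in [pchar k] -> (forall i, linear (z i)) ->
  (forall i j y, z i (z j y) = z j (z i y)) ->
  iter p (fun y => \sum_i z i y) x = \sum_i iter p (z i) x.
Proof.
move=> charp z_lin z_comm.
have charP : p \in [pchar {mpoly k[N]}] := rmorph_pchar (@mpolyC N k) charp.
have iterX (P : {mpoly k[N]}) (h : M -> M) m :
    (forall y, h y = mpact z P y) -> iter m h x = mpact z (P ^+ m) x.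
  move=> hE; elim: m => [|m IH]; first by rewrite expr0 -mpolyC1 mpactC scale1r.
  by rewrite iterS IH hE mpactA // exprS.
have sumP (P : 'I_N -> {mpoly k[N]}) y : mpact z (\sum_i P i) y = \sum_i mpact z (P i) y.
  have := @mpact_suml k M N z _ (index_enum 'I_N) (fun=> 1) P y.
  by under eq_bigr do rewrite scale1r; under [RHS]eq_bigr do rewrite scale1r.
rewrite (iterX (\sum_i 'X_i)) => [|y]; last first.
  by rewrite sumP; apply: eq_bigr => i _; rewrite mpactXi.
rewrite -(pFrobenius_autE charP) rmorph_sum sumP; apply: eq_bigr => i _.
by rewrite /= pFrobenius_autE -(iterX _ (z i)) // => y; rewrite mpactXi.
Qed.

Lemma iter_comp_comm (T : Type) (A B : T -> T) m x : (forall y, A (B y) = B (A y)) ->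
  iter m (fun y => A (B y)) x = iter m A (iter m B x).
Proof.
move=> AB; elim: m x => // m IH x; rewrite iterSr IH.
have -> : iter m B (A (B x)) = A (iter m B (B x)).
  by elim: (m) => // r IHr; rewrite !iterS IHr AB.
by rewrite [in RHS]iterSr [iter m.+1 B x]iterSr.
Qed.

(** * Restriction of the Fock module to both algebras *)

Section FockRep.
Variables (k : fieldType) (p n : nat) (q : bool).
Hypothesis charp : p \in [pchar k].
Hypothesis p_odd : odd p.
Variable t : 'I_n -> k.
Notation F := (fock k p n).
Notation Z := (@zop k p n t).
Notation R := (fockR Z).
Notation zc := (@zop_comm k p n charp t).
Notation zl := (@zop_lin k p n t).

Lemma fockR_diag A D (f : F) : R (block_mx A 0 0 D) f =
  \sum_i \sum_j A i j *: fockE Z (lshift n i) (lshift n j) f +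
  \sum_i \sum_j D i j *: fockE Z (rshift n i) (rshift n j) f.
Proof.
rewrite /fockR big_split_ord /=; congr (_ + _); apply: eq_bigr => i _.
  rewrite big_split_ord /= [X in _ + X]big1 => [|j _].
    by rewrite addr0; apply: eq_bigr => j _; rewrite block_mxEul.
  by rewrite block_mxEur mxE scale0r.
rewrite big_split_ord /= big1 => [|j _].
  by rewrite add0r; apply: eq_bigr => j _; rewrite block_mxEdr.
by rewrite block_mxEdl mxE scale0r.
Qed.

(** The lower right block of [evA q] at E_ij is E_ij in the queer case and - E_ji in the periplectic
    one; [rsgn] and [ri] record the sign and the order of indices. *)
Definition rsgn : k := if q then 1 else -1.
Definition ri (i j : 'I_n) := if q then i else j.

Lemma fockR_eop i j (f : F) : R (evA q (delta_mx i j)) f =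
  fockE Z (lshift n i) (lshift n j) f +
  rsgn *: fockE Z (rshift n (ri i j)) (rshift n (ri j i)) f.
Proof.
have dsum (G : 'I_n -> 'I_n -> F) a b :
    \sum_i \sum_j (delta_mx a b : 'M[k]_n) i j *: G i j = G a b.
  rewrite (bigD1 a) //= (bigD1 b) //= mxE !eqxx scale1r !big1 ?addr0 // => c ca.
    by rewrite big1 // => d _; rewrite mxE (negPf ca) scale0r.
  by rewrite mxE (negPf ca) andbF scale0r.
rewrite fockR_diag dsum; congr (_ + _); rewrite /rsgn /ri /tau; case: q.
  by rewrite dsum scale1r.
rewrite trmx_delta scaleN1r -[X in _ = - X](dsum (fun a b => fockE Z (rshift n a) (rshift n b) f)).
rewrite -sumrN; apply: eq_bigr => a _; rewrite -sumrN; apply: eq_bigr => b _.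
by rewrite mxE scaleNr.
Qed.

(** The operator is a sum of commuting terms, so each is raised to the power [p] separately. A
    fermionic term squares to zero. In a bosonic one the modes (i, a) and (j, a) are not both
    diagonal, and the factor of an off-diagonal mode has zero p-th power. *)
Lemma fockR_nil i j (f : F) : i != j -> iter p (R (evA q (delta_mx i j))) f = 0.
Proof.
move=> ij; have p_pr := pcharf_prime charp.
have rij : ri i j != ri j i by rewrite /ri; case: q; rewrite // eq_sym.
(* The [n] bosonic and [n] fermionic terms share one index set, as [iter_sum_comm] requires. *)
pose c0 x := if @split n n x is inl _ then 1 else rsgn.
pose I0 x := match @split n n x with inl _ => lshift n i | inr _ => rshift n (ri i j) end.
pose J0 x := match @split n n x with inl _ => lshift n j | inr _ => rshift n (ri j i) end.
pose a0 x := match @split n n x with inl a => a | inr a => a end.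
pose z x (g : F) := c0 x *: zd Z (I0 x) (J0 x) (a0 x) g.
have RE g : R (evA q (delta_mx i j)) g = \sum_x z x g.
  rewrite fockR_eop big_split_ord /fockE scaler_sumr; congr (_ + _); apply: eq_bigr => a _.
    by rewrite /z /c0 /I0 /J0 /a0 -[lshift n a]/(unsplit (inl a)) unsplitK scale1r.
  by rewrite /z /c0 /I0 /J0 /a0 -[rshift n a]/(unsplit (inr a)) unsplitK.
have zdl I J a := zd_lin zl I J a.
have z_lin x : linear (z x).
  by move=> c g h; rewrite /z zdl scalerDr !scalerA mulrC.
have ij' : (j == i) = false by rewrite eq_sym; apply/negbTE.
have rij' : (ri j i == ri i j) = false by rewrite eq_sym; apply/negbTE.
(* As [i] and [j] differ, no annihilated index is ever a created one, so all brackets of the terms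
   vanish. *)
have neIJ x y : (J0 x == I0 y) = false.
  rewrite /I0 /J0; case: (split x) => _; case: (split y) => _.
  - by rewrite (inj_eq (@lshift_inj _ _)).
  - by rewrite eq_lrshift.
  - by rewrite eq_rlshift.
  by rewrite (inj_eq (@rshift_inj _ _)).
have parIJ x : ipar (I0 x) (+) ipar (J0 x) = false.
  by rewrite /I0 /J0 /ipar; case: (split x) => _;
     rewrite -?[lshift n _]/(unsplit (inl _)) -?[rshift n _]/(unsplit (inr _)) !unsplitK.
have z_comm x y g : z x (z y g) = z y (z x g).
  rewrite /z !(plinZ (zdl _ _ _)) (zd_comm zl zc) !neIJ !parIJ /= !scale0r scaler0 subr0 addr0.
  by rewrite expr0 scale1r !scalerA mulrC.
rewrite (eq_iter RE) (iter_sum_comm _ charp z_lin z_comm) big1 // => x _.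
have -> m : iter m (z x) f = (c0 x) ^+ m *: iter m (zd Z (I0 x) (J0 x) (a0 x)) f.
  elim: m => [|m IH]; first by rewrite expr0 scale1r.
  by rewrite !iterS IH /z (plinZ (zdl _ _ _)) scalerA exprS mulrC.
suff -> : iter p (zd Z (I0 x) (J0 x) (a0 x)) f = 0 by rewrite scaler0.
have Z0 b I a : Z b I a 0 = 0 by apply: plin0 (zl b I a).
rewrite /I0 /J0 /a0; case: (split x) => a.
  have cm b c u v (g : F) : u != v -> bos t b u (bos t c v g) = bos t c v (bos t b u g).
    by move=> uv; rewrite bos_comm // (negPf uv) scale0r addr0.
  have ne : (i, a) != (j, a) by rewrite xpair_eqE (negPf ij).
  have zE g : zd Z (lshift n i) (lshift n j) a g = bos t true (i, a) (bos t false (j, a) g).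
    by rewrite /zd /zop -[lshift n i]/(unsplit (inl i)) -[lshift n j]/(unsplit (inl j)) !unsplitK.
  rewrite (eq_iter zE); set A := bos t true (i, a); set B := bos t false (j, a).
  have AB g : A (B g) = B (A g) by apply: cm.
  have [ai|ai] := eqVneq a i; last first.
    by rewrite iter_comp_comm // (bos_iter charp) //= eq_sym.
  rewrite (eq_iter AB) (iter_comp_comm _ _ (fun y => esym (AB y))).
  by apply: (bos_iter charp); rewrite /= ai eq_sym.
have zE g : zd Z (rshift n (ri i j)) (rshift n (ri j i)) a g =
   fer true (ri i j, a) (fer false (ri j i, a) g).
  by rewrite /zd /zop -[rshift n (ri i j)]/(unsplit (inr (ri i j)))
    -[rshift n (ri j i)]/(unsplit (inr (ri j i))) !unsplitK.
rewrite (eq_iter zE); set A := fer true _; set B := fer false _.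
have sq : A (B (A (B f))) = 0.
  have -> : A (B (A (B f))) = - A (A (B (B f))).
    rewrite {1}/B fer_comm -/B xpair_eqE [ri j i == _]rij' scale0r addr0.
    have A_lin : linear A := wop_lin _ _.
    by rewrite -scaleN1r (plinZ A_lin) scaleN1r.
  have -> : A (A (B (B f))) = 0; last by rewrite oppr0.
  have /eqP := fer_comm true true (ri i j, a) (ri i j, a) (B (B f)).
  rewrite -/A andbF scale0r addr0 -addr_eq0 -mulr2n -scaler_nat scaler_eq0.
  by rewrite (negPf (two_neq0 charp p_odd)) => /eqP.
have H m : (1 < m)%N -> iter m (fun g => A (B g)) f = 0; last exact: H (prime_gt1 p_pr).
case: m => [|[|m]] // _; rewrite !iterSr sq.
elim: m => // m IH; rewrite iterS IH; have -> : B 0 = 0 by apply: plin0 (wop_lin _ _).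
exact: plin0 (wop_lin _ _).
Qed.

Definition fweight i (d : fstate p n) : k := \sum_a ((d.1 (i, a))%:R + shift_t t (i, a)) +
  rsgn * \sum_a (d.2 (i, a))%:R.

Lemma fockR_diagE i (f : F) d : R (evA q (delta_mx i i)) f d = fweight i d *: f d.
Proof.
have ffsum (G : 'I_n -> F) : (\sum_a G a) d = \sum_a G a d.
  by rewrite sum_ffunE.
rewrite fockR_eop /ri; have -> : (if q then i else i) = i by case: q.
rewrite ffunE ffunE /fockE !ffsum /fweight scalerDl scaler_suml -scalerA scaler_suml.
by congr (_ + _ *: _); apply: eq_bigr => a _; [apply: (zd_bos charp) | apply: zd_fer].
Qed.

(** Frobenius fixes the occupation numbers and the sign; only the shift t_i moves. *)
Lemma fweightX i d : fweight i d ^+ p = fweight i d + (t i ^+ p - t i).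
Proof.
rewrite -(pFrobenius_autE charp) /fweight rmorphD rmorphM !rmorph_sum /=.
have -> : pFrobenius_aut charp rsgn = rsgn.
  by rewrite /rsgn; case: q; rewrite ?rmorphN1 ?rmorph1.
under eq_bigr => a _ do rewrite rmorphD /= rmorph_nat.
under [X in _ + _ * X]eq_bigr => a _ do rewrite rmorph_nat.
have tsum (h : k -> k) : h 0 = 0 -> \sum_a h (shift_t t (i, a)) = h (t i).
  move=> h0; rewrite (bigD1 i) //= /shift_t /= eqxx big1 ?addr0 // => a ai.
  by rewrite eq_sym (negPf ai).
have tE : \sum_a shift_t t (i, a) = t i := tsum id erefl.
rewrite !big_split /= tE (tsum (pFrobenius_aut charp)) ?rmorph0 // pFrobenius_autE.
by ring.
Qed.

Lemma fockR_tor i (f : F) : iter p (R (evA q (delta_mx i i))) f =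
  R (evA q (delta_mx i i)) f + (t i ^+ p - t i) *: f.
Proof.
apply/ffunP => d.
have -> m : iter m (R (evA q (delta_mx i i))) f d = fweight i d ^+ m *: f d.
  elim: m => [|m IH]; first by rewrite expr0 scale1r.
  by rewrite iterS fockR_diagE IH scalerA exprS.
rewrite fock_add fock_scale fockR_diagE fweightX; exact: scalerDl.
Qed.

(** Two copies of the Fock space, graded by the copy alone: even elements preserve the copies and
    odd ones exchange them, so [fock] itself need not be split by parity. *)
Definition fop (X : 'M[k]_(n + n)) (v : F * F) : F * F :=
  (R (hpart false X) v.1 + R (hpart true X) v.2, R (hpart false X) v.2 + R (hpart true X) v.1).

Lemma fop_rep : srep (gfam k n q) fop.
Proof.
have R0 v : R 0 v = 0 := plin0 (fockR_linl Z v).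
have Rv0 X : R X 0 = 0 := plin0 (fockR_linr zl X).
have hp a X b : X \in gl_part k n a -> hpart b X = if b == a then X else 0.
  by move=> /gl_partP XE; rewrite -[in LHS]XE hpart_hpart XE.
split.
- move=> v c X Y; rewrite /fop !linearP /= !(fockR_linl Z).
  by congr pair; rewrite /= scalerDr addrACA.
- move=> X c u v; rewrite /fop /= !(fockR_linr zl).
  by congr pair; rewrite /= scalerDr addrACA.
- move=> a b X [v0 v1] _ Xa; rewrite /homogeneous /fop !(hp a) //.
  by case: a {Xa}; case: b => /= ->; rewrite !(R0, Rv0, addr0).
move=> a b X Y v _ _ Xa Yb; have XYab := gl_part_bracket Xa Yb.
rewrite /fop !(hp _ _ _ Xa) !(hp _ _ _ Yb) !(hp _ _ _ XYab).
have br := fockR_bracket zl zc _ Xa Yb.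
by case: a b {Xa Yb XYab} br => -[] br; rewrite /= !(R0, add0r, addr0) !br.
Qed.

Lemma fop_evA A v : fop (evA q A) v = (R (evA q A) v.1, R (evA q A) v.2).
Proof.
have /gl_partP E := evA_even q A; have R0 f : R 0 f = 0 := plin0 (fockR_linl Z f).
by rewrite /fop E (_ : hpart true (evA q A) = 0) ?R0 ?addr0 // -E hpart_hpart.
Qed.

Lemma iter_fop A m v : iter m (fop (evA q A)) v =
  (iter m (R (evA q A)) v.1, iter m (R (evA q A)) v.2).
Proof. by elim: m => [|m IH]; [case: v | rewrite !iterS IH fop_evA]. Qed.

Lemma fop_nil i j v : i != j -> iter p (eop q fop i j) v = 0.
Proof. by move=> ij; rewrite iter_fop !fockR_nil. Qed.

Lemma fop_tor i v : iter p (eop q fop i i) v = eop q fop i i v + (t i ^+ p - t i) *: v.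
Proof. by rewrite iter_fop !fockR_tor /eop fop_evA. Qed.

End FockRep.

(** * Irreducible submodules of a finite-dimensional representation *)

(** A subspace inside [P] is enlarged by one vector at a time until it fills [P]; the ambient
    dimension stops the process. *)
Lemma prop_vspace (k : fieldType) (F : vectType k) (P : F -> Prop) :
  P 0 -> (forall c u v, P u -> P v -> P (c *: u + v)) ->
  exists U : {vspace F}, forall u, u \in U <-> P u.
Proof.
move=> P0 Pl; have claim m : exists U : {vspace F}, (forall u, u \in U -> P u) /\
    ((m <= \dim U)%N \/ forall u, P u -> u \in U).
  elim: m => [|m [U [UP mU]]].
    by exists 0%VS; split=> [u|]; [rewrite memv0 => /eqP -> | left].
  have [PU|/not_all_ex_not[u]] := classic (forall u, P u -> u \in U).
    by exists U; split=> //; right.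
  move=> nu; have Pu : P u by apply: NNPP => nPu; apply: nu => /nPu.
  have uU : u \notin U by apply/negP => uU; apply: nu.
  case: mU => [mU|PU]; last by case: nu; apply: PU.
  exists (U + <[u]>)%VS; split.
    move=> x /memv_addP[y yU [z /vlineP[c ->] ->]]; rewrite addrC.
    exact: Pl Pu (UP _ yU).
  left; apply: leq_ltn_trans mU _; rewrite (ltn_leqif (dimv_leqif_sup (addvSl _ _))).
  by apply: contra uU => /subvP; apply; rewrite (subvP (addvSr _ _)) ?memv_line.
have [U [UP [lt_dim|PU]]] := claim (\dim {:F}).+1; last by exists U => u; split; auto.
by have := dimvS (subvf U); rewrite leqNgt lt_dim.
Qed.

Section IrreducibleSub.
Variables (k : fieldType) (n : nat) (g : {vspace 'M[k]_(n + n)}) (F : vectType k).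
Variable op : 'M[k]_(n + n) -> F * F -> F * F.
Hypothesis op_rep : srep g op.

Definition stable2 (W0 W1 : {vspace F}) := forall x v, x \in g ->
  v.1 \in W0 -> v.2 \in W1 -> (op x v).1 \in W0 /\ (op x v).2 \in W1.

(** Descent on the total dimension of the two components. *)
Lemma minimal_stable : (exists v : F, v != 0) -> exists W0 W1 : {vspace F},
  [/\ stable2 W0 W1, (0 < \dim W0 + \dim W1)%N &
   forall U0 U1, stable2 U0 U1 -> (0 < \dim U0 + \dim U1)%N ->
     (U0 <= W0)%VS -> (U1 <= W1)%VS -> U0 = W0 /\ U1 = W1].
Proof.
move=> [v v0]; have dF : (0 < \dim {:F} + \dim {:F})%N.
  rewrite addn_gt0 lt0n dimv_eq0 orbb; apply: contra v0 => /eqP F0.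
  by rewrite -memv0 -F0 memvf.
have stF : stable2 fullv fullv by move=> *; rewrite !memvf.
suff H m (W0 W1 : {vspace F}) : stable2 W0 W1 -> (0 < \dim W0 + \dim W1)%N ->
  (\dim W0 + \dim W1 < m)%N -> exists W0 W1 : {vspace F},
  [/\ stable2 W0 W1, (0 < \dim W0 + \dim W1)%N &
   forall U0 U1, stable2 U0 U1 -> (0 < \dim U0 + \dim U1)%N ->
     (U0 <= W0)%VS -> (U1 <= W1)%VS -> U0 = W0 /\ U1 = W1].
  exact: H stF dF (ltnSn _).
elim: m W0 W1 => // m IH W0 W1 stW dW lt_m.
have [min|/not_all_ex_not[U0 /not_all_ex_not[U1 nU]]] := classic (forall U0 U1,
  stable2 U0 U1 -> (0 < \dim U0 + \dim U1)%N ->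
     (U0 <= W0)%VS -> (U1 <= W1)%VS -> U0 = W0 /\ U1 = W1); first by exists W0, W1.
have [stU nU1] := imply_to_and _ _ nU; have [dU nU2] := imply_to_and _ _ nU1.
have [UW0 nU3] := imply_to_and _ _ nU2; have [UW1 ne] := imply_to_and _ _ nU3.
apply: (IH U0 U1 stU dU).
suff lt : (\dim U0 + \dim U1 < \dim W0 + \dim W1)%N by apply: leq_trans lt _.
have [l0 e0] := dimv_leqif_eq UW0; have [l1 e1] := dimv_leqif_eq UW1.
rewrite ltn_neqAle leq_add // andbT; apply/negP => /eqP E; apply: ne.
have E0 : \dim U0 = \dim W0 by lia.
have E1 : \dim U1 = \dim W1 by lia.
by split; apply/eqP; [rewrite -e0 E0 | rewrite -e1 E1].
Qed.

Variables W0 W1 : {vspace F}.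
Hypothesis stW : stable2 W0 W1.

Definition sub_in (v : subvs_of W0 * subvs_of W1) : F * F := (vsval v.1, vsval v.2).
Definition sub_act (x : subvs_of g) v : subvs_of W0 * subvs_of W1 :=
  (vsproj W0 (op (vsval x) (sub_in v)).1, vsproj W1 (op (vsval x) (sub_in v)).2).

Lemma sub_in_lin : linear sub_in.
Proof. by move=> c [u0 u1] [v0 v1]; congr pair; apply: linearP. Qed.

Lemma sub_in_inj : injective sub_in.
Proof. by move=> [u0 u1] [v0 v1] [/subvs_inj -> /subvs_inj ->]. Qed.

Lemma sub_actE x v : sub_in (sub_act x v) = op (vsval x) (sub_in v).
Proof.
have [h0 h1] := stW (subvsP x) (subvsP v.1 : (sub_in v).1 \in W0) (subvsP v.2).
by rewrite /sub_in /= !vsprojK // -surjective_pairing.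
Qed.

Lemma sub_homog b v : homogeneous b (sub_in v) <-> homogeneous b v.
Proof.
rewrite /homogeneous /sub_in; case: b => /=; split=> [|->]; rewrite ?linear0 //;
  by move=> E; apply: subvs_inj; rewrite E linear0.
Qed.

Fact sub_act_linear_l v : linear (sub_act^~ v).
Proof.
move=> c x y; apply: sub_in_inj.
by rewrite sub_in_lin !sub_actE linearP (srep_linl op_rep).
Qed.

Fact sub_act_linear_r x : linear (sub_act x).
Proof. by move=> c u v; apply: sub_in_inj; rewrite sub_in_lin !sub_actE sub_in_lin (srep_lin op_rep). Qed.

Fact sub_act_parity (a b : bool) (x : subvs_of g) v :
  vsval x \in gl_part k n a -> homogeneous b v -> homogeneous (a (+) b) (sub_act x v).
Proof.
by move=> xa hv; apply/sub_homog; rewrite sub_actE;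
  apply: (srep_par op_rep) (subvsP x) xa _; apply/sub_homog.
Qed.

Hypothesis g_lie : lie_subsuperalgebra g.

Fact sub_act_bracket (a b : bool) (x y : subvs_of g) v :
  vsval x \in gl_part k n a -> vsval y \in gl_part k n b ->
  sub_act (vsproj g (superbracket (vsval x) (vsval y))) v =
  sub_act x (sub_act y v) - (-1) ^+ (a && b) *: sub_act y (sub_act x v).
Proof.
move=> xa yb; apply: sub_in_inj; rewrite (plinB sub_in_lin) (plinZ sub_in_lin) !sub_actE.
by rewrite vsprojK ?(srep_bracket op_rep _ _ _ xa yb) ?subvsP //; apply: g_lie.2; apply: subvsP.
Qed.

Definition sub_module : supermodule g :=
  Supermodule sub_act_linear_l sub_act_linear_r sub_act_parity sub_act_bracket.

Hypothesis dimW : (0 < \dim W0 + \dim W1)%N.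
Hypothesis minW : forall U0 U1, stable2 U0 U1 -> (0 < \dim U0 + \dim U1)%N ->
     (U0 <= W0)%VS -> (U1 <= W1)%VS -> U0 = W0 /\ U1 = W1.

(** The even and odd parts of a nonzero graded submodule form a stable pair inside the minimal pair,
    hence equal it. *)
Lemma sub_irreducible : irreducible sub_module.
Proof.
split.
  have nz (W : {vspace F}) : (0 < \dim W)%N -> vsproj W (vpick W) <> 0.
    move=> dW E; have : vpick W != 0 by rewrite vpick0 -dimv_eq0 -lt0n.
    by rewrite -(vsprojK (memv_pick W)) E linear0 eqxx.
  have [dW0|] := posnP (\dim W0); last by move=> /nz ne; exists (vsproj W0 (vpick W0), 0) => -[].
  have /nz ne : (0 < \dim W1)%N by have := dimW; rewrite dW0.
  by exists (0, vsproj W1 (vpick W1)) => -[].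
move=> W [W00 Wl Wg Wst].
have [all0|/not_all_ex_not[v nv]] := classic (forall v, W v -> v = 0); first by left.
right; have [Wv v0] := imply_to_and _ _ nv.
have [|c u u' [s [<- Ws]] [s' [<- Ws']]|U0 U0P] :=
    @prop_vspace k F (fun u => exists s : subvs_of W0, vsval s = u /\ W (s, 0)).
- by exists 0; split=> //; rewrite linear0.
- exists (c *: s + s'); split; first by rewrite linearP.
  by have := Wl c _ _ Ws Ws'; congr W; congr pair; rewrite /= scaler0 addr0.
have [|c u u' [s [<- Ws]] [s' [<- Ws']]|U1 U1P] :=
    @prop_vspace k F (fun u => exists s : subvs_of W1, vsval s = u /\ W (0, s)).
- by exists 0; split=> //; rewrite linear0.
- exists (c *: s + s'); split; first by rewrite linearP.
  by have := Wl c _ _ Ws Ws'; congr W; congr pair; rewrite /= scaler0 addr0.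
have Wpair s0 s1 : W (s0, 0) -> W (0, s1) -> W (s0, s1).
  move=> h0 h1; have := Wl 1 _ _ h0 h1; congr W.
  by congr pair; rewrite /= scale1r ?addr0 ?add0r.
have UW0 : (U0 <= W0)%VS by apply/subvP => u /U0P[s [<- _]]; apply: subvsP.
have UW1 : (U1 <= W1)%VS by apply/subvP => u /U1P[s [<- _]]; apply: subvsP.
have stU : stable2 U0 U1.
  move=> x [u0 u1] xg /= /U0P[s0 [<- Ws0]] /U1P[s1 [<- Ws1]].
  set y := sub_act (vsproj g x) (s0, s1).
  have /Wg[y0 y1] : W y := Wst (vsproj g x) _ (Wpair _ _ Ws0 Ws1).
  have := sub_actE (vsproj g x) (s0, s1); rewrite -/y vsprojK // => E.
  by rewrite -[(vsval s0, vsval s1)]/(sub_in (s0, s1)) -E; split; [apply/U0P | apply/U1P];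
     eexists; split.
have [|E0 E1] := minW stU _ UW0 UW1.
  rewrite lt0n addn_eq0 !dimv_eq0; apply/negP => /andP[/eqP z0 /eqP z1]; apply: v0.
  have [h0 h1] := Wg _ Wv; have v1U : vsval v.1 \in U0 by apply/U0P; exists v.1.
  have v2U : vsval v.2 \in U1 by apply/U1P; exists v.2.
  apply: sub_in_inj; rewrite z0 memv0 in v1U; rewrite z1 memv0 in v2U.
  by rewrite /sub_in (eqP v1U) (eqP v2U) !linear0.
move=> [s0 s1]; apply: Wpair.
  have /U0P[s [/subvs_inj <- //]] : vsval s0 \in U0 by rewrite E0 subvsP.
by have /U1P[s [/subvs_inj <- //]] : vsval s1 \in U1 by rewrite E1 subvsP.
Qed.

End IrreducibleSub.

Lemma irreducible_sub (k : fieldType) (n : nat) (g : {vspace 'M[k]_(n + n)}) (F : vectType k)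
    (op : 'M[k]_(n + n) -> F * F -> F * F) :
  srep g op -> lie_subsuperalgebra g -> (exists v : F, v != 0) ->
  exists (M : supermodule g) (h : sm_even M * sm_odd M -> F * F),
    [/\ irreducible M, linear h, injective h &
        forall x v, x \in g -> h (@sop k n g M x v) = op x (h v)].
Proof.
move=> op_rep g_lie nz; have [W0 [W1 [stW dW minW]]] := @minimal_stable k n g F op nz.
exists (sub_module op_rep stW g_lie), (@sub_in k F W0 W1); split.
- exact: sub_irreducible.
- exact: sub_in_lin.
- exact: sub_in_inj.
by move=> x v xg; rewrite [LHS](sub_actE stW) vsprojK.
Qed.

(** * Generic parameters and an irreducible module of the maximal dimension *)

(** A root of X times the product of the X - a, plus 1, differs from every [a]; the factor X keeps
    the degree positive for an empty list. *)
Lemma fresh_scalar (k : closedFieldType) (s : seq k) : exists x, x \notin s.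
Proof.
have sz : size (\prod_(a <- s) ('X - a%:P) * 'X) = (size s).+2.
  by rewrite size_mulX ?size_prod_XsubC // -size_poly_eq0 size_prod_XsubC.
have [|x /eqP xE] := @closed_root k (\prod_(a <- s) ('X - a%:P) * 'X + 1).
  by rewrite size_polyDl sz ?size_poly1.
exists x; apply/negP => xs; move/eqP: xE; rewrite hornerD hornerM hornerX hornerC.
have /rootP -> : root (\prod_(a <- s) ('X - a%:P)) x by rewrite root_prod_XsubC.
by rewrite mul0r add0r oner_eq0.
Qed.

(** Each new scalar avoids zero, the previous ones and their opposites; 2 being nonzero handles the
    sums t_i + t_i. *)
Lemma generic_family (k : closedFieldType) (n : nat) : 2%:R != 0 :> k -> exists t : 'I_n -> k,
  (forall i j, i != j -> t i != t j) /\ (forall i j, t i + t j != 0).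
Proof.
move=> two0; have [s [sz us s0]] : exists s : seq k,
    [/\ size s = n, uniq s & forall x y, x \in s -> y \in s -> x + y != 0].
  elim: n => [|n [s [sz us s0]]]; first by exists [::].
  have [x] := fresh_scalar (0 :: s ++ map -%R s).
  rewrite inE mem_cat !negb_or => /and3P[x0 xs nxs]; exists (x :: s); split.
  - by rewrite /= sz.
  - by rewrite /= xs.
  have xy y : y \in s -> x + y != 0.
    by move=> ys; apply: contra nxs; rewrite addr_eq0 => /eqP ->; rewrite map_f.
  move=> y z; rewrite !inE => /predU1P[->|ys] /predU1P[->|zs]; last exact: s0.
  - by rewrite -mulr2n -mulr_natl mulf_neq0.
  - exact: xy.
  by rewrite addrC xy.
exists (fun i => s`_i); split=> [i j ij|i j]; last by rewrite s0 ?mem_nth ?sz.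
by rewrite nth_uniq ?sz.
Qed.

Lemma artin_schreier (k : closedFieldType) p (a : k) : (1 < p)%N -> exists x, x ^+ p - x = a.
Proof.
move=> p1; have [x /eqP xE] : exists x, root ('X^p - ('X + a%:P)) x.
  by apply: closed_root; rewrite size_polyDl ?size_polyN size_polyXn ?size_XaddC ltnS // ltnW.
exists x; apply/eqP; rewrite -subr_eq0 -addrA -opprD; apply/eqP.
by move: xE; rewrite !hornerE.
Qed.

(** Fock parameters solving t^p - t = t' with t' generic give a module on which the p-character is
    regular. An irreducible submodule inherits it, so [lower_q] or [lower_p] bounds its dimension
    from below, and [irreducible_bound] from above. *)
Lemma exists_irreducible (k : closedFieldType) (p n : nat) (q : bool) :
  p \in [pchar k] -> odd p ->
  exists2 M : supermodule (gfam k n q), irreducible M & has_dim M (kwdim p n q).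
Proof.
move=> charp p_odd; have p_pr := pcharf_prime charp.
have [t' [t_inj t_add]] := generic_family n (two_neq0 charp p_odd).
have [t tE] : exists t : 'I_n -> k, forall i, t i ^+ p - t i = t' i.
  exact: fin_all_exists (fun i => artin_schreier (t' i) (prime_gt1 p_pr)).
have nz : exists v : fock k p n, v != 0.
  exists [ffun=> 1]; apply/eqP => /ffunP/(_ ([ffun=> Ordinal (prime_gt0 p_pr)], [ffun=> false])).
  by rewrite !ffunE => /eqP; rewrite oner_eq0.
have [M [h [M_irr h_lin h_inj hE]]] :=
  irreducible_sub (fop_rep q charp t) (gfam_lie k n q) nz.
have hI i j m v : h (iter m (eop q (@sop k n _ M) i j) v) = iter m (eop q (fop t) i j) (h v).
  by elim: m => // m IH; rewrite !iterS hE ?evA_gfam // IH.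
have nil i j v : i != j -> iter p (eop q (@sop k n _ M) i j) v = 0.
  by move=> ij; apply: h_inj; rewrite hI (fop_nil _ charp) // (plin0 h_lin).
have tor i v : iter p (eop q (@sop k n _ M) i i) v = eop q (@sop k n _ M) i i v + t' i *: v.
  apply: h_inj; rewrite hI (fop_tor _ charp) tE (plinD h_lin) (plinZ h_lin).
  by have := hI i i 1%N v; rewrite /= => ->.
have op_rep := sop_rep M; have [b0 [v0 [v00 hv0]]] := irr_homog (irreducible_rep M_irr).
have [J [f [f_ind cJ]]] : exists (J : finType) (f : J -> sm_even M * sm_odd M),
    indep f /\ #|J| = kwdim p n q.
  move: M op_rep v0 v00 hv0 nil tor {h M_irr h_lin h_inj hE hI}.
  case: (q) => M op_rep v0 v00 hv0 nil tor.
    exact (lower_q charp p_odd op_rep t_inj t_add nil tor v00 hv0).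
  exact (lower_p charp p_odd t_inj op_rep nil tor v00 hv0).
have [d hd le_d] := irreducible_bound charp p_odd M_irr.
exists M => //; rewrite (_ : kwdim p n q = d) //; apply/anti_leq.
by rewrite le_d -cJ (indep_has_dim hd f_ind).
Qed.

(** * Stabilizers of forms and the maximum of the Kac-Weisfeiler numbers *)

Lemma dim_le_inj (k : fieldType) (U V : vectType k) (W : {vspace U}) (f : U -> V) :
  linear f -> (forall x, x \in W -> f x = 0 -> x = 0) -> (\dim W <= \dim {:V})%N.
Proof.
move=> f_lin f_inj; pose h : {linear U -> V} := HB.pack f (GRing.isLinear.Build k U V _ f f_lin).
have <- : \dim (linfun h @: W) = \dim W; last exact/dimvS/subvf.
apply: limg_dim_eq; apply/eqP; rewrite -subv0; apply/subvP => x.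
by rewrite memv_cap memv_ker lfunE memv0 => /andP[xW /eqP /f_inj ->].
Qed.

(** Rank-nullity: the conditions [L] cost at most as many dimensions as there are indices. *)
Lemma dim_ge_ker (k : fieldType) (U V : vectType k) (W : {vspace V}) n (I : finType)
    (f : U -> V) (L : U -> {ffun I -> k^o}) : linear f -> injective f -> linear L ->
  \dim {:U} = (n + #|I|)%N -> (forall x, L x = 0 -> f x \in W) -> (n <= \dim W)%N.
Proof.
move=> f_lin f_inj L_lin dU LW.
pose h : {linear U -> V} := HB.pack f (GRing.isLinear.Build k U V _ f f_lin).
pose l : {linear U -> {ffun I -> k^o}} := HB.pack L (GRing.isLinear.Build k U _ _ L L_lin).
have := limg_ker_dim (linfun l) fullv; rewrite capfv dU => E.
have : (\dim (linfun l @: fullv) <= #|I|)%N.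
  by apply: leq_trans (dimvS (subvf _)) _; rewrite dimvf /dim /= muln1.
move=> le_I; apply: (@leq_trans (\dim (lker (linfun l)))); first by lia.
have <- : \dim (linfun h @: lker (linfun l)) = \dim (lker (linfun l)).
  apply: limg_dim_eq; apply/eqP; rewrite -subv0; apply/subvP => x.
  rewrite memv_cap !memv_ker !lfunE /= memv0 => /andP[_ /eqP fx0].
  by apply/eqP/f_inj; rewrite fx0 (plin0 f_lin).
apply/dimvS/subvP => y /memv_imgP[x]; rewrite memv_ker lfunE => /eqP Lx ->.
by rewrite lfunE; apply: LW.
Qed.

Section KWMaximum.
Variables (k : closedFieldType) (p n : nat) (q : bool).
Hypothesis charp : p \in [pchar k].
Hypothesis p_odd : odd p.
Notation g := (gfam k n q).

Lemma dim_mx m : \dim {:'M[k]_m} = (m * m)%N.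
Proof. by rewrite dimvf. Qed.

Lemma tri_double : (n + (tri n + tri n) = n * n)%N.
Proof.
rewrite /tri bin2; case: n => // m; rewrite succnK addnn.
have /even_halfK -> : ~~ odd (m.+1 * m) by rewrite oddM /= andNb.
by rewrite -mulnS.
Qed.

Lemma trace_delta (M : 'M[k]_n) i j : \tr (M *m delta_mx j i) = M i j.
Proof.
rewrite /mxtrace (bigD1 i) //= mxE (bigD1 j) //= !mxE !eqxx mulr1 !big1 ?addr0 // => l.
  by move=> li; rewrite mxE big1 // => m _; rewrite mxE (negPf li) andbF mulr0.
by move=> lj; rewrite mxE (negPf lj) mulr0.
Qed.

Lemma gfam_oddP X : X \in g -> X \in gl_part k n true -> exists B C : 'M[k]_n,
  X = block_mx 0 B C 0 /\ if q then C = B else B = B^T /\ C = - C^T.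
Proof.
rewrite /gfam => Xg /gl_partP; rewrite /hpart.
case: q Xg => [/queerP[A [B ->]]|/periplecticP[A [B [C [-> BE CE]]]]].
  by rewrite block_mxKur block_mxKdl => <-; exists B, B.
by rewrite block_mxKur block_mxKdl => <-; exists B, C.
Qed.

Lemma extend_form_evA theta : exists T, forall A,
  extend_form (g := g) theta (evA q A) = \tr (T *m A).
Proof.
exists (\matrix_(i, j) extend_form theta (evA q (delta_mx j i))) => A.
pose f A : k^o := extend_form theta (evA q A).
have f_lin : linear f by move=> c B C; rewrite /f evA_lin extend_form_is_linear.
rewrite -[LHS]/(f A) [A in LHS]matrix_sum_delta (plin_sum f_lin) /mxtrace.
under eq_bigr => i _ do rewrite (plin_sum f_lin).
rewrite exchange_big; apply: eq_bigr => i _; rewrite mxE; apply: eq_bigr => j _.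
by rewrite (plinZ f_lin) mxE mulrC.
Qed.

Lemma extend_form_onto T : exists theta : even_dual g, forall A,
  extend_form theta (evA q A) = \tr (T *m A).
Proof.
pose W := (g :&: gl_part k n false)%VS.
pose f (u : subvs_of W) : k^o := \tr (T *m ulsubmx (vsval u)).
have f_lin : linear f.
  move=> c u v; rewrite /f linearP (_ : ulsubmx _ = c *: ulsubmx (vsval u) + ulsubmx (vsval v)).
    by rewrite mulmxDr -scalemxAr !linearP.
  by apply/matrixP => i j; rewrite !mxE.
pose h : {linear subvs_of W -> k^o} := HB.pack f (GRing.isLinear.Build k _ _ _ f f_lin).
exists (linfun h) => A; have /gl_partP E := evA_even q A.
by rewrite /extend_form E lfunE /= /f vsprojK ?block_mxKul // memv_cap evA_gfam evA_even.
Qed.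

Section Form.
Variables (theta : even_dual g) (T : 'M[k]_n).
Hypothesis thetaE : forall A, extend_form theta (evA q A) = \tr (T *m A).
Notation cent := (centralizer theta).

Lemma extend_form_odd X : X \in gl_part k n true -> extend_form theta X = 0.
Proof. by move=> /gl_partP <-; rewrite /extend_form hpart_hpart !linear0. Qed.

(** The extended form vanishes on odd elements, so the bracket of [X] with the component of opposite
    parity contributes nothing. *)
Lemma centralizer_hom b X : X \in g -> X \in gl_part k n b ->
  (forall Y, Y \in g -> Y \in gl_part k n b -> extend_form theta (superbracket X Y) = 0) ->
  X \in (cent :&: gl_part k n b)%VS.
Proof.
move=> Xg Xb XY; rewrite memv_cap Xb andbT; apply/centralizerP; split=> // Y Yg.
have Yh c : hpart c Y \in g by apply: (gfam_lie k n q).1.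
rewrite (hpartD Y) linearD (plinD (extend_form_is_linear theta)).
have E c : extend_form theta (superbracket X (hpart c Y)) = 0.
  have [->|cb] := eqVneq c b; first by apply: XY; rewrite ?Yh ?gl_part_hpart.
  apply: extend_form_odd; have := gl_part_bracket Xb (gl_part_hpart c Y).
  by have -> : b (+) c = true by apply/eqP; rewrite eqb_id addbC -negb_eqb.
by rewrite !E addr0.
Qed.

Lemma evA_bracket (A B : 'M[k]_n) : superbracket (evA q A) (evA q B) = evA q (A *m B - B *m A).
Proof. by rewrite (superbracket_even (evA_even q A) (evA_even q B)) evA_br. Qed.

Lemma trace_bracket (A B : 'M[k]_n) : \tr (T *m (A *m B - B *m A)) = \tr ((T *m A - A *m T) *m B).
Proof.
rewrite mulmxBr mulmxBl !linearB /= !mulmxA; congr (_ - _).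
by rewrite mxtrace_mulC mulmxA.
Qed.

(** In a basis where [T] is lower triangular, require [A] to be lower triangular and [T, A] to have
    no strictly lower entries: n(n-1) linear conditions. The diagonal of [T, A] is then zero
    automatically, so [A] commutes with [T], and dimension at least [n] remains. *)
Lemma dim_cent_even : (n <= \dim (cent :&: gl_part k n false))%N.
Proof.
have [P [Pu low]] := triangularize T.
pose L (A : 'M[k]_n) : {ffun npair n + npair n -> k^o} := [ffun x => match x with
  | inl x => (P *m A *m invmx P) (val x).2 (val x).1
  | inr x => (P *m (T *m A - A *m T) *m invmx P) (val x).1 (val x).2 end].
apply: (@dim_ge_ker k _ _ _ n _ (evA q) L); first exact: evA_lin.
- by move=> A B /(congr1 ulsubmx); rewrite !block_mxKul.
- move=> c A B; apply/ffunP => -[x|x]; rewrite !ffunE.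
    by rewrite mulmxDr -scalemxAr mulmxDl -scalemxAl !mxE.
  rewrite (_ : T *m _ - _ = c *: (T *m A - A *m T) + (T *m B - B *m T)).
    by rewrite mulmxDr -scalemxAr mulmxDl -scalemxAl !mxE.
  by rewrite mulmxDr mulmxDl -scalemxAr -scalemxAl scalerBr opprD addrACA.
- by rewrite dim_mx card_sum card_npair tri_double.
move=> A LA; suff TA : T *m A - A *m T = 0.
  apply: centralizer_hom; rewrite ?evA_gfam ?evA_even // => Y Yg Ye.
  have [B ->] := gfam_evenP Yg Ye.
  by rewrite evA_bracket thetaE trace_bracket TA mul0mx mxtrace0.
pose A' := P *m A *m invmx P; pose T' := P *m T *m invmx P.
have A'0 (i j : 'I_n) : (i < j)%N -> A' i j = 0.
  by move=> ij; have /ffunP/(_ (inl (exist _ (j, i) ij))) := LA; rewrite !ffunE.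
have T'0 (i j : 'I_n) : (i < j)%N -> T' i j = 0 by apply: low.
have E : P *m (T *m A - A *m T) *m invmx P = T' *m A' - A' *m T'.
  by rewrite mulmxBr mulmxBl /A' /T' !mulmxA !(mulmxKV Pu).
have D0 : T' *m A' - A' *m T' = 0.
  have lowM (X Y : 'M[k]_n) : (forall i j : 'I_n, (i < j)%N -> X i j = 0) ->
      (forall i j : 'I_n, (i < j)%N -> Y i j = 0) ->
      forall i j : 'I_n, (i <= j)%N -> (X *m Y) i j = (i == j)%:R * (X i i * Y i i).
    move=> X0 Y0 i j ij; rewrite mxE (bigD1 i) //= big1 ?addr0 => [|l li].
      have [->|ne] := eqVneq i j; first by rewrite mul1r.
      by rewrite Y0 ?mulr0 ?mul0r // ltn_neqAle ne.
    have [lt_il|le_li] := ltnP i l; first by rewrite X0 ?mul0r.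
    rewrite (Y0 l j) ?mulr0 //; apply: leq_trans ij.
    by rewrite ltn_neqAle le_li andbT val_eqE.
  apply/matrixP => i j; have [lt_ji|le_ij] := ltnP j i.
    have /ffunP/(_ (inr (exist _ (i, j) lt_ji))) := LA; rewrite !ffunE /= E => ->.
    by rewrite mxE.
  have X1 := lowM T' A' T'0 A'0 i j le_ij; have X2 := lowM A' T' A'0 T'0 i j le_ij.
  by rewrite mxE [X in _ + X]mxE X1 X2 [RHS]mxE [A' i i * _]mulrC subrr.
have : invmx P *m (P *m (T *m A - A *m T) *m invmx P) *m P = 0.
  by rewrite E D0 mulmx0 mul0mx.
by rewrite !mulmxA mulVmx // mul1mx mulmxKV.
Qed.

Lemma cent_evenP X : X \in (cent :&: gl_part k n false)%VS ->
  exists2 A, X = evA q A & T *m A = A *m T.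
Proof.
rewrite memv_cap => /andP[/centralizerP[Xg XY] Xe]; have [A AE] := gfam_evenP Xg Xe.
exists A => //; apply/eqP; rewrite -subr_eq0; apply/eqP/matrixP => i j.
rewrite -trace_delta -trace_bracket -thetaE -evA_bracket -AE XY ?evA_gfam //.
by rewrite mxE.
Qed.

End Form.

End KWMaximum.

Lemma dim_ge_inj (k : fieldType) (U V : vectType k) (W : {vspace V}) (f : U -> V) :
  linear f -> injective f -> (forall x, f x \in W) -> (\dim {:U} <= \dim W)%N.
Proof.
move=> f_lin f_inj fW; pose L (x : U) : {ffun 'I_0 -> k^o} := 0.
apply: (@dim_ge_ker k U V W _ 'I_0 f L) => //; last by rewrite card_ord addn0.
by move=> c x y; rewrite /L scaler0 addr0.
Qed.

Section KWOdd.
Variables (k : closedFieldType) (p n : nat).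
Hypothesis charp : p \in [pchar k].
Hypothesis p_odd : odd p.
Let two0 := two_neq0 charp p_odd.

Lemma mx_double0 (M : 'M[k]_n) : M + M = 0 -> M = 0.
Proof.
by move=> /eqP; rewrite -mulr2n -scaler_nat scaler_eq0 (negPf two0) => /eqP.
Qed.

Lemma trace_sym_alt (S C : 'M[k]_n) : S^T = S -> C^T = - C -> \tr (S *m C) = 0.
Proof.
move=> SE CE; apply/eqP; have : 2%:R * \tr (S *m C) = 0.
  rewrite mulr_natl mulr2n -{2}mxtrace_tr trmx_mul SE CE mulNmx linearN /=.
  by rewrite [\tr (C *m S)]mxtrace_mulC subrr.
by move/eqP; rewrite mulf_eq0 (negPf two0).
Qed.

Lemma dim_gfam_even q : \dim (gfam k n q :&: gl_part k n false) = (n * n)%N.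
Proof.
apply/anti_leq; rewrite -(dim_mx k n); apply/andP; split.
  apply: (@dim_le_inj k _ _ _ (fun X : 'M[k]_(n + n) => ulsubmx X)).
    by move=> c X Y; apply/matrixP => i j; rewrite !mxE.
  move=> X; rewrite memv_cap => /andP[Xg Xe]; have [A ->] := gfam_evenP Xg Xe.
  by rewrite block_mxKul => ->; apply: plin0 (@evA_lin k n q).
apply: (@dim_ge_inj k _ _ _ (evA q)); first exact: evA_lin.
  by move=> A B /(congr1 ulsubmx); rewrite !block_mxKul.
by move=> A; rewrite memv_cap evA_gfam evA_even.
Qed.

(** The sum of the two off-diagonal blocks identifies the odd part with all matrices: it recovers a
    symmetric plus an antisymmetric part in the periplectic case and twice the block in the queer
    case. *)
Lemma dim_gfam_odd q : \dim (gfam k n q :&: gl_part k n true) = (n * n)%N.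
Proof.
apply/anti_leq; rewrite -(dim_mx k n); apply/andP; split.
  apply: (@dim_le_inj k _ _ _ (fun X : 'M[k]_(n + n) => ursubmx X + dlsubmx X)).
    by move=> c X Y; apply/matrixP => i j; rewrite !mxE; ring.
  move=> X; rewrite memv_cap => /andP[Xg Xo]; have [B [C [-> BC]]] := gfam_oddP Xg Xo.
  rewrite block_mxKur block_mxKdl => S0; have B0 : B = 0.
    apply: mx_double0; move: S0 BC; case: (q) => [S0 CB|S0 [BE CE]]; first by rewrite CB in S0.
    have := congr1 trmx S0; rewrite raddfD /= trmx0 -BE => S1.
    have : B + C + (B + C^T) = 0 by rewrite S0 S1 addr0.
    by rewrite {1}CE addrACA addNr addr0.
  by move: S0; rewrite B0 add0r => ->; rewrite /block_mx !row_mx0 col_mx0.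
pose f (M : 'M[k]_n) := if q then qB M else pB M + pC M.
apply: (@dim_ge_inj k _ _ _ f).
- move=> c A B; rewrite /f; case: (q); first exact: qB_lin.
  by rewrite pB_lin pC_lin scalerDr addrACA.
- move=> A B E; have := congr1 ursubmx E; have := congr1 dlsubmx E.
  rewrite /f; case: (q); first by rewrite !block_mxKur.
  rewrite /pB /pC !add_block_mx !block_mxKur !block_mxKdl !addr0 !add0r => E1 E2.
  apply/eqP; rewrite -subr_eq0; apply/eqP/mx_double0.
  have : (A + A^T) + (A - A^T) = (B + B^T) + (B - B^T) by rewrite E1 E2.
  by rewrite [LHS]addrACA [RHS]addrACA !subrr !addr0 => E3; rewrite addrACA E3 -opprD subrr.
move=> A; rewrite memv_cap /f; case: (q); first by rewrite qB_gfam qB_odd.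
by rewrite !memvD ?pB_gfam ?pC_gfam ?pB_odd ?pC_odd.
Qed.

Lemma odd_bracket (B C B' C' : 'M[k]_n) :
  superbracket (block_mx 0 B C 0) (block_mx 0 B' C' 0) =
  block_mx (B *m C' + B' *m C) 0 0 (C *m B' + C' *m B).
Proof. by rewrite superbracket_block !(mul0mx, mulmx0, oppr0, addr0, add0r). Qed.

Section Periplectic.
Variables (theta : even_dual (gfam k n false)) (T : 'M[k]_n).
Hypothesis thetaE : forall A, extend_form theta (evA false A) = \tr (T *m A).

Lemma extend_form_odd_odd (B C B' C' : 'M[k]_n) : B^T = B -> C^T = - C -> B'^T = B' ->
  C'^T = - C' -> extend_form theta (superbracket (block_mx 0 B C 0) (block_mx 0 B' C' 0)) =
  \tr (T *m (B *m C' + B' *m C)).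
Proof.
move=> BE CE BE' CE'; rewrite odd_bracket -thetaE; congr (extend_form theta).
rewrite /evA /tau raddfD /= !trmx_mul BE CE BE' CE' opprD !mulNmx !opprK.
by rewrite [C' *m B + _]addrC.
Qed.

(** An element with upper block [M] stabilizes the form when [M] and T M are symmetric, because a
    symmetric times an antisymmetric matrix has trace zero. Symmetry of [M] makes T M - M T^t
    antisymmetric, so its lower entries suffice, and n(n-1) conditions are imposed in all. *)
Lemma dim_cent_odd : (n <= \dim (centralizer theta :&: gl_part k n true))%N.
Proof.
pose L (M : 'M[k]_n) : {ffun npair n + npair n -> k^o} := [ffun x => match x with
  | inl x => M (val x).1 (val x).2 - M (val x).2 (val x).1
  | inr x => (T *m M - M *m T^T) (val x).1 (val x).2 end].
apply: (@dim_ge_ker k _ _ _ n _ (fun M => block_mx 0 M 0 0) L).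
- move=> c A B; rewrite scale_block_mx add_block_mx !scaler0 !addr0 //.
- by move=> A B /(congr1 ursubmx); rewrite !block_mxKur.
- move=> c A B; apply/ffunP => -[x|x]; rewrite !ffunE.
    by rewrite !mxE /=; rewrite /GRing.scale /=; ring.
  rewrite (_ : T *m _ - _ = c *: (T *m A - A *m T^T) + (T *m B - B *m T^T)).
    by rewrite mxE [X in X + _]mxE.
  by rewrite mulmxDr mulmxDl -scalemxAr -scalemxAl scalerBr opprD addrACA.
- by rewrite dim_mx card_sum card_npair tri_double.
move=> M LM; have ME : M^T = M.
  suff H (i j : 'I_n) : (j < i)%N -> M j i = M i j.
    apply/matrixP => i j; rewrite mxE.
    by have [/H->|/H->|/val_inj->] := ltngtP i j.
  move=> ji; have /ffunP/(_ (inl (exist _ (i, j) ji))) := LM; rewrite !ffunE /= => /eqP.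
  by rewrite subr_eq0 => /eqP.
have TM : T *m M = M *m T^T.
  pose D := T *m M - M *m T^T; have DE : D^T = - D.
    by rewrite /D raddfB /= !trmx_mul ME trmxK opprB.
  suff D0 : D = 0 by apply/eqP; rewrite -subr_eq0 -/D D0.
  have Dlow (i j : 'I_n) : (j < i)%N -> D i j = 0.
    by move=> ji; have /ffunP/(_ (inr (exist _ (i, j) ji))) := LM; rewrite !ffunE.
  have Dt i j : D i j = - D j i by have /matrixP/(_ j i) := DE; rewrite !mxE.
  apply/matrixP => i j; rewrite [RHS]mxE; have [ij|/Dlow //|/val_inj <-] := ltngtP i j.
    by rewrite Dt Dlow ?oppr0.
  apply/eqP; have /eqP := Dt i i; rewrite -addr_eq0 -mulr2n -mulr_natl mulf_eq0.
  by rewrite (negPf two0).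
have Xg : block_mx 0 M 0 0 \in gfam k n false.
  by apply/periplecticP; exists 0, M, 0; rewrite ME !trmx0 !oppr0.
apply: centralizer_hom Xg _ _; first exact: block_anti_odd.
move=> Y Yg Yo; have [B' [C' [-> [BE CE]]]] := gfam_oddP Yg Yo.
rewrite extend_form_odd_odd ?trmx0 ?oppr0 //; last by rewrite [in RHS]CE opprK.
rewrite mulmx0 addr0 mulmxA; apply: trace_sym_alt; last by rewrite [in RHS]CE opprK.
by rewrite trmx_mul ME TM.
Qed.

End Periplectic.

(** The even orbit dimension, and the odd one in the periplectic case, are at most n^2 - n. In the
    queer case the odd one is at most n^2, and half of n^2 rounded up is n(n-1)/2 plus the ceiling
    of n/2. *)
Lemma kw_upper q (theta : even_dual (gfam k n q)) : (kw_number p theta <= kwdim p n q)%N.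
Proof.
have [T TE] := extend_form_evA theta; have p_pr := pcharf_prime charp.
have tri2 := tri_double n.
rewrite /kw_number /orbit_dim dim_gfam_even dim_gfam_odd /kwdim.
have le2 x : (n <= x)%N -> (n * n - x <= (tri n).*2)%N by rewrite -tri2 -addnn; lia.
apply: leq_mul.
  rewrite leq_pexp2l ?prime_gt0 // -[X in (_ <= X)%N]doubleK half_leq //.
  by apply: le2; apply: dim_cent_even TE.
rewrite leq_pexp2l //; case: q theta TE => theta TE.
  apply: leq_trans (uphalf_leq (leq_subr _ _)) _.
  rewrite -tri2 addnn !uphalf_half oddD odd_double addbF halfD odd_double andbF doubleK; lia.
rewrite -[X in (_ <= X)%N](uphalf_double (tri n)); apply/uphalf_leq/le2.
exact: dim_cent_odd TE.
Qed.

Section Regular.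
Variable t : 'I_n -> k.
Hypothesis t_inj : forall i j, i != j -> t i != t j.
Hypothesis t_add : forall i j, t i + t j != 0.
Let T : 'M[k]_n := diag_mx (\row_i t i).

Lemma diag_mulE (A : 'M[k]_n) i j : (T *m A) i j = t i * A i j.
Proof. by rewrite mul_diag_mx !mxE. Qed.

Lemma mul_diagE (A : 'M[k]_n) i j : (A *m T) i j = A i j * t j.
Proof. by rewrite mul_mx_diag !mxE. Qed.

Lemma diag_offdiag (x y c : k) : x != y -> x * c = c * y -> c = 0.
Proof.
move=> xy /eqP; rewrite [c * y]mulrC -subr_eq0 -mulrBl mulf_eq0 subr_eq0 (negPf xy).
by move/eqP.
Qed.

Lemma dim_cent_even_diag q (theta : even_dual (gfam k n q)) :
  (forall A, extend_form theta (evA q A) = \tr (T *m A)) ->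
  (\dim (centralizer theta :&: gl_part k n false) <= n)%N.
Proof.
move=> thetaE; apply: (@leq_trans (\dim {:'rV[k]_n})); last by rewrite dimvf /dim /= mul1n.
apply: (@dim_le_inj k _ _ _ (fun X : 'M[k]_(n + n) => \row_i (ulsubmx X) i i)).
  by move=> c X Y; apply/rowP => i; rewrite !mxE.
move=> X /(cent_evenP thetaE)[A -> TA] /rowP D0.
suff -> : A = 0 by apply: plin0 (@evA_lin k n q).
apply/matrixP => i j; rewrite [RHS]mxE; have [<-|ij] := eqVneq i j.
  by have := D0 i; rewrite mxE block_mxKul mxE.
by apply: (diag_offdiag (t_inj ij)); rewrite -diag_mulE TA mul_diagE.
Qed.

(** Pairing with the odd element of E_ji yields (t_i + t_j) B_ij. *)
Lemma dim_cent_odd_q (theta : even_dual (gfam k n true)) :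
  (forall A, extend_form theta (evA true A) = \tr (T *m A)) ->
  \dim (centralizer theta :&: gl_part k n true) = 0%N.
Proof.
move=> thetaE; apply/eqP; rewrite dimv_eq0 -subv0; apply/subvP => X.
rewrite memv_cap memv0 => /andP[/centralizerP[Xg XY] Xo].
have [B [C [XE CB]]] := gfam_oddP Xg Xo; rewrite /= in CB; subst C.
suff B0 : B = 0 by rewrite XE B0 /block_mx !row_mx0 col_mx0.
apply/matrixP => i j; rewrite [RHS]mxE; apply/eqP.
have := XY _ (qB_gfam (delta_mx j i)); rewrite XE odd_bracket.
rewrite (_ : block_mx _ _ _ _ = evA true (B *m delta_mx j i + delta_mx j i *m B)) //.
have E2 : \tr (T *m (delta_mx j i *m B)) = (B *m T) i j.
  by rewrite mxtrace_mulC -mulmxA mxtrace_mulC trace_delta.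
rewrite thetaE mulmxDr linearD /= E2 mulmxA trace_delta diag_mulE mul_diagE => /eqP.
by rewrite [B i j * _]mulrC -mulrDl mulf_eq0 (negPf (t_add i j)).
Qed.

(** Pairing with the antisymmetric and the symmetric generators yields (t_i - t_j) times B_ij and,
    up to sign, C_ij; so C vanishes and B is diagonal. *)
Lemma dim_cent_odd_p (theta : even_dual (gfam k n false)) :
  (forall A, extend_form theta (evA false A) = \tr (T *m A)) ->
  (\dim (centralizer theta :&: gl_part k n true) <= n)%N.
Proof.
move=> thetaE; apply: (@leq_trans (\dim {:'rV[k]_n})); last by rewrite dimvf /dim /= mul1n.
apply: (@dim_le_inj k _ _ _ (fun X : 'M[k]_(n + n) => \row_i (ursubmx X) i i)).
  by move=> c X Y; apply/rowP => i; rewrite !mxE.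
move=> X; rewrite memv_cap => /andP[/centralizerP[Xg XY] Xo] /rowP D0.
have [B [C [XE [BE CE]]]] := gfam_oddP Xg Xo.
have BT : B^T = B by rewrite -BE.
have CT : C^T = - C by rewrite [in RHS]CE opprK.
have Dt (i j : 'I_n) : (delta_mx i j)^T = delta_mx j i :> 'M[k]_n by apply: trmx_delta.
have B0 : B = 0.
  apply/matrixP => i j; rewrite [RHS]mxE; have [<-|ij] := eqVneq i j.
    by have := D0 i; rewrite XE mxE block_mxKur mxE.
  have := XY _ (pC_gfam (delta_mx j i)); rewrite XE (extend_form_odd_odd thetaE) ?trmx0 //.
    rewrite mul0mx addr0 mulmxA mulmxBr Dt linearB /= !trace_delta !diag_mulE => /eqP.
    rewrite subr_eq0 => /eqP.
    have -> : B j i = B i j by have /matrixP/(_ i j) := BT; rewrite mxE.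
    by rewrite [t j * _]mulrC; apply: diag_offdiag (t_inj ij).
  by rewrite raddfB /= trmxK opprB.
have C0 : C = 0.
  apply/matrixP => i j; rewrite [RHS]mxE.
  have CTE a b : C b a = - C a b by have /matrixP/(_ a b) := CT; rewrite !mxE.
  have [<-|ij] := eqVneq i j.
    apply/eqP; have /eqP := CTE i i; rewrite -addr_eq0 -mulr2n -mulr_natl mulf_eq0.
    by rewrite (negPf two0).
  have := XY _ (pB_gfam (delta_mx j i)); rewrite XE (extend_form_odd_odd thetaE) ?trmx0 ?oppr0 //.
    rewrite mulmx0 add0r mxtrace_mulC -mulmxA mxtrace_mulC mulmxDr Dt linearD /=.
    rewrite !trace_delta !mul_diagE [C j i]CTE mulNr => /eqP.
    by rewrite subr_eq0 eq_sym mulrC => /eqP; apply: diag_offdiag (t_inj ij).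
  by rewrite raddfD /= trmxK addrC.
by rewrite XE B0 C0 /block_mx !row_mx0 col_mx0.
Qed.

End Regular.

(** Equality in [kw_upper] is attained at the trace form of a diagonal matrix with generic
    entries. *)
Lemma kw_maximum q :
  is_maximum (fun theta : even_dual (gfam k n q) => kw_number p theta) (kwdim p n q).
Proof.
split; last exact: kw_upper.
have [t [t_inj t_add]] := generic_family n two0.
have [theta thetaE] := extend_form_onto q (diag_mx (\row_i t i)).
exists theta; apply/anti_leq; rewrite kw_upper /= /kw_number /orbit_dim.
rewrite dim_gfam_even dim_gfam_odd /kwdim.
have p_gt0 := prime_gt0 (pcharf_prime charp); have tri2 := tri_double n.
have le2 x : (x <= n)%N -> ((tri n).*2 <= n * n - x)%N by rewrite -tri2 -addnn; lia.
apply: leq_mul; rewrite leq_pexp2l //.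
  rewrite -[X in (X <= _)%N]doubleK half_leq //; apply: le2.
  exact: dim_cent_even_diag thetaE.
case: q theta thetaE => theta thetaE.
  rewrite (dim_cent_odd_q t_add thetaE) subn0.
  rewrite -tri2 addnn !uphalf_half oddD odd_double addbF halfD odd_double andbF doubleK; lia.
rewrite -[X in (X <= _)%N](uphalf_double (tri n)); apply/uphalf_leq/le2.
exact: dim_cent_odd_p thetaE.
Qed.

End KWOdd.

Theorem theorem4p11 (k : closedFieldType) (p : nat) (hchar : p \in [pchar k]%R)
  (hp : (2 < p)%N) (n : nat) (hn : (1 <= n)%N) (g : {vspace 'M[k]_(n + n)})
  (hg : g = periplectic k n \/ g = queer k n) :
  first_super_KW p g.
Proof.
have p_odd : odd p.
  by case: (even_prime (pcharf_prime hchar)) => // p2; rewrite p2 in hp.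
have kw q : first_super_KW p (gfam k n q).
  exists (kwdim p n q); split; first exact: kw_maximum.
  by split; [exact: exists_irreducible | move=> M; exact: irreducible_bound].
by case: hg => ->; [exact: (kw false) | exact: (kw true)].
Qed.
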